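(* For every $1\leq r\leq (\log n)^{O(1)}$, there exists an $r$-round one-sided $\varepsilon$-testing algorithm for $(1,3,2)$-freeness of sequences $f\colon[n]\to\mathbb{R}$ with query complexity $\tilde{O}\!\left(\varepsilon^{-1} n^{\frac{1}{r+1}}\right)$.
   Context: A sequence $f\colon[n]\to\mathbb{R}$ contains the pattern $(1,3,2)$ if there are $i<j<l$ with $f(i)<f(l)<f(j)$; otherwise it is $(1,3,2)$-free. $f$ is $\varepsilon$-far from $(1,3,2)$-freeness if more than $\varepsilon n$ values must be changed to make it $(1,3,2)$-free. A one-sided $\varepsilon$-test always accepts $(1,3,2)$-free inputs and rejects $\varepsilon$-far inputs with probability at least $2/3$. An $r$-round test proceeds in $r$ stages: in each stage it chooses a batch of queries that may depend only on answers received in previous stages (not on each other), then receives all answers; after the $r$ stages it accepts or rejects. Its query complexity is the total number of queries. $\tilde{O}$ hides factors polylogarithmic in $n$. *)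

(* Defs.v *)
From HB Require Import structures.
From mathcomp Require Import all_boot all_order all_algebra.
From mathcomp Require Import all_classical all_reals all_analysis.

Set Implicit Arguments.
Unset Strict Implicit.
Unset Printing Implicit Defensive.

Import Order.TTheory GRing.Theory Num.Theory.

Local Open Scope ring_scope.

Section Sequences.
Variables (R : realType) (n : nat).
Implicit Types (f g : 'I_n -> R) (eps : R).

Definition contains132 f : Prop :=
  exists i j l : 'I_n, [/\ (i < j)%N, (j < l)%N, f i < f l & f l < f j].

Definition free132 f : Prop := ~ contains132 f.

Definition far132 eps f : Prop :=
  forall g, free132 g -> eps * n%:R < #|[set i : 'I_n | f i != g i]|%:R.

End Sequences.

(* The answers received in one round, and the answers received in all completed
   rounds (oldest round first). *)
Definition answers (R : realType) (n : nat) := seq ('I_n * R).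
Definition history (R : realType) (n : nat) := seq (answers R n).

(* A randomized algorithm is a distribution [coin_pr] over a finite set [coins]
   of outcomes of its internal randomness. Given the coins and the answers of
   the previous rounds, [batch] is the list of positions queried in the next
   round; [verdict] is applied to the history of all rounds (true = accept).
   The index of the current round is the size of the history. *)
Record round_tester (R : realType) (n : nat) := RoundTester {
  coins : finType;
  coin_pr : coins -> R;
  coin_pr_ge0 : forall w, 0 <= coin_pr w;
  coin_pr_sum1 : \sum_(w : coins) coin_pr w = 1;
  batch : coins -> history R n -> seq 'I_n;
  verdict : coins -> history R n -> bool
}.

Section Runs.
Variables (R : realType) (n : nat) (T : round_tester R n).
Implicit Types (f : 'I_n -> R) (w : coins T).

Fixpoint run w f (k : nat) : history R n :=
  if k is k'.+1 then
    let h := run w f k' in rcons h [seq (i, f i) | i <- batch w h]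
  else [::].

Definition accepts (r : nat) w f : bool := verdict w (run w f r).

Definition num_queries (r : nat) w f : nat := sumn (map size (run w f r)).

Definition reject_pr (r : nat) f : R :=
  \sum_(w : coins T | ~~ accepts r w f) coin_pr w.

Definition one_sided_test132 (r : nat) (eps : R) : Prop :=
  (forall f, free132 f -> forall w, accepts r w f) /\
  (forall f, far132 eps f -> 2%:R / 3%:R <= reject_pr r f).

End Runs.

Definition log2 (R : realType) (x : R) : R := ln x / ln 2.

(* Main.v *)
(* A far sequence has many disjoint copies (i, j, l) of the pattern. Group them by
   the dyadic interval W at which i and l separate, and, up to powers of two, by
   the densities of the values below and above f(l) around i, j and l at every
   scale. Samples of the left half of W give a value below f(l) for half of the
   copies of W. If j lies in the right half of W, sampling two adjacent cells
   reveals f(j) > f(l). Otherwise one half of W provides a target: a sampled value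
   v playing the part of f(l), or a pair of values between which f(l) lies; the
   other half has to be searched for the missing part, at positions where the
   values cross the target. The search descends through cells of sizes
   2^(gam r), ..., 2^gam, 1 with 2^gam about n^(1/(r+1)), following the last cell
   in which a value on the early side of the target was sampled. Either it stays
   near the copy, or a value on the late side was sampled before one on the early
   side, and such an inversion completes a copy.

   This takes r + 1 levels. One round is saved by guessing a cell J of the top level
   and sampling in round 0 inside J as well; the targets that turn out to lead to J
   are pursued. A random cell is right with small probability, but a batch of
   targets shares the guess. Its size is tuned so that either a typical guess is hit
   by the batch with constant probability, or the hits of different targets are
   nearly disjoint and their probabilities add up; in both cases about
   n^(1/(r+1)) queries suffice. *)

Require Import Defs.
From mathcomp Require Import all_boot all_order all_algebra.
From mathcomp Require Import all_classical all_reals all_analysis.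
From mathcomp Require Import all_boot all_order all_algebra.
From mathcomp Require Import zify ring lra.

Set Implicit Arguments.
Unset Strict Implicit.
Unset Printing Implicit Defensive.

Import Order.TTheory GRing.Theory Num.Theory.

(** * Probability on finite types *)

(** Rare values are costly to search for: at density [2 ^ - m] every visited cell needs about
    [2 ^ m] samples. The compensation is that rarity of values forces rarity of copies. The exponent
    [m] is chosen minimal, so some count around a copy is at most [2 * 2 ^ (h - m)] in a cell of
    exponent [h], and the copy of a cell that is extreme in the right order has all the others of
    that cell in its count. The copies therefore spread over many top cells, and a guess succeeds
    about [2 ^ m] times more often. The rate [j] at which random targets serve copies rests on
    bounds of the same kind. The obstacle is the left half, where values above and below f(l) need
    not occur around the copy at all scales. They are compared with the rank density [2 ^ - b] of
    f(l) in the right half. At density at least [2 ^ - (b + 4)] they can steer a search of the left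
    half, with an extremal sampled value as target. Otherwise one side is so scarce that two
    neighbouring cells of the left half bracket f(l), or one of them is almost constantly f(l), and
    the right half is searched. *)

Section Probability.
Variable R : realFieldType.
Local Open Scope ring_scope.

Definition pr (T : finType) (P : pred T) : R := #|P|%:R / #|T|%:R.

Lemma pr_ge0 (T : finType) (P : pred T) : 0 <= pr P.
Proof. by rewrite divr_ge0 ?ler0n. Qed.

Lemma pr_le1 (T : finType) (P : pred T) : pr P <= 1.
Proof.
rewrite /pr; have [->|T0] := posnP #|T|; first by rewrite invr0 mulr0.
by rewrite ler_pdivrMr ?ltr0n // mul1r ler_nat max_card.
Qed.

Lemma eq_pr (T : finType) (P Q : pred T) : P =1 Q -> pr P = pr Q.
Proof. by move=> PQ; rewrite /pr (eq_card PQ). Qed.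

Lemma pr_mono (T : finType) (P Q : pred T) :
  (forall x, P x -> Q x) -> pr P <= pr Q.
Proof.
move=> PQ; rewrite ler_wpM2r ?invr_ge0 ?ler0n // ler_nat.
by apply/subset_leq_card/subsetP => x; apply: PQ.
Qed.

Lemma pr_predT (T : finType) : (0 < #|T|)%N -> pr (fun _ : T => true) = 1.
Proof. by move=> T0; rewrite /pr divff // pnatr_eq0 -lt0n. Qed.

Lemma pr_predC (T : finType) (P : pred T) :
  (0 < #|T|)%N -> pr (fun x => ~~ P x) = 1 - pr P.
Proof.
move=> T0; apply/eqP; rewrite -subr_eq opprK /pr -mulrDl -natrD addnC.
by rewrite (cardC P) divff // pnatr_eq0 -lt0n.
Qed.

Lemma pr_predU (T : finType) (P Q : pred T) :
  pr (fun x => P x || Q x) <= pr P + pr Q.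
Proof.
rewrite /pr -mulrDl -natrD ler_wpM2r ?invr_ge0 ?ler0n // ler_nat.
by rewrite -(cardUI P Q) leq_addr.
Qed.

Lemma pr_predI (T : finType) (P Q : pred T) (a b : R) : (0 < #|T|)%N ->
  1 - a <= pr P -> 1 - b <= pr Q -> 1 - (a + b) <= pr (fun x => P x && Q x).
Proof.
move=> T0 Pa Qb.
have H := pr_predU (fun x => ~~ P x) (fun x => ~~ Q x).
have E : pr (fun x => ~~ P x || ~~ Q x) = 1 - pr (fun x => P x && Q x).
  by rewrite -(pr_predC _ T0); apply: eq_pr => x; rewrite negb_and.
by move: H; rewrite E !(pr_predC _ T0); lra.
Qed.

Lemma pr_has (T : finType) (J : Type) (s : seq J) (Q : J -> pred T) (d : R) :
  (forall j, pr (Q j) <= d) ->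
  pr (fun x => has (fun j => Q j x) s) <= (size s)%:R * d.
Proof.
move=> Qd; elim: s => [|j s IH] /=.
  by rewrite /pr (eq_card (B := pred0)) // card0 !mul0r.
apply: le_trans (pr_predU _ _) _.
by rewrite -natr1 mulrDl mul1r addrC lerD.
Qed.

(** Double counting: each [x] is charged to at most one [j]. This is how the success probabilities
    of mutually exclusive targets add up. *)
Lemma pr_disjoint (T J : finType) (A : pred J) (P : pred T) (Q : J -> pred T) :
  (forall j x, A j -> Q j x -> P x) ->
  (forall i j x, A i -> A j -> Q i x -> Q j x -> i = j) ->
  \sum_(j | A j) pr (Q j) <= pr P.
Proof.
move=> QP Qi; rewrite /pr -mulr_suml ler_wpM2r ?invr_ge0 ?ler0n //.
rewrite -natr_sum ler_nat.
under eq_bigr do rewrite -sum1_card big_mkcond.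
rewrite exchange_big /= -sum1_card [leqRHS]big_mkcond /=.
apply: leq_sum => x _.
have [/existsP[j /andP[Aj Qjx]]|nex] := boolP [exists j, A j && Q j x].
  have Px := QP _ _ Aj Qjx.
  rewrite (bigD1 j) //= big1 => [|i /andP[Ai ij]].
    by rewrite !unfold_in Qjx Px.
  by rewrite unfold_in; case: ifP => // Qix; rewrite (Qi i j x) ?eqxx in ij.
rewrite big1 // => j Aj; rewrite unfold_in; case: ifP => // Qjx.
by case/existsP: nex; exists j; rewrite Aj.
Qed.

Lemma pr_pairE (S T : finType) (Q : S -> pred T) :
  pr (fun x : S * T => Q x.1 x.2) = (\sum_a pr (Q a)) / #|S|%:R.
Proof.
rewrite /pr card_prod natrM -mulr_suml -mulrA -invfM [X in _ = _ / X]mulrC.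
congr (_ / _); rewrite -natr_sum; congr _%:R.
rewrite -sum1_card (eq_bigl (fun p : S * T => predT p.1 && Q p.1 p.2)) //.
rewrite -(pair_big_dep predT (fun a b => Q a b) (fun _ _ => 1%N)) /=.
by apply: eq_bigr => a _; rewrite sum1_card.
Qed.

Lemma pr_pair_sum (S T : finType) (Q : S -> pred T) (A : pred S) (c : S -> R) :
  (forall a, A a -> c a <= pr (Q a)) ->
  (\sum_(a | A a) c a) / #|S|%:R <= pr (fun x : S * T => Q x.1 x.2).
Proof.
move=> H; rewrite pr_pairE ler_wpM2r ?invr_ge0 ?ler0n //.
rewrite big_mkcond; apply: ler_sum => a _.
by case: ifP => [/H|_] //; exact: pr_ge0.
Qed.

Lemma pr_pair_ge (S T : finType) (Q : S -> pred T) (A : pred S) (c : R) :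
  (forall a, A a -> c <= pr (Q a)) ->
  pr A * c <= pr (fun x : S * T => Q x.1 x.2).
Proof.
move=> H; apply: le_trans (pr_pair_sum (c := fun _ => c) H).
by rewrite (eq_bigl (mem A)) // sumr_const -(mulr_natl c) /pr mulrAC.
Qed.

Lemma pr_pair_le (S T : finType) (Q : S -> pred T) (c : R) : 0 <= c ->
  (forall a, pr (Q a) <= c) -> pr (fun x : S * T => Q x.1 x.2) <= c.
Proof.
move=> c0 H; rewrite pr_pairE.
have [->|S0] := posnP #|S|; first by rewrite invr0 mulr0.
rewrite ler_pdivrMr ?ltr0n //.
apply: (@le_trans _ _ (\sum_(a : S) c)); first by apply: ler_sum.
by rewrite sumr_const mulr_natr.
Qed.

Lemma pr_swap (S T : finType) (Q : S -> T -> bool) :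
  pr (fun x : S * T => Q x.1 x.2) = pr (fun x : T * S => Q x.2 x.1).
Proof.
rewrite (pr_pairE Q) (pr_pairE (fun b => Q^~ b)) /pr -!mulr_suml -!mulrA.
rewrite -!invfM [X in _ = _ / X]mulrC -!natr_sum; congr (_%:R / _).
under eq_bigr do rewrite -sum1_card big_mkcond.
by rewrite exchange_big /=; apply: eq_bigr => b _; rewrite -sum1_card -big_mkcond.
Qed.

Lemma pr_snd (S T : finType) (P : pred T) : (0 < #|S|)%N ->
  pr (fun x : S * T => P x.2) = pr P.
Proof.
move=> S0; rewrite (pr_pairE (fun _ : S => P)) sumr_const -(mulr_natl (pr P)).
by rewrite mulrAC divff ?mul1r // pnatr_eq0 -lt0n.
Qed.

Lemma pr_fst (S T : finType) (P : pred S) : (0 < #|T|)%N ->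
  pr (fun x : S * T => P x.1) = pr P.
Proof. by move=> T0; rewrite (pr_swap (fun a _ => P a)) pr_snd. Qed.

(** The coordinates of a uniformly random function are independent, because the cardinality of
    [family] is a product. *)
Lemma pr_ffun_fam (J T : finType) (P : J -> pred T) :
  pr (fun f : {ffun J -> T} => [forall j, P j (f j)]) = \prod_j pr (P j).
Proof.
rewrite /pr prodf_div; congr (_ / _).
  rewrite -natr_prod; congr _%:R.
  transitivity #|family P|; last by rewrite card_family foldrE big_image.
  apply: eq_card => f; apply/forallP/familyP => H j; exact: H.
by rewrite card_ffun prodr_const natrX.
Qed.

Lemma pr_ffun_all (J T : finType) (P : pred T) :
  pr (fun f : {ffun J -> T} => [forall j, P (f j)]) = pr P ^+ #|J|.
Proof. by rewrite (pr_ffun_fam (fun _ => P)) prodr_const. Qed.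

Lemma pr_ffun_sub (J T : finType) (A : pred J) (P : pred T) :
  (0 < #|T|)%N ->
  pr (fun f : {ffun J -> T} => [forall j, A j ==> P (f j)]) = pr P ^+ #|A|.
Proof.
move=> T0; rewrite (pr_ffun_fam (fun j x => A j ==> P x)).
rewrite (bigID A) /= [X in _ * X]big1 ?mulr1 => [|j /negPf Aj].
  rewrite -prodr_const; apply: eq_bigr => j Aj.
  by apply: eq_pr => x; rewrite Aj.
by rewrite (eq_pr (Q := fun=> true)) ?pr_predT // => x; rewrite Aj.
Qed.

Lemma pr_ffun_coord (J T : finType) (j : J) (P : pred T) : (0 < #|T|)%N ->
  pr (fun f : {ffun J -> T} => P (f j)) = pr P.
Proof.
move=> T0; rewrite -[RHS]expr1 -(card1 j) -pr_ffun_sub //.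
apply: eq_pr => f; apply/idP/forallP => [Pf i|/(_ j)].
  by apply/implyP => /= /eqP ->.
by rewrite /= eqxx.
Qed.

(** A rational substitute for [exp (- k x)], so that all failure bounds make sense in any real
    field. The induction step is [(1 - x) (1 + (k + 1) x) <= 1 + k x]. *)
Lemma bernoulli_inv (x : R) (k : nat) :
  0 <= x <= 1 -> (1 - x) ^+ k <= (1 + k%:R * x)^-1.
Proof.
move=> /andP[x0 x1]; have kx n : 0 < 1 + n%:R * x.
  by rewrite ltr_wpDr // mulr_ge0.
rewrite -[leRHS]mul1r ler_pdivlMr //.
elim: k => [|k IH]; first by rewrite expr0 mul0r addr0 mul1r.
apply: le_trans IH; rewrite exprSr -mulrA.
rewrite ler_wpM2l ?exprn_ge0 ?subr_ge0 // -natr1.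
have := mulr_ge0 (mulr_ge0 (ler0n R k.+1) x0) x0.
by rewrite -natr1; nra.
Qed.

Lemma bernoulli_sub (x : R) (k : nat) : 0 <= x <= 1 -> 1 - k%:R * x <= (1 - x) ^+ k.
Proof.
move=> /andP[x0 x1]; elim: k => [|k IH]; first by rewrite mul0r subr0.
rewrite exprS -natr1.
have : (1 - x) * (1 - k%:R * x) <= (1 - x) * (1 - x) ^+ k.
  by rewrite ler_wpM2l ?subr_ge0.
apply: le_trans; have := mulr_ge0 (mulr_ge0 (ler0n R k) x0) x0; nra.
Qed.

Lemma pr_repeat (T : finType) (P : pred T) (k : nat) (p : R) : (0 < #|T|)%N ->
  0 <= p -> p <= pr P ->
  1 - (1 + k%:R * p)^-1 <= pr (fun f : {ffun 'I_k -> T} => [exists i, P (f i)]).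
Proof.
move=> T0 p0 pP.
have F0 : (0 < #|{: {ffun 'I_k -> T}}|)%N by rewrite card_ffun expn_gt0 T0.
rewrite (eq_pr (Q := fun f : {ffun 'I_k -> T} => ~~ [forall i, ~~ P (f i)])); last first.
  by move=> f; rewrite negb_forall; apply: eq_existsb => i; rewrite negbK.
rewrite (pr_predC _ F0) lerD2l lerN2 (pr_ffun_all _ (fun x => ~~ P x)) card_ord pr_predC //.
have p1 := le_trans pP (pr_le1 P).
apply: le_trans (bernoulli_inv k _); last by rewrite p0 p1.
by rewrite lerXn2r ?nnegrE ?subr_ge0 ?pr_le1 // lerD2l lerN2.
Qed.

Lemma pr_markov (T J : finType) (Q : J -> pred T) (B : nat) :
  pr (fun x => (B <= #|[pred j | Q j x]|)%N) * B%:R <= \sum_j pr (Q j).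
Proof.
rewrite /pr -mulr_suml mulrAC ler_wpM2r ?invr_ge0 ?ler0n //.
rewrite -natr_sum -natrM ler_nat.
under [leqRHS]eq_bigr do rewrite -sum1_card big_mkcond.
rewrite exchange_big /= -sum_nat_const big_mkcond.
apply: leq_sum => x _; rewrite unfold_in; case: ifP => // /leq_trans; apply.
by rewrite -sum1_card -big_mkcond.
Qed.

End Probability.

(** * Counting in dyadic cells *)

Section Counting.

Lemma pigeonhole (I L : finType) (T : {set I}) (P : L -> pred I) :
  (0 < #|T|)%N -> (forall i, i \in T -> exists l, P l i) ->
  exists l, (#|T| <= #|L| * #|[set i in T | P l i]|)%N.
Proof.
move=> T0 HP; have [i0 i0T] := card_gt0P T0; have [l0 _] := HP _ i0T.
apply/existsP; apply: contraT; rewrite negb_exists => /forallP H.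
have : (#|T| <= \sum_l #|[set i in T | P l i]|)%N.
  rewrite -sum1_card.
  under [leqRHS]eq_bigr do rewrite -sum1_card big_mkcond.
  rewrite exchange_big /= [leqLHS]big_mkcond; apply: leq_sum => i _.
  case: ifP => // iT; have [l Pl] := HP _ iT.
  by rewrite (bigD1 l) //= inE iT Pl.
have L0 : (0 < #|L|)%N by apply/card_gt0P; exists l0.
have {}H l : (#|L| * #|[set i in T | P l i]| < #|T|)%N by rewrite ltnNge H.
rewrite -(leq_pmul2l L0) big_distrr /= -sum_nat_const leqNgt => /negP[].
rewrite (bigD1 l0) //= [ltnRHS](bigD1 l0) //= -addSn leq_add ?H //.
by apply: leq_sum => l _; exact: ltnW.
Qed.

Lemma median (d : Order.disp_t) (V : orderType d) (I : finType) (A : {set I})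
    (key : I -> V) : A != set0 ->
  exists a, (#|A| <= 2 * #|[set i in A | key i <= a]%O|)%N /\
            (#|A| <= 2 * #|[set i in A | a <= key i]%O|)%N.
Proof.
case/set0Pn => i0 i0A.
(* The median is the smallest key with at least half of [A] at or below it. The largest key under it
   has less than half at or below, so at least half of [A] is at or above the median. *)
pose C j := (j \in A) && (#|A| <= 2 * #|[set i in A | key i <= key j]%O|)%N.
have [jm jmA jmax] := @Order.TotalTheory.arg_maxP _ _ I i0 (mem A) key i0A.
have {}jmA : jm \in A by [].
have Cjm : C jm.
  rewrite /C jmA (_ : [set i in A | _] = A) ?leq_pmull //.
  by apply/setP => i; rewrite inE; case iA: (i \in A) => //=; exact: jmax.
case: (@Order.TotalTheory.arg_minP _ _ I jm C key Cjm) => j /andP[jA Cj] /= jmin.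
exists (key j); split=> //.
pose L := [set i in A | key i < key j]%O.
have EA : #|A| = (#|L| + #|[set i in A | key j <= key i]%O|)%N.
  rewrite -(cardsID L A); congr addn; apply: eq_card => i; rewrite !inE.
    by case: (i \in A).
  by case: (i \in A); rewrite ?andbF //= andbT -leNgt.
suff : (2 * #|L| <= #|A|)%N by rewrite EA; lia.
have [->|/set0Pn[k kL]] := eqVneq L set0; first by rewrite cards0.
case: (@Order.TotalTheory.arg_maxP _ _ I k (mem L) key kL) => l lL lmax.
have : l \in L by []; rewrite inE => /andP[lA lj].
have NC : ~~ C l by apply: contraL lj => /jmin; rewrite -leNgt.
move: NC; rewrite /C lA -ltnNge => /ltnW; apply: leq_trans.
rewrite leq_mul2l subset_leq_card //; apply/subsetP => i iL.
by move: (iL); rewrite !inE => /andP[-> _] /=; exact: lmax.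
Qed.

End Counting.

Section Dyadic.
Implicit Types (h z e : nat) (P Q : pred nat).

Definition cell h z : seq nat := iota (z * 2 ^ h) (2 ^ h).
Definition cnt h z P : nat := count P (cell h z).
(** Reduction modulo [2 ^ h] turns one uniform coin of [pos e] into a uniform position of any cell
    of exponent [h <= e]; the same coin type serves all scales. *)
Definition smp h z (y : nat) : nat := z * 2 ^ h + y %% 2 ^ h.
(** This is ['I_(2 ^ e)] in successor form, so that [inord] and [ord0] apply. *)
Definition pos e := 'I_(2 ^ e).-1.+1.

Lemma mem_cell h z p : (p \in cell h z) = (p %/ 2 ^ h == z).
Proof.
have h0 : 0 < 2 ^ h by rewrite expn_gt0.
by rewrite mem_iota -mulSnr eqn_leq leq_divRL // -[p %/ _ <= z]ltnS ltn_divLR // andbC.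
Qed.

Lemma smp_div h z y : smp h z y %/ 2 ^ h = z.
Proof.
have h0 : 0 < 2 ^ h by rewrite expn_gt0.
by rewrite /smp divnMDl // divn_small ?addn0 // ltn_mod.
Qed.

Lemma smp0 z y : smp 0 z y = z.
Proof. by rewrite /smp expn0 modn1 muln1 addn0. Qed.

Lemma card_pos e : #|{: pos e}| = 2 ^ e.
Proof. by rewrite card_ord prednK // expn_gt0. Qed.

Lemma pos_gt0 e : 0 < #|{: pos e}|.
Proof. by rewrite card_pos expn_gt0. Qed.

Lemma eq_cnt h z P Q : (forall p, p \in cell h z -> P p = Q p) -> cnt h z P = cnt h z Q.
Proof. by move=> H; apply: eq_in_count. Qed.

Lemma cnt_mono h z P Q : (forall p, p \in cell h z -> P p -> Q p) -> cnt h z P <= cnt h z Q.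
Proof.
move=> H; rewrite (eq_cnt (Q := predI P Q)) => [|p /H /=]; last first.
  by case: (P p) => //= ->.
by apply: sub_count => p /andP[].
Qed.

Lemma cnt_le h z P : cnt h z P <= 2 ^ h.
Proof. by rewrite -[leqRHS](size_iota (z * 2 ^ h)) count_size. Qed.

Lemma cnt_predC h z P : cnt h z P + cnt h z (predC P) = 2 ^ h.
Proof. by rewrite count_predC size_iota. Qed.

Lemma cnt_gt0 h z P p : p %/ 2 ^ h = z -> P p -> 0 < cnt h z P.
Proof. by move=> pz Pp; rewrite -has_count; apply/hasP; exists p; rewrite ?mem_cell ?pz. Qed.

Lemma count_mod P m k :
  count (fun y => P (y %% m)) (iota 0 (k * m)) = k * count P (iota 0 m).
Proof.
elim: k => [|k IH]; first by rewrite !mul0n.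
rewrite !mulSnr iotaD count_cat IH add0n; congr (_ + _).
rewrite -[k * m]addn0 iotaDl count_map; apply: eq_in_count => y; rewrite mem_iota /= add0n => ym.
by rewrite /= modnMDl modn_small.
Qed.

Lemma pr_smp (R : realFieldType) e h z P : h <= e ->
  pr R (fun y : pos e => P (smp h z y)) = ((cnt h z P)%:R / (2 ^ h)%:R)%R.
Proof.
move=> he; rewrite /pr card_pos.
have -> : #|[pred y : pos e | P (smp h z y)]| = 2 ^ (e - h) * cnt h z P.
  rewrite -sum1_card (eq_bigl (fun y : pos e => P (smp h z y))) //.
  rewrite -(big_mkord (fun y => P (smp h z y)) (fun=> 1%N)) sum1_count.
  rewrite /index_iota subn0 prednK ?expn_gt0 // -{1}(subnK he) expnD.
  rewrite (count_mod (fun y => P (z * 2 ^ h + y))); congr (_ * _).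
  by rewrite /cnt /cell -[z * 2 ^ h]addn0 iotaDl count_map addn0.
rewrite -{2}(subnK he) expnD !natrM -mulf_div divff; first by rewrite mul1r.
by rewrite pnatr_eq0 -lt0n expn_gt0.
Qed.

Lemma pr_smp_hit (R : realFieldType) e h z P s : h <= e ->
  (1 - (1 + s%:R * ((cnt h z P)%:R / (2 ^ h)%:R))^-1 <=
   pr R (fun f : {ffun 'I_s -> pos e} => [exists i, P (smp h z (f i))]))%R.
Proof.
move=> he; apply: (pr_repeat (P := fun y : pos e => P (smp h z y))).
- exact: pos_gt0.
- by rewrite divr_ge0 // ler0n.
- by rewrite pr_smp.
Qed.

(** Descend to the smallest dyadic cell containing both positions: its two halves separate them, and
    the left half has an even index. *)
Lemma dyadic_split e p q : p < q -> p %/ 2 ^ e = q %/ 2 ^ e ->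
  exists w, [/\ w < e, q %/ 2 ^ w = (p %/ 2 ^ w).+1 & ~~ odd (p %/ 2 ^ w)].
Proof.
elim: e => [|e IH] pq; first by rewrite expn0 !divn1 => E; rewrite E ltnn in pq.
have [/(IH pq)[w [we E o]] _|ne] := eqVneq (p %/ 2 ^ e) (q %/ 2 ^ e).
  by exists w; rewrite ltnS ltnW.
rewrite expnSr !divnMA => E; exists e; split=> //.
- have le : p %/ 2 ^ e <= q %/ 2 ^ e by rewrite leq_div2r // ltnW.
  by move: ne le E; rewrite !divn2; lia.
- have le : p %/ 2 ^ e <= q %/ 2 ^ e by rewrite leq_div2r // ltnW.
  by move: ne le E; rewrite !divn2; lia.
Qed.

Lemma divn_exp2 p h h' : h' <= h -> p %/ 2 ^ h' %/ 2 ^ (h - h') = p %/ 2 ^ h.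
Proof. by move=> hh; rewrite -divnMA -expnD subnKC. Qed.

Lemma card_le_cnt (I : finType) (A : {set I}) (g : I -> nat) h z P :
  injective g -> (forall i, i \in A -> g i %/ 2 ^ h = z /\ P (g i)) ->
  #|A| <= cnt h z P.
Proof.
move=> gi H; rewrite cardE -(size_map g) /cnt -size_filter.
apply: uniq_leq_size; first by rewrite map_inj_uniq ?enum_uniq.
move=> p /mapP[i]; rewrite mem_enum => /H[gz Pg] ->.
by rewrite mem_filter Pg mem_cell gz eqxx.
Qed.

Lemma cell_split h h' z : h' <= h ->
  cell h z = flatten [seq cell h' z' | z' <- iota (z * 2 ^ (h - h')) (2 ^ (h - h'))].
Proof.
move=> hh; rewrite /cell -{1 2}(subnK hh) expnD mulnA.
move: (z * _) => a; move: (2 ^ (h - h')) => k.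
elim: k a => [|k IH] a; first by rewrite mul0n.
by rewrite mulSn iotaD /= -IH mulSnr.
Qed.

Lemma cnt_split h h' z P : h' <= h ->
  cnt h z P = \sum_(z' <- iota (z * 2 ^ (h - h')) (2 ^ (h - h'))) cnt h' z' P.
Proof.
by move=> hh; rewrite /cnt (cell_split _ hh) count_flatten sumnE -map_comp big_map.
Qed.

(** Averaging: if every subcell had density below [2 ^ - m], so would the cell. *)
Lemma dense_subcell h h' z P m : h' <= h -> 2 ^ h <= cnt h z P * 2 ^ m ->
  exists z', z' %/ 2 ^ (h - h') = z /\ 2 ^ h' <= cnt h' z' P * 2 ^ m.
Proof.
move=> hh H; case: (boolP (has (fun z' => 2 ^ h' <= cnt h' z' P * 2 ^ m)
    (cell (h - h') z))).
  by move=> /hasP[z' z'c Hz]; exists z'; move: z'c; rewrite mem_cell => /eqP.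
move=> /hasPn N; move: H; rewrite leqNgt (cnt_split z P hh) -[iota _ _]/(cell (h - h') z).
have -> : 2 ^ h = size (cell (h - h') z) * 2 ^ h' by rewrite size_iota -expnD subnK.
have : cell (h - h') z != [::] by rewrite -size_eq0 size_iota -lt0n expn_gt0.
rewrite big_distrl /= => c0 /negP[]; elim: (cell _ _) N c0 => // a s IH N _.
rewrite big_cons /= mulSn.
have Na : cnt h' a P * 2 ^ m < 2 ^ h' by rewrite ltnNge N ?inE ?eqxx.
have [->|s0] := eqVneq s [::]; first by rewrite big_nil mul0n !addn0.
rewrite -addSn leq_add // ltnW // IH // => x xs.
by apply: N; rewrite inE xs orbT.
Qed.

(** The minimal admissible [u] rounds the density [c / 2 ^ h] down to a power of two; minimality
    gives the upper bound. *)
Lemma bucket c h : 0 < c <= 2 ^ h ->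
  exists u, [/\ u <= h, 2 ^ h <= c * 2 ^ u & c * 2 ^ u <= 2 * 2 ^ h].
Proof.
case/andP=> c0 ch; have ex : exists u, 2 ^ h <= c * 2 ^ u.
  by exists h; rewrite leq_pmull.
case: (ex_minnP ex) => u Hu umin; exists u; split=> //.
  by apply: umin; rewrite leq_pmull.
case: u Hu umin => [|u] Hu umin.
  by rewrite muln1 (leq_trans ch) // leq_pmull.
have : ~~ (2 ^ h <= c * 2 ^ u) by apply/negP => /umin; rewrite ltnn.
by rewrite -ltnNge expnS mulnCA leq_mul2l => /ltnW ->.
Qed.

End Dyadic.

(** * The search through the levels *)

Section Search.
Variables (lam gam r zD : nat) (sl : nat -> nat -> seq nat).

Definition ex t := minn lam (gam * t).

(** The focus is accurate up to one cell, and the wanted child may be a neighbour of the child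
    holding the copy, hence lie one parent further: so the window has the five parents [c - 2] to
    [c + 2]. Truncation of [c - 2] at 0 only extends the window on the right. *)
Definition kids t c : seq nat :=
  [seq z <- iota ((c - 2) * 2 ^ (ex t.+1 - ex t)) (5 * 2 ^ (ex t.+1 - ex t))
   | z %/ 2 ^ (lam - ex t) == zD].

Definition qlev t c : seq nat := flatten [seq sl t z | z <- kids t c].

(** The default, the first child, is for a crossing that precedes every sample. *)
Definition focus (A : pred nat) t c : nat :=
  last (head 0 (kids t c)) [seq z <- kids t c | has A (sl t z)].

Fixpoint focusn (A : pred nat) k : nat :=
  if k is k'.+1 then focus A (r - k') (focusn A k') else zD.

(** [A], [B] and [C] will be the positions whose values are [before], [after] and [found]. The
    expected order is [A] then [B], so a [B] followed by an [A] is the inversion. *)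
Definition wins (A B C : pred nat) (Q : seq nat) : bool :=
  has C Q || has (fun p => B p && has (fun p' => (p < p') && A p') Q) Q.

Definition near (a b : nat) := (a <= b.+1) && (b <= a.+1).

Lemma ex_le t : ex t <= lam. Proof. exact: geq_minl. Qed.

Lemma ex_mono t t' : t <= t' -> ex t <= ex t'.
Proof. by move=> h; rewrite /ex leq_min geq_minl geq_min leq_mul2l h !orbT. Qed.

Lemma ex_step t : ex t.+1 - ex t <= gam.
Proof. by rewrite /ex mulnS; lia. Qed.

Lemma size_kids t c : size (kids t c) <= 5 * 2 ^ gam.
Proof.
rewrite size_filter (leq_trans (count_size _ _)) // size_iota leq_mul2l /=.
by rewrite leq_exp2l // ex_step.
Qed.

Lemma kids_sorted t c : sorted leq (kids t c).
Proof. by rewrite sorted_filter ?iota_sorted //; exact: leq_trans. Qed.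

Lemma mem_kids t c z :
  c <= (z %/ 2 ^ (ex t.+1 - ex t)).+2 -> z %/ 2 ^ (ex t.+1 - ex t) <= c.+2 ->
  z %/ 2 ^ (lam - ex t) = zD -> z \in kids t c.
Proof.
move=> H1 H2 zd; rewrite mem_filter zd eqxx /= mem_iota.
have d0 : 0 < 2 ^ (ex t.+1 - ex t) by rewrite expn_gt0.
rewrite -leq_divRL // -mulnDl -ltn_divLR //.
by move: H1 H2; move: (z %/ _) => q; lia.
Qed.

Lemma kids_dom t c z : z \in kids t c -> z %/ 2 ^ (lam - ex t) = zD.
Proof. by rewrite mem_filter => /andP[/eqP]. Qed.

Lemma sorted_last (s : seq nat) x d : sorted leq s -> x \in s -> x <= last d s.
Proof.
elim: s d => // a s IH d /= ps; rewrite inE => /orP[/eqP->|xs].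
  rewrite {IH}; elim: s a ps => //= b s IH a /andP[ab /IH]; exact: leq_trans.
by case: s ps xs IH => // b s /= /andP[_ ps] xs IH; exact: IH.
Qed.

Lemma sorted_head (s : seq nat) x d : sorted leq s -> x \in s -> head d s <= x.
Proof.
case: s => // a s /= ps; rewrite inE => /orP[/eqP->//|xs].
by move: ps => /(order_path_min leq_trans)/allP/(_ x xs).
Qed.

Lemma near_div a b d : 0 < d -> near a b -> near (a %/ d) (b %/ d).
Proof.
move=> d0 /andP[ab ba]; have H x y : x <= y.+1 -> x %/ d <= (y %/ d).+1.
  by move=> /(leq_div2r d) /leq_trans; apply; rewrite divnS //; case: (_ %| _).
by rewrite /near !H.
Qed.

Section Chain.
Variables (A B C : pred nat) (u tmin : nat).
Let zz t := u %/ 2 ^ ex t.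
Hypothesis top : lam <= gam * r.+1.
Hypothesis slP : forall t z p, p \in sl t z -> p %/ 2 ^ ex t = z.
Hypothesis uD : u %/ 2 ^ lam = zD.
Hypothesis tmin_bd : 0 < tmin <= r.+1.
(** Both sides of the target show up in the cell of [u] or next to it, except at the borders of the
    domain: the focus cannot fall behind the first cell or overtake the last one. [tmin] is the
    finest level at which this is required. *)
Hypothesis HA : forall t, tmin <= t <= r ->
  zz t = zD * 2 ^ (lam - ex t) \/
  exists z, [/\ near z (zz t), z %/ 2 ^ (lam - ex t) = zD & has (predU A C) (sl t z)].
Hypothesis HB : forall t, tmin <= t <= r ->
  (zz t).+1 = zD.+1 * 2 ^ (lam - ex t) \/
  exists z, [/\ near z (zz t), z %/ 2 ^ (lam - ex t) = zD & has (predU B C) (sl t z)].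

Let step k := qlev (r - k) (focusn A k).

Lemma ex_top : ex r.+1 = lam. Proof. by apply/minn_idPl. Qed.

Lemma zz_dom t : zz t %/ 2 ^ (lam - ex t) = zD.
Proof. by rewrite /zz divn_exp2 ?ex_le. Qed.

Lemma zz_kids t c z : near c (zz t.+1) -> near z (zz t) ->
  z %/ 2 ^ (lam - ex t) = zD -> z \in kids t c.
Proof.
move=> nc nz zd; have d0 : 0 < 2 ^ (ex t.+1 - ex t) by rewrite expn_gt0.
have := near_div d0 nz; rewrite /zz divn_exp2 ?ex_mono // -/(zz t.+1) => nz'.
apply: mem_kids => //; move: nc nz'; rewrite /near; move: (z %/ _) (zz _) => a b; lia.
Qed.

Lemma mem_qlev t c z p : z \in kids t c -> p \in sl t z -> p \in qlev t c.
Proof. by move=> zk ps; apply/flattenP; exists (sl t z) => //; apply: map_f. Qed.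

Lemma focus_in (A' : pred nat) t c z : z \in kids t c -> focus A' t c \in kids t c.
Proof.
move=> zk; rewrite /focus; set L := [seq _ <- _ | _].
have := mem_last (head 0 (kids t c)) L; rewrite inE => /orP[/eqP->|].
  by case: (kids t c) zk => //= a s _; rewrite inE eqxx.
by rewrite mem_filter => /andP[].
Qed.

(** The sample in [A] next to [u] bounds the focus from below, the one in [B] bounds it from
    above. *)
Lemma focus_near t c : tmin <= t <= r -> near c (zz t.+1) ->
  wins A B C (qlev t c) \/ near (focus A t c) (zz t).
Proof.
move=> tb nc; have [w|nw] := boolP (wins A B C (qlev t c)); [by left|right].
have nearzz : near (zz t) (zz t) by rewrite /near; lia.
have zk := zz_kids nc nearzz (zz_dom t).
set L := [seq z <- kids t c | has A (sl t z)].
have Ls : sorted leq L by rewrite sorted_filter ?kids_sorted //; exact: leq_trans.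
have fk := focus_in A zk.
have noC z p : z \in kids t c -> p \in sl t z -> ~~ C p.
  move=> zk' ps; apply: contra nw => Cp; rewrite /wins; apply/orP; left.
  by apply/hasP; exists p => //; exact: mem_qlev ps.
have noBA z z' p p' : z \in kids t c -> z' \in kids t c -> p \in sl t z ->
    p' \in sl t z' -> B p -> A p' -> z < z' -> False.
  move=> zk1 zk2 ps ps' Bp Ap' zz'; move/negP: nw; apply; apply/orP; right.
  apply/hasP; exists p; first exact: mem_qlev ps.
  rewrite Bp; apply/hasP; exists p'; first exact: mem_qlev ps'.
  rewrite Ap' andbT ltnNge; apply/negP => /(leq_div2r (2 ^ ex t)).
  by rewrite (slP ps) (slP ps') leqNgt zz'.
rewrite /near; apply/andP; split; last first.
  have [zfirst|[z [nz zd /hasP[p ps /orP[Ap|Cp]]]]] := HA tb.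
  - rewrite zfirst (leq_trans _ (leqnSn _)) //.
    by rewrite -(kids_dom fk) leq_trunc_div.
  - have zL : z \in L.
      by rewrite mem_filter (zz_kids nc nz zd) andbT; apply/hasP; exists p.
    have := sorted_last (head 0 (kids t c)) Ls zL.
    by move: nz; rewrite /near /focus -/L; lia.
  - by have := noC z p (zz_kids nc nz zd) ps; rewrite Cp.
have [Lempty|Lne] := eqVneq L [::].
  rewrite /focus -/L Lempty /= (leq_trans _ (leqnSn _)) //.
  by apply: sorted_head => //; exact: kids_sorted.
have fL : focus A t c \in L.
  by rewrite /focus -/L; move: Lne; case: (L) => //= a l _; exact: mem_last.
have [zlast|[z [nz zd /hasP[p ps /orP[Bp|Cp]]]]] := HB tb.
- rewrite zlast (leq_trans (leqnSn _)) // -ltn_divLR ?expn_gt0 //.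
  by rewrite (kids_dom fk).
- move: fL; rewrite mem_filter => /andP[/hasP[p' ps' Ap'] _].
  have := noBA z (focus A t c) p p' (zz_kids nc nz zd) fk ps ps' Bp Ap'.
  by move: nz; rewrite /near; case: ltnP => // ? ? H; first [by case: H | lia].
- by have := noC z p (zz_kids nc nz zd) ps; rewrite Cp.
Qed.

(* If the focus overtakes the cell of [u], a sample in [B] near [u] precedes a
   sample in [A] of the focus: this inversion is a win. *)
Lemma chain_near k : k <= r.+1 - tmin ->
  (exists2 k', k' < k & wins A B C (step k')) \/ near (focusn A k) (zz (r.+1 - k)).
Proof.
elim: k => [|k IH] kr.
  by right; rewrite subn0 /= /zz ex_top uD /near; lia.
have [|[k' kk' w]|nk] := IH; first by lia.
  by left; exists k' => //; lia.
have tb : tmin <= r - k <= r by lia.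
move: nk; rewrite (_ : r.+1 - k = (r - k).+1) => [nk|]; last by lia.
have [w|nf] := focus_near tb nk; [left|right].
  by exists k.
by rewrite subSS /=.
Qed.

(** One level below [tmin] the position of the focus no longer matters: the samples of all cells
    inside the cell of [u] already win together. *)
Hypothesis Hfin : forall Q : seq nat,
  (forall z, z %/ 2 ^ (ex tmin - ex tmin.-1) = zz tmin ->
     {subset sl tmin.-1 z <= Q}) -> wins A B C Q.

(** The alternatives separate what step 0 achieves alone from what depends on the guess: if step 0
    does not win, the first focus lies next to the cell of [u], and a trial that guesses this focus
    can carry on. *)
Lemma chain_wins :
  wins A B C (step 0) \/
  [/\ tmin <= r, near (focusn A 1) (zz r), focusn A 1 %/ 2 ^ (lam - ex r) = zD &
      exists2 k, 0 < k <= r & wins A B C (step k)].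
Proof.
have [w0|nw0] := boolP (wins A B C (step 0)); [by left|right].
have fin : exists2 k, k <= r.+1 - tmin & wins A B C (step k).
  have [[k' kk' w]|nk] := chain_near (leqnn (r.+1 - tmin)).
    by exists k' => //; exact: ltnW.
  exists (r.+1 - tmin) => //; apply: Hfin => z zt.
  have Et : r - (r.+1 - tmin) = tmin.-1 by lia.
  have Et' : r.+1 - (r.+1 - tmin) = tmin by lia.
  rewrite /step Et; move=> p ps; apply: mem_qlev ps.
  move: nk; rewrite Et' -{1}(prednK (n := tmin)); last by lia.
  move=> nk; apply: mem_kids.
  - by rewrite (prednK (n := tmin)) ?zt; [move: nk; rewrite (prednK (n := tmin)) /near; lia|lia].
  - by rewrite (prednK (n := tmin)) ?zt; [move: nk; rewrite (prednK (n := tmin)) /near; lia|lia].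
  have e1 : ex tmin.-1 <= ex tmin by apply: ex_mono; lia.
  have e2 := ex_le tmin.
  have -> : lam - ex tmin.-1 = (ex tmin - ex tmin.-1) + (lam - ex tmin) by lia.
  by rewrite expnD divnMA zt zz_dom.
have [k kr w] := fin.
have k0 : 0 < k by case: k w {kr} => // w; rewrite w in nw0.
have tr : tmin <= r by lia.
split=> //; last by exists k => //; lia.
  2: {
    apply: (kids_dom (c := zD)); rewrite /= subn0.
    apply: (focus_in _ (z := zz r)); apply: zz_kids (zz_dom r).
      by rewrite /zz ex_top uD /near; lia.
    by rewrite /near; lia. }
have [|[k' kk' w']|] := @chain_near 1; first by lia.
  by move: kk' w'; rewrite ltnS leqn0 => /eqP-> w'; rewrite w' in nw0.
by rewrite subn1.
Qed.

End Chain.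
End Search.

(** * Query strategies *)

Lemma sumn_map_le (T : eqType) (s : seq T) (g : T -> nat) c :
  (forall x, x \in s -> g x <= c) -> sumn (map g s) <= size s * c.
Proof.
elim: s => // a s IH H /=; rewrite mulSn leq_add ?H ?mem_head ?IH // => x xs.
by rewrite H // inE xs orbT.
Qed.

Lemma size_flatten_le (T : eqType) (U : Type) (s : seq T) (g : T -> seq U) c :
  (forall x, x \in s -> size (g x) <= c) -> size (flatten (map g s)) <= size s * c.
Proof. by move=> H; rewrite size_flatten /shape -map_comp; exact: sumn_map_le. Qed.

Section Strategies.
Context {d : Order.disp_t} {V : orderType d}.
Implicit Types F G : nat -> V.

Definition has132 F (Q : seq nat) : bool :=
  has (fun i => has (fun j => has (fun k =>
    [&& i < j, j < k, (F i < F k)%O & (F k < F j)%O]) Q) Q) Q.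

Lemma has132P F (Q : seq nat) :
  reflect (exists i j k, [/\ i \in Q, j \in Q, k \in Q & [&& i < j, j < k, (F i < F k)%O & (F k < F j)%O]])
          (has132 F Q).
Proof.
apply: (iffP hasP) => [[i iQ /hasP[j jQ /hasP[k kQ H]]]|[i [j [k [iQ jQ kQ H]]]]].
  by exists i, j, k.
by exists i => //; apply/hasP; exists j => //; apply/hasP; exists k.
Qed.

Lemma sub_has132 F (Q Q' : seq nat) : {subset Q <= Q'} -> has132 F Q -> has132 F Q'.
Proof.
move=> QQ /has132P[i [j [k [iQ jQ kQ H]]]]; apply/has132P.
by exists i, j, k; split; rewrite ?QQ.
Qed.

(* A strategy receives shared data [x : X] and its own coins; [qry] is its
   list of queries in each round, written as a function of the whole input and
   required to be [adaptive]. *)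
Record strat (X : Type) := Strat {
  coinT : finType;
  qry : X -> coinT -> (nat -> V) -> nat -> seq nat
}.

Arguments qry {X} s _ _ _ _.

Definition asked X (s : strat X) x w F k : seq nat :=
  flatten [seq qry s x w F k' | k' <- iota 0 k].
Arguments asked {X} s _ _ _ _.

(** [pre x] are positions that an enclosing strategy queries in round 0, so their values may
    influence the queries from round 1 on. *)
Definition adaptive X (pre : X -> seq nat) (s : strat X) := forall x w F G k,
  (0 < k -> {in pre x, F =1 G}) -> {in asked s x w F k, F =1 G} ->
  qry s x w F k = qry s x w G k.

Definition cost_le X (s : strat X) (r c : nat) :=
  forall x w F, size (asked s x w F r) <= c.

Lemma mem_asked X (s : strat X) x w F k k' p :
  k' < k -> p \in qry s x w F k' -> p \in asked s x w F k.
Proof.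
move=> kk pq; apply/flattenP; exists (qry s x w F k') => //.
by apply/mapP; exists k'; rewrite // mem_iota add0n.
Qed.

Lemma askedP X (s : strat X) x w F k p :
  reflect (exists2 k', k' < k & p \in qry s x w F k') (p \in asked s x w F k).
Proof.
apply: (iffP flattenP) => [[_ /mapP[k' k'k ->] pq]|[k' k'k pq]].
  by exists k' => //; move: k'k; rewrite mem_iota.
by exists (qry s x w F k') => //; apply/mapP; exists k'; rewrite ?mem_iota.
Qed.

Lemma size_asked X (s : strat X) x w F k :
  size (asked s x w F k) = \sum_(k' <- iota 0 k) size (qry s x w F k').
Proof. by rewrite size_flatten /shape -map_comp sumnE big_map. Qed.

Definition rep X n (s : strat X) : strat X :=
  @Strat X {ffun 'I_n -> coinT s}
    (fun x w F k => flatten [seq qry s x (w i) F k | i <- enum 'I_n]).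

Definition par2 X (s t : strat X) : strat X :=
  @Strat X (coinT s * coinT t)%type
    (fun x w F k => qry s x w.1 F k ++ qry t x w.2 F k).

Definition skip X : strat X := @Strat X unit (fun _ _ _ _ => [::]).

Definition par X (ss : seq (strat X)) : strat X := foldr (@par2 X) (skip X) ss.

(** One draw of the data, queried once in round 0, serves all the strategies that [s] runs in
    parallel. *)
Definition share (T : finType) (P : T -> seq nat) (s : strat T) : strat unit :=
  @Strat unit (T * coinT s)%type (fun _ w F k =>
    (if k == 0 then P w.1 else [::]) ++ qry s w.1 w.2 F k).

Lemma rep_adaptive X pre n (s : strat X) : adaptive pre s -> adaptive pre (rep n s).
Proof.
move=> ad x w F G k Fpre Fask /=; congr flatten; apply: eq_map => i.
apply: ad => // p /askedP[k' kk pq]; apply: Fask; apply: (mem_asked kk) => /=.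
by apply/flattenP; exists (qry s x (w i) F k') => //; apply: map_f; rewrite mem_enum.
Qed.

Lemma par2_adaptive X pre (s t : strat X) :
  adaptive pre s -> adaptive pre t -> adaptive pre (par2 s t).
Proof.
move=> ads adt x w F G k Fpre Fask /=; congr (_ ++ _).
  apply: ads => // p /askedP[k' kk pq]; apply: Fask; apply: (mem_asked kk) => /=.
  by rewrite mem_cat pq.
apply: adt => // p /askedP[k' kk pq]; apply: Fask; apply: (mem_asked kk) => /=.
by rewrite mem_cat pq orbT.
Qed.

Lemma par_adaptive X pre (I : eqType) (l : seq I) (s : I -> strat X) :
  (forall i, adaptive pre (s i)) -> adaptive pre (par (map s l)).
Proof. by move=> ad; elim: l => //= i l IH; apply: par2_adaptive. Qed.

Lemma share_adaptive (T : finType) P (s : strat T) :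
  adaptive P s -> adaptive (fun=> [::]) (share P s).
Proof.
move=> ad [] w F G k _ Fask /=; congr (_ ++ _); apply: ad.
  by move=> k0 p pP; apply: Fask; apply: (@mem_asked _ _ _ _ _ _ 0) => //=; rewrite mem_cat pP.
move=> p /askedP[k' kk pq]; apply: Fask; apply: (mem_asked kk) => /=.
by rewrite mem_cat pq orbT.
Qed.

Lemma rep_cost X r c n (s : strat X) : cost_le s r c -> cost_le (rep n s) r (n * c).
Proof.
move=> H x w F; rewrite size_asked /=.
under eq_bigr do rewrite size_flatten /shape -map_comp sumnE big_map.
rewrite exchange_big /= -[n in n * c]size_enum_ord -sum1_size big_distrl /=.
by apply: leq_sum => i _; rewrite mul1n -size_asked; apply: H.
Qed.

Lemma par2_cost X r c c' (s t : strat X) :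
  cost_le s r c -> cost_le t r c' -> cost_le (par2 s t) r (c + c').
Proof.
move=> H H' x w F; rewrite size_asked /=.
under eq_bigr do rewrite size_cat.
by rewrite big_split /= -!size_asked leq_add.
Qed.

Lemma par_cost X (I : eqType) r c (l : seq I) (s : I -> strat X) :
  (forall i, i \in l -> cost_le (s i) r (c i)) ->
  cost_le (par (map s l)) r (sumn (map c l)).
Proof.
elim: l => /= [_ x w F|i l IH H]; first by rewrite size_asked big1_seq.
apply: par2_cost; first by apply: H; rewrite mem_head.
by apply: IH => j jl; apply: H; rewrite inE jl orbT.
Qed.

Lemma share_cost (T : finType) (P : T -> seq nat) r c c' (s : strat T) :
  (forall x, size (P x) <= c') -> cost_le s r c -> cost_le (share P s) r (c' + c).
Proof.
move=> HP H [] w F; rewrite size_asked /=.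
under eq_bigr do rewrite size_cat.
rewrite big_split /= -!size_asked leq_add //.
case: r {H} => [|r] /=; first by rewrite big_nil.
rewrite big_cons /= big1_seq ?addn0 ?HP // => k /andP[_].
by rewrite mem_iota; case: k.
Qed.

Section Success.
Variables (R : realFieldType) (r : nat).
Local Open Scope ring_scope.

Definition winpr X (s : strat X) x F (P : seq nat) : R :=
  pr R (fun w => has132 F (P ++ asked s x w F r)).

Definition coined X (s : strat X) := (0 < #|coinT s|)%N.

Lemma rep_coined X n (s : strat X) : coined s -> coined (rep n s).
Proof. by rewrite /coined card_ffun expn_gt0 => ->. Qed.

Lemma par_coined X (I : eqType) (l : seq I) (s : I -> strat X) :
  (forall i, coined (s i)) -> coined (par (map s l)).
Proof.
move=> H; elim: l => [|i l IH]; first by rewrite /coined /= card_unit.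
by rewrite /coined /= card_prod muln_gt0; apply/andP; split; [exact: H|].
Qed.

Lemma rep_win X n (s : strat X) x F P p : coined s -> 0 <= p ->
  p <= winpr s x F P -> 1 - (1 + n%:R * p)^-1 <= winpr (rep n s) x F P.
Proof.
move=> cs p0 pw; apply: le_trans (pr_repeat n cs p0 pw) _; apply: pr_mono => w.
move=> /existsP[i]; apply: sub_has132 => q; rewrite !mem_cat => /orP[->//|].
move=> /askedP[k kr qk]; apply/orP; right; apply: (mem_asked kr) => /=.
by apply/flattenP; exists (qry s x (w i) F k) => //; apply: map_f; rewrite mem_enum.
Qed.

Lemma par_win X (I : eqType) (l : seq I) (s : I -> strat X) i x F P :
  (forall i, coined (s i)) -> i \in l ->
  winpr (s i) x F P <= winpr (par (map s l)) x F P.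
Proof.
move=> cs; elim: l => //= j l IH; rewrite inE => /orP[/eqP <-|il].
  apply: (@le_trans _ _ (pr R (fun w : coinT (s i) * coinT (par (map s l)) =>
    has132 F (P ++ asked (s i) x w.1 F r)))).
    by rewrite (pr_fst _ (fun w => has132 F (P ++ asked (s i) x w F r))) ?lexx //; exact: par_coined.
  apply: pr_mono => w; apply: sub_has132 => q; rewrite !mem_cat => /orP[->//|].
  move=> /askedP[k kr qk]; apply/orP; right; apply: (mem_asked kr) => /=.
  by rewrite mem_cat qk.
apply: le_trans (IH il) _.
apply: (@le_trans _ _ (pr R (fun w : coinT (s j) * coinT (par (map s l)) =>
  has132 F (P ++ asked (par (map s l)) x w.2 F r)))).
  by rewrite (pr_snd _ (fun w => has132 F (P ++ asked (par (map s l)) x w F r))) ?lexx //; exact: cs.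
apply: pr_mono => w; apply: sub_has132 => q; rewrite !mem_cat => /orP[->//|].
move=> /askedP[k kr qk]; apply/orP; right; apply: (mem_asked kr) => /=.
by rewrite mem_cat qk orbT.
Qed.

Lemma share_win (T : finType) (P : T -> seq nat) (s : strat T) F (A : pred T) p :
  (0 < r)%N -> (forall x, A x -> p <= winpr s x F (P x)) ->
  pr R A * p <= winpr (share P s) tt F [::].
Proof.
move=> r0 H; apply: le_trans (pr_pair_ge H) _; apply: pr_mono => w.
apply: sub_has132 => q; rewrite mem_cat /= => /orP[qP|/askedP[k kr qk]].
  by apply: (mem_asked r0) => /=; rewrite mem_cat qP.
by apply: (mem_asked kr) => /=; rewrite mem_cat qk orbT.
Qed.

End Success.
End Strategies.
Arguments qry {d V X} s _ _ _ _.
Arguments asked {d V X} s _ _ _ _.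

(** * The parallel search *)

(* The kinds of sampled targets: [Inv] looks for an inversion to the right of a
   low value, [Ext] aims at the extremal (highest or lowest) sampled value of
   the right half, [Pair] at the values between the minimum of a cell and the
   maximum of the next one, [Tie] at the exact value of a sampled position. *)
Inductive kind := Inv | Ext of bool | Pair | Tie of bool.

Section Status.
Context {d : Order.disp_t} {V : orderType d}.
Local Open Scope order_scope.
Implicit Types (x v : V) (l : seq (nat * V)).

Definition above (l0 : seq V) x := has (fun y => y < x) l0.

(** Ties in value are broken by position, which makes the extremal sampled position unique. *)
Definition prec (q q' : nat * V) := (q.2 < q'.2) || (q.2 == q'.2) && (q.1 < q'.1)%N.

Definition extremal (up : bool) (l0 : seq V) l1 : seq (nat * V) :=
  [seq q <- l1 | above l0 q.2 &&
    ~~ has (fun q' => above l0 q'.2 && (if up then prec q q' else prec q' q)) l1].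

Definition crosses v l :=
  has (fun q => has (fun q' => [&& (q.1 < q'.1)%N, q.2 < v & v < q'.2]) l) l.

(* [before], [after] and [found] tell whether a queried value lies before or
   after the target in the searched half, or completes a copy of the pattern. *)
Definition before (k : kind) (l0 : seq V) l1 l2 x : bool :=
  match k with
  | Inv => false
  | Ext up => has (fun q => q.2 < x) (extremal up l0 l1)
  | Pair => [&& above l0 x, ~~ has (fun q => q.2 < x) l1 & has (fun q => x < q.2) l2]
  | Tie b => above l0 x && has (fun q => x < q.2) (take 1 (if b then l1 else l2))
  end.

Definition after (k : kind) (l0 : seq V) l1 l2 x : bool :=
  match k with
  | Inv => false
  | Ext up => has (fun q => x < q.2) (extremal up l0 l1)
  | Pair => ~~ has (fun q => x < q.2) l2
  | Tie b => has (fun q => q.2 < x) (take 1 (if b then l1 else l2))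
  end.

Definition found (k : kind) (l0 : seq V) l1 l2 x : bool :=
  match k with
  | Inv | Ext _ => false
  | Pair => has (fun q => q.2 < x) l1 && has (fun q => x < q.2) l2
  | Tie b => has (fun q => q.2 == x) (take 1 (if b then l1 else l2)) &&
             crosses x (if b then l2 else l1)
  end.

End Status.

(* Cells of exponent [zx] are sampled for targets, with [nt] samples for each
   target; every searched cell gets [ns] samples. Each of the [nJ] trials guesses
   one cell and carries [nM] targets, and at most [nB] of the targets whose first
   search step leads to the guessed cell are pursued. *)
Record params := Params {
  kd : kind;
  zx : nat;
  ns : nat; nt : nat; nM : nat; nJ : nat; nB : nat
}.

Section Body.
Context {d : Order.disp_t} {V : orderType d}.
Implicit Types F G : nat -> V.
Variables (e lam gam r s0 : nat) (th : params).

(** [sdom] is the half of W that is searched, [pdom] the one in which targets are sampled. An [Ext]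
    target plays the part of l and comes from the right half, [Pair] and [Tie] targets come from the
    left half, and [Inv] samples both j and l in the right half. *)
Definition sdom zW := if kd th is Ext _ then zW else zW.+1.
Definition pdom zW := match kd th with Pair | Tie _ => zW | _ => zW.+1 end.

Definition shareT : finType := (pos e * {ffun 'I_s0 -> pos e})%type.
Definition targetT : finType :=
  (pos e * ({ffun 'I_(nt th) -> pos e} * {ffun 'I_(nt th) -> pos e}))%type.
(** The coins of all cells at all levels are drawn in advance and shared by all targets; only
    visited cells are queried. Whether the grid is good for a given copy is then an event
    independent of the targets and of the path of the search. *)
Definition gridT : finType := {ffun 'I_r.+1 * pos e * 'I_(ns th) -> pos e}.
Definition trialT : finType := (pos e * {ffun 'I_(nM th) -> targetT})%type.
Definition bodyT : finType := (gridT * {ffun 'I_(nJ th) -> trialT})%type.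

Implicit Types (x : shareT) (w : bodyT) (o : targetT) (S : gridT).

Definition zw (x : shareT) : nat := 2 * (x.1 %/ 2 ^ lam.+1).
Definition P0 (x : shareT) : seq nat := [seq smp lam (zw x) (x.2 i) | i <- enum 'I_s0].

Definition zc zW (o : targetT) : nat := smp lam (pdom zW) o.1 %/ 2 ^ zx th.
Definition P1 zW (o : targetT) : seq nat :=
  [seq smp (zx th) (zc zW o) (o.2.1 i) | i <- enum 'I_(nt th)].
Definition P2 zW (o : targetT) : seq nat :=
  [seq smp (zx th) (zc zW o).+1 (o.2.2 i) | i <- enum 'I_(nt th)].

Definition sl (S : gridT) t z : seq nat :=
  [seq smp (ex lam gam t) z (S (inord t, inord z, i)) | i <- enum 'I_(ns th)].

Definition st (f : kind -> seq V -> seq (nat * V) -> seq (nat * V) -> V -> bool)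
    zW (P : seq nat) (o : targetT) F : V -> bool :=
  f (kd th) (map F P) [seq (p, F p) | p <- P1 zW o] [seq (p, F p) | p <- P2 zW o].

Definition bf zW P o F : pred nat := fun p => st before zW P o F (F p).
Definition af zW P o F : pred nat := fun p => st after zW P o F (F p).
Definition fd zW P o F : pred nat := fun p => st found zW P o F (F p).

Definition lev zW S t c := qlev lam gam (sdom zW) (sl S) t c.
Definition foc zW S (A : pred nat) k := focusn lam gam r (sdom zW) (sl S) A k.

(** Cell indices are sampled like positions: the level-[r] cells of the domain are numbered by a
    dyadic interval of exponent [lam - ex r]. *)
Definition Jc zW (y : pos e) : nat := smp (lam - ex lam gam r) (sdom zW) y.

Definition om (w : bodyT) (ba : 'I_(nJ th) * 'I_(nM th)) : targetT := (w.2 ba.1).2 ba.2.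

Definition cands zW P (w : bodyT) F : seq ('I_(nJ th) * 'I_(nM th)) :=
  [seq ba <- enum {: 'I_(nJ th) * 'I_(nM th)} |
    foc zW w.1 (bf zW P (om w ba) F) 1 == Jc zW (w.2 ba.1).1].

Definition body_qry (x : shareT) (w : bodyT) F k : seq nat :=
  if k == 0 then
    flatten [seq P1 (zw x) (om w ba) ++ P2 (zw x) (om w ba) |
             ba <- enum {: 'I_(nJ th) * 'I_(nM th)}]
    ++ lev (zw x) w.1 r (sdom (zw x))
    ++ flatten [seq lev (zw x) w.1 (r - 1) (Jc (zw x) (w.2 b).1) | b <- enum 'I_(nJ th)]
  else
    flatten [seq lev (zw x) w.1 (r - k.+1) (foc (zw x) w.1 (bf (zw x) (P0 x) (om w ba) F) k.+1) |
             ba <- take (nB th) (cands (zw x) (P0 x) w F)].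

Definition body : strat shareT := @Strat _ V shareT bodyT body_qry.

Lemma focusn_eq zW S (A A' : pred nat) k :
  (forall k', k' < k -> {in lev zW S (r - k') (foc zW S A k'), A =1 A'}) ->
  foc zW S A k = foc zW S A' k.
Proof.
rewrite /foc; elim: k => //= k IH H; rewrite -IH => [|k' kk]; last by apply: H; rewrite ltnS ltnW.
rewrite /focus; congr last; apply: eq_in_filter => z zk.
apply: eq_in_has => p ps; apply: (H k (ltnSn k)).
by apply/flattenP; exists (sl S (r - k) z) => //; apply: map_f.
Qed.

Lemma mem_round0_targets x w F ba p :
  p \in P1 (zw x) (om w ba) ++ P2 (zw x) (om w ba) -> p \in body_qry x w F 0.
Proof.
move=> H; rewrite mem_cat; apply/orP; left; apply/flattenP.
by exists (P1 (zw x) (om w ba) ++ P2 (zw x) (om w ba)) => //; apply: map_f; rewrite mem_enum.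
Qed.

Lemma mem_round0_top x w F p :
  p \in lev (zw x) w.1 r (sdom (zw x)) -> p \in body_qry x w F 0.
Proof. by move=> H; rewrite !mem_cat H orbT. Qed.

Lemma mem_step1 x w F (b : 'I_(nJ th)) p :
  p \in lev (zw x) w.1 (r - 1) (Jc (zw x) (w.2 b).1) -> p \in body_qry x w F 0.
Proof.
move=> H; rewrite !mem_cat; apply/orP; right; apply/orP; right; apply/flattenP.
by exists (lev (zw x) w.1 (r - 1) (Jc (zw x) (w.2 b).1)) => //; apply: map_f; rewrite mem_enum.
Qed.

Lemma mem_step x w F ba k p : 0 < k -> ba \in take (nB th) (cands (zw x) (P0 x) w F) ->
  p \in lev (zw x) w.1 (r - k.+1) (foc (zw x) w.1 (bf (zw x) (P0 x) (om w ba) F) k.+1) ->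
  p \in body_qry x w F k.
Proof.
case: k => // k _ bac H; apply/flattenP; eexists; last exact: H.
exact: (map_f (fun ba => lev (zw x) w.1 (r - k.+2)
  (foc (zw x) w.1 (bf (zw x) (P0 x) (om w ba) F) k.+2))).
Qed.

(* Step [k] of the search of a processed candidate is asked in round
   [k - 1], except that steps 0 and 1 are both asked in round 0. *)
Lemma mem_cand_steps x w F ba k p : ba \in take (nB th) (cands (zw x) (P0 x) w F) ->
  p \in lev (zw x) w.1 (r - k) (foc (zw x) w.1 (bf (zw x) (P0 x) (om w ba) F) k) ->
  p \in body_qry x w F k.-1.
Proof.
move=> bac; case: k => [|[|k]].
- by rewrite subn0; exact: mem_round0_top.
- have := mem_take bac; rewrite mem_filter => /andP[/eqP bJ _].
  by rewrite bJ; exact: mem_step1.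
- exact: mem_step.
Qed.

Lemma body_adaptive : adaptive P0 body.
Proof.
move=> x w F G [//|k] /(_ isT) Fpre Fask.
have ask0 p : p \in body_qry x w F 0 -> F p = G p.
  by move=> pq; apply: Fask; apply: (mem_asked (k' := 0)).
have stE f ba : st f (zw x) (P0 x) (om w ba) F = st f (zw x) (P0 x) (om w ba) G.
  have E (l : seq nat) : {subset l <= P1 (zw x) (om w ba) ++ P2 (zw x) (om w ba)} ->
      [seq (p, F p) | p <- l] = [seq (p, G p) | p <- l].
    move=> sub; apply/eq_in_map => p pl; congr (_, _); apply: ask0.
    exact: mem_round0_targets (sub _ pl).
  have E0 : map F (P0 x) = map G (P0 x) by apply/eq_in_map.
  by rewrite /st E0 !E // => p; rewrite mem_cat => ->; rewrite ?orbT.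
have bfE ba p : F p = G p -> bf (zw x) (P0 x) (om w ba) F p = bf (zw x) (P0 x) (om w ba) G p.
  by move=> E; rewrite /bf stE E.
have c1 ba : foc (zw x) w.1 (bf (zw x) (P0 x) (om w ba) F) 1 =
             foc (zw x) w.1 (bf (zw x) (P0 x) (om w ba) G) 1.
  apply: focusn_eq => [] [] // _ p; rewrite subn0 => pq; apply: bfE; apply: ask0.
  exact: mem_round0_top.
have cE : cands (zw x) (P0 x) w F = cands (zw x) (P0 x) w G.
  by apply: eq_filter => ba; rewrite c1.
rewrite /qry /= /body_qry /= -cE; congr flatten; apply/eq_in_map => ba bac; congr lev.
(* The focus used in round [k + 1] rests on steps up to [k + 1], and step [k'] was answered in round
   [k' - 1] (steps 0 and 1 both in round 0). *)
apply: (@focusn_eq _ _ _ _ k.+2) => k' k'k p pq; apply: bfE; apply: Fask.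
have pq' := mem_cand_steps bac pq; apply: (mem_asked (k' := k'.-1)) => //; lia.
Qed.

Lemma size_lev zW S t c : size (lev zW S t c) <= 5 * 2 ^ gam * ns th.
Proof.
apply: leq_trans (size_flatten_le (c := ns th) _) _ => [z _|].
  by rewrite size_map size_enum_ord.
by rewrite leq_mul2r size_kids orbT.
Qed.

Definition body_cost := nJ th * nM th * (2 * nt th) +
  (1 + nJ th + r * nB th) * (5 * 2 ^ gam * ns th).

Lemma body_cost_le : cost_le body r body_cost.
Proof.
move=> x w F; rewrite size_asked /= /body_cost.
set L := 5 * 2 ^ gam * ns th.
set a := nJ th * nM th * (2 * nt th) + (1 + nJ th) * L.
have Hk k : size (body_qry x w F k) <= (k == 0) * a + nB th * L.
  rewrite /body_qry; case: eqP => _; last first.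
    apply: leq_trans (size_flatten_le (c := L) _) _ => [z _|]; first exact: size_lev.
    by rewrite mul0n add0n leq_mul2r size_take_min geq_minl orbT.
  rewrite mul1n (leq_trans _ (leq_addr _ _)) // !size_cat /a mulnDl mul1n leq_add //.
    apply: leq_trans (size_flatten_le (c := 2 * nt th) _) _ => [z _|].
      by rewrite size_cat !size_map -enumT size_enum_ord; lia.
    by rewrite -cardE card_prod !card_ord.
  rewrite leq_add ?size_lev //.
  apply: leq_trans (size_flatten_le (c := L) _) _ => [z _|]; first exact: size_lev.
  by rewrite size_enum_ord.
apply: leq_trans (leq_sum _ (fun k _ => Hk k)) _; rewrite big_split /=.
rewrite big_const_seq count_predT size_iota iter_addn_0 -big_distrl /=.
have s1 : \sum_(k <- iota 0 r) (k == 0) <= 1.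
  rewrite (eq_bigr (fun k => if k == 0 then 1 else 0)) => [|k _]; last by case: eqP.
  by rewrite -big_mkcond sum1_count count_uniq_mem ?iota_uniq // leq_b1.
apply: leq_trans (leq_add (leq_mul s1 (leqnn a)) (leqnn _)) _.
by rewrite mul1n /a [in leqRHS]mulnDl addnA leq_add2l mulnAC [nB th * r]mulnC.
Qed.

End Body.

(** * Success probability of the parallel search *)

Section Trials.
Variables (R : realFieldType) (e h z M : nat) (Ts : finType).
Variables (hit : Ts -> nat -> bool).
Hypotheses (he : h <= e) (Ts0 : 0 < #|Ts|).
Local Open Scope ring_scope.

Let trial := (pos e * {ffun 'I_M -> Ts})%type.
Let q (J : nat) : R := pr R (fun o => hit o J).

Definition trial_hit (t : trial) : bool := [exists a, hit (t.2 a) (smp h z t.1)].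

Lemma q_ge0 J : 0 <= q J. Proof. exact: pr_ge0. Qed.

(** For a guess in [X] the batch expects at least one hit, so it hits with probability at least
    1/2. *)
Lemma trial_large (X : pred nat) :
  (forall J, X J -> 1 <= M%:R * q J) ->
  2^-1 * ((cnt h z X)%:R / (2 ^ h)%:R) <= pr R trial_hit.
Proof.
move=> HX; rewrite mulrC -(pr_smp R _ _ he).
apply: (pr_pair_ge (Q := fun (y : pos e) (g : {ffun 'I_M -> Ts}) =>
  [exists a, hit (g a) (smp h z y)])) => y /HX Mq.
apply: le_trans (pr_repeat (P := fun o => hit o (smp h z y)) M Ts0 (q_ge0 _) (lexx _)).
rewrite -/(q _); set a := M%:R * _ in Mq *.
have : (1 + a)^-1 <= 2^-1 by rewrite lef_pV2 ?posrE; lra.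
lra.
Qed.

(** With [a <= 1] expected hits, [1 - (1 + a)^-1 >= a / 2]: outside [X] a batch succeeds in
    proportion to its size. A good target has a right guess outside [X], drawn with probability
    [2 ^ - h]; summing over the guesses gives the bound. *)
Lemma trial_small (X : pred nat) (good : pred Ts) :
  (forall J, ~~ X J -> M%:R * q J <= 1) ->
  (forall o, good o -> exists J, [/\ J %/ 2 ^ h = z, ~~ X J & hit o J])%N ->
  M%:R / 2 * (pr R good / (2 ^ h)%:R) <= pr R trial_hit.
Proof.
move=> HX Hg.
pose Q (y : pos e) (o : Ts) := ~~ X (smp h z y) && hit o (smp h z y).
have H1 : pr R good / (2 ^ h)%:R <= pr R (fun p : pos e * Ts => Q p.1 p.2).
  rewrite (pr_swap R Q).
  apply: (pr_pair_ge (Q := fun o y => Q y o)) => o /Hg [J [Jz XJ hJ]].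
  apply: (@le_trans _ _ (pr R (fun y : pos e => smp h z y == J))).
    rewrite (pr_smp R _ (fun p => p == J) he) -[leLHS]mul1r ler_wpM2r ?invr_ge0 ?ler0n //.
    by rewrite -[1]/(1%:R) ler_nat (@cnt_gt0 _ _ _ J).
  by apply: pr_mono => y /eqP yJ; rewrite /Q yJ XJ.
apply: le_trans (ler_wpM2l _ H1) _; first by rewrite divr_ge0.
rewrite pr_pairE mulrA mulr_sumr.
apply: le_trans (pr_pair_sum (Q := fun (y : pos e) (g : {ffun 'I_M -> Ts}) =>
  [exists a, hit (g a) (smp h z y)]) (A := predT) _); last first.
  by move=> y _; apply: (pr_repeat (P := fun o => hit o (smp h z y)) M Ts0 (q_ge0 _) (lexx _)).
rewrite ler_wpM2r ?invr_ge0 ?ler0n //; apply: ler_sum => y _.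
rewrite -/(q (smp h z y)).
have q0 := q_ge0 (smp h z y); have Mq0 : 0 <= M%:R * q (smp h z y) by rewrite mulr_ge0.
have inv1 : (1 + M%:R * q (smp h z y))^-1 <= 1.
  by rewrite invf_le1; lra.
have [Xy|nXy] := boolP (X (smp h z y)).
  have -> : pr R (Q y) = 0.
    by rewrite /pr /Q Xy (eq_card (B := pred0)) // card0 mul0r.
  by rewrite mulr0; lra.
have -> : pr R (Q y) = q (smp h z y) by apply: eq_pr => o; rewrite /Q nXy.
have := HX _ nXy; move: Mq0 inv1; rewrite mulrAC; move: (M%:R * _) => a a0 _ a1.
have : (1 + a)^-1 * (1 + a) = 1 by rewrite mulVf //; lra.
have : 0 <= (1 + a)^-1 by rewrite invr_ge0; lra.
nra.
Qed.

Variables (nJ B : nat) (cnd : Ts -> nat).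

Let cand (w : {ffun 'I_nJ -> trial}) (ba : 'I_nJ * 'I_M) : bool :=
  cnd ((w ba.1).2 ba.2) == smp h z (w ba.1).1.

(** Guess and target are independent, so each pair is a candidate with probability at most
    [2 ^ - h]. By Markov's inequality there are more than [B] candidates with probability at most
    1/8. *)
Lemma trials_win p : 0 <= p -> p <= pr R trial_hit ->
  (8 * (nJ * M) <= B * 2 ^ h)%N ->
  1 - (1 + nJ%:R * p)^-1 - 8^-1 <=
  pr R (fun w => (#|[pred ba | cand w ba]| <= B)%N && [exists b, trial_hit (w b)]).
Proof.
move=> p0 pp HB.
have T0 : (0 < #|{: trial}|)%N.
  by rewrite card_prod card_ffun muln_gt0 pos_gt0 expn_gt0 Ts0.
have W0 : (0 < #|{: {ffun 'I_nJ -> trial}}|)%N by rewrite card_ffun expn_gt0 T0.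
have H1 := pr_repeat nJ T0 p0 pp.
have c1 ba : pr R (fun w => cand w ba) <= (2 ^ h)%:R^-1.
  rewrite (pr_ffun_coord R ba.1 (fun t : trial => cnd (t.2 ba.2) == smp h z t.1)) //.
  rewrite (pr_swap R (fun (y : pos e) (g : {ffun 'I_M -> Ts}) => cnd (g ba.2) == smp h z y)).
  apply: (@pr_pair_le R _ _ (fun (g : {ffun 'I_M -> Ts}) (y : pos e) => cnd (g ba.2) == smp h z y)).
    by rewrite invr_ge0 ler0n.
  move=> g; rewrite (pr_smp R _ (fun p => cnd (g ba.2) == p) he).
  rewrite -[leRHS]mul1r ler_wpM2r ?invr_ge0 ?ler0n // -[1]/(1%:R) ler_nat.
  rewrite /cnt (eq_count (a2 := pred1 (cnd (g ba.2)))) => [|p' /=]; last by rewrite eq_sym.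
  by rewrite count_uniq_mem ?iota_uniq // leq_b1.
have H2 : 1 - 8^-1 <= pr R (fun w => (#|[pred ba | cand w ba]| <= B)%N).
  have := pr_predC R (fun w => (#|[pred ba | cand w ba]| <= B)%N) W0.
  rewrite (eq_pr R (Q := fun w => (B.+1 <= #|[pred ba | cand w ba]|)%N)); last first.
    by move=> w; rewrite -ltnNge.
  suff : pr R (fun w => (B.+1 <= #|[pred ba | cand w ba]|)%N) <= 8^-1 by lra.
  have := pr_markov R (fun ba w => cand w ba) B.+1.
  have : \sum_ba pr R (fun w => cand w ba) <= (B.+1)%:R / 8.
    apply: le_trans (ler_sum _ (fun ba _ => c1 ba)) _.
    rewrite sumr_const card_prod !card_ord -(mulr_natl (2 ^ h)%:R^-1).
    rewrite ler_pdivrMr ?ltr0n ?expn_gt0 // mulrAC ler_pdivlMr //.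
    rewrite -!natrM ler_nat; apply: leq_trans (leq_trans HB _); first by lia.
    by rewrite leq_mul2r leqnSn orbT.
  move=> H /le_trans /(_ H) Hm.
  by rewrite -(ler_pM2r (x := B.+1%:R)) ?ltr0n // (le_trans Hm) // mulrC.
have := pr_predI W0 (a := 8^-1) (b := (1 + nJ%:R * p)^-1) H2 H1.
by apply: le_trans; lra.
Qed.

End Trials.

(** * Success of the parallel search in a fixed window *)

Section BodyWin.
Context {d : Order.disp_t} {V : orderType d}.
Variables (R : realFieldType) (e lam gam r s0 : nat) (th : params).
Variables (F : nat -> V) (x : shareT e s0).

Let zW := zw lam x.
Let sD := sdom th zW.
Let P := P0 lam x.
Let Ec := lam - ex lam gam r.

Definition imm (S : gridT e r th) (o : targetT e th) : bool :=
  has132 F (P ++ (P1 lam zW o ++ P2 lam zW o) ++ lev lam gam zW S r sD).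

(** For a fixed grid this depends on one target and one guess only, which brings it under the
    analysis of independent trials. *)
Definition hitB S o J : bool :=
  imm S o || (foc lam gam zW S (bf lam zW P o F) 1 == J) &&
    [exists k : 'I_r.+1, (0 < k) && has132 F (P ++ (P1 lam zW o ++ P2 lam zW o) ++
       lev lam gam zW S (r - k) (foc lam gam zW S (bf lam zW P o F) k))].

Lemma body_hit (w : bodyT e r th) b a : 0 < r ->
  hitB w.1 (om w (b, a)) (Jc lam gam r th zW (w.2 b).1) ->
  #|[pred ba | foc lam gam zW w.1 (bf lam zW P (om w ba) F) 1 ==
     Jc lam gam r th zW (w.2 ba.1).1]| <= nB th ->
  has132 F (P ++ asked (body e lam gam r s0 th) x w F r).
Proof.
move=> r0 H cB.
have in0 p : p \in body_qry lam gam x w F 0 -> p \in asked (body e lam gam r s0 th) x w F r.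
  exact: (mem_asked (s := body e lam gam r s0 th) r0).
have inP p : p \in P ++ (P1 lam zW (om w (b, a)) ++ P2 lam zW (om w (b, a))) ->
    p \in P ++ asked (body e lam gam r s0 th) x w F r.
  rewrite mem_cat => /orP[pP|/mem_round0_targets pq]; rewrite mem_cat ?pP //.
  by rewrite in0 ?orbT.
case/orP: H => [|/andP[fJ /existsP[[k kr] /= /andP[k0]]]].
  apply: sub_has132 => p; rewrite catA mem_cat => /orP[/inP //|/mem_round0_top pq].
  by rewrite mem_cat in0 ?orbT.
apply: sub_has132 => p; rewrite catA mem_cat => /orP[/inP //|pq].
have bac : (b, a) \in take (nB th) (cands lam gam zW P w F).
  have cE : size (cands lam gam zW P w F) <= nB th.
    by apply: leq_trans cB; rewrite cardE /enum_mem -enumT /cands size_filter -size_filter.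
  by rewrite take_oversize // mem_filter fJ mem_enum.
rewrite mem_cat; apply/orP; right.
apply: (mem_asked (k' := k.-1)); last exact: (mem_cand_steps bac pq).
by rewrite prednK.
Qed.

Section Grid.
Variables (K m : nat).
Hypotheses (K0 : 0 < K) (nsE : ns th = 20 * K * 2 ^ m) (le : lam <= e).
Local Open Scope ring_scope.

(** At density [2 ^ - m], the [20 * K * 2 ^ m] samples of a cell expect at least [20 * K] hits. *)
Lemma grid_miss t z (Q : pred nat) : (t <= r)%N -> (z < 2 ^ e)%N ->
  (2 ^ ex lam gam t <= cnt (ex lam gam t) z Q * 2 ^ m)%N ->
  pr R (fun S : gridT e r th => ~~ has Q (sl lam gam S t z)) <= (20 * K)%:R^-1.
Proof.
move=> tr ze; set h := ex lam gam t => dq.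
pose A := [pred i : 'I_r.+1 * pos e * 'I_(ns th) | i.1 == (inord t, inord z)].
have he : (h <= e)%N by apply: leq_trans le; exact: ex_le.
rewrite (eq_pr R (Q := fun S : gridT e r th =>
  [forall i, A i ==> ~~ Q (smp h z (S i))])); last first.
  move=> S; rewrite -all_predC; apply/allP/forallP => /= H.
    move=> [[t' z'] i] /=; apply/implyP => /eqP[-> ->]; apply: H.
    by apply/mapP; exists i; rewrite ?mem_enum.
  move=> p /mapP[i _ ->]; have := H (inord t, inord z, i).
  by rewrite eqxx.
rewrite (pr_ffun_sub R A (fun y : pos e => ~~ Q (smp h z y))) ?pos_gt0 //.
have -> : #|A| = ns th.
  rewrite -[RHS]card_ord -(card_imset (f := fun i : 'I_(ns th) => (inord t : 'I_r.+1, inord z : pos e, i))).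
    apply: eq_card => [[[t' z'] i]]; apply/eqP/imsetP => /= [[-> ->]|[i' _ [-> -> _]] //].
    by exists i.
  by move=> i j [].
rewrite pr_predC ?pos_gt0 // (pr_smp R z Q he).
have h0 : 0 < (2 ^ h)%:R :> R by rewrite ltr0n expn_gt0.
apply: le_trans (bernoulli_inv _ _) _.
  rewrite divr_ge0 ?ler0n //= ler_pdivrMr // mul1r ler_nat; exact: cnt_le.
have K0' : 0 < (20 * K)%:R :> R by rewrite ltr0n; lia.
rewrite lef_pV2; [|by rewrite posrE ltr_pwDl // mulr_ge0 ?divr_ge0|by rewrite posrE].
apply: ler_wpDl => //; rewrite mulrA ler_pdivlMr // -!natrM ler_nat nsE.
by rewrite -[X in (_ <= X)%N]mulnA leq_mul2l mulnC [(2 ^ m * _)%N]mulnC dq orbT.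
Qed.

Lemma grid_all (s : seq nat) (E E' : nat -> pred (gridT e r th)) :
  (size s <= K)%N ->
  (forall t, t \in s -> pr R (fun S => ~~ E t S) <= (20 * K)%:R^-1) ->
  (forall t, t \in s -> pr R (fun S => ~~ E' t S) <= (20 * K)%:R^-1) ->
  pr R (fun S => ~~ all (fun t => E t S && E' t S) s) <= 10^-1.
Proof.
move=> ss HE HE'; pose D t S := (t \in s) && (~~ E t S || ~~ E' t S).
rewrite (eq_pr R (Q := fun S => has (D^~ S) s)); last first.
  by move=> S; rewrite -has_predC; apply: eq_in_has => t ts; rewrite /D ts /= negb_and.
apply: le_trans (pr_has (d := 2 * (20 * K)%:R^-1) _ _) _ => [t|].
  rewrite /D; have [ts|ts] := boolP (t \in s); last first.
    by rewrite /pr (eq_card (B := pred0)) // card0 mul0r mulr_ge0 ?invr_ge0 ?ler0n.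
  apply: le_trans (pr_predU R (fun S => ~~ E t S) (fun S => ~~ E' t S)) _.
  by have := HE _ ts; have := HE' _ ts; lra.
have K0' : 0 < (20 * K)%:R :> R by rewrite ltr0n; lia.
rewrite mulrA ler_pdivrMr //; move: ss; rewrite -(ler_nat R) !natrM; lra.
Qed.

End Grid.

Section Win.
Local Open Scope ring_scope.
Variables (I : finType) (T : {set I}) (serve : targetT e th -> I -> bool).
Variables (ok : I -> pred (gridT e r th)) (im : bool) (u : I -> nat).
Variables (m j Qu : nat).
Hypotheses (r0 : (0 < r)%N) (le : (lam <= e)%N).
(** Required for every subfamily, because copies with a bad grid or with too frequent guesses nearby
    are discarded afterwards. *)
Hypothesis linear : forall U : {set I}, U \subset T ->
  #|U|%:R * (2 ^ j)%:R / (8 * (2 ^ lam)%:R) <= pr R (fun o => [exists i in U, serve o i]).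
Hypothesis Hok : forall i, i \in T -> pr R (fun S => ~~ ok i S) <= 10^-1.
Hypothesis Hhit : forall S i o, i \in T -> ok i S -> serve o i ->
  (im -> imm S o) /\
  (~~ im -> exists J, [/\ J %/ 2 ^ Ec = sD, near J (u i) & hitB S o J]%N).
(** No top cell holds many copies, so they spread over many guesses. The flag [im] marks the case
    where step 0 finds the copy and any guess will do. *)
Hypothesis cap : ~~ im -> forall z, (#|[set i in T | u i == z]| * 2 ^ m <= 2 * 2 ^ ex lam gam r)%N.
Hypothesis T0 : T != set0.
Hypothesis bigT : (2 ^ lam <= #|T| * Qu)%N.
Hypothesis Tm : (#|T| * 2 ^ m <= 2 * 2 ^ lam)%N.
Hypothesis mj : (m <= j + 4)%N.
(** Since [m <= j + 4], a trial expects at most [2 ^ 4] candidates; the bound [128 = 8 * 2 ^ 4] in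
    [BE] leaves the factor 8 for Markov. [JE] makes the expected number of successful trials at
    least 4. *)
Hypothesis ME : nM th = (2 ^ (Ec + m - j))%N.
Hypothesis JE : (256 * Qu <= nJ th * 2 ^ maxn m (j - Ec))%N.
Hypothesis BE : nB th = (128 * nJ th)%N.

(** The expected share of copies with a bad grid is at most 1/10, so it exceeds 1/2 with probability
    at most 1/5. *)
Lemma grid_good :
  4 / 5 <= pr R (fun S => (#|T| <= 2 * #|[set i in T | ok i S]|)%N).
Proof.
have S0 : (0 < #|{: gridT e r th}|)%N.
  by rewrite card_ffun expn_gt0 pos_gt0.
have := pr_predC R (fun S => (#|T| <= 2 * #|[set i in T | ok i S]|)%N) S0.
set N := #|T|; pose B := (N %/ 2).+1.
have T1 : (0 < N)%N by rewrite card_gt0.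
suff : pr R (fun S => ~~ (N <= 2 * #|[set i in T | ok i S]|)%N) <= 5^-1 by lra.
apply: le_trans (pr_mono R (Q := fun S => B <= #|[pred i | (i \in T) && ~~ ok i S]|)%N _) _.
  move=> S; rewrite -ltnNge => H.
  have : (#|[set i in T | ok i S]| + #|[pred i | (i \in T) && ~~ ok i S]| = N)%N.
    rewrite /N -(cardsID [set i | ok i S] T); congr addn; apply: eq_card => i.
      by rewrite !inE.
    by rewrite !inE andbC.
  by rewrite /B; lia.
have B0 : 0 < B%:R :> R by rewrite ltr0n.
rewrite -(ler_pM2r B0); apply: le_trans (pr_markov R (fun i S => (i \in T) && ~~ ok i S) B) _.
apply: (@le_trans _ _ (\sum_(i in T) 10^-1)).
  rewrite [leRHS]big_mkcond; apply: ler_sum => i _; case: ifP => [iT|_].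
    exact: le_trans (pr_mono _ _) (Hok iT).
  by rewrite /pr (eq_card (B := pred0)) // card0 mul0r.
rewrite sumr_const -/N -(mulr_natl 10^-1).
have : (N <= 2 * B)%N by rewrite /B; lia.
by rewrite -(ler_nat R) natrM; lra.
Qed.

(** The probability bounded below by [linear] is at most 1, which bounds [j]; [Tm] against [bigT]
    bounds [m]. *)
Lemma rate_bounds : (2 ^ j <= 8 * Qu)%N /\ (2 ^ m <= 2 * Qu)%N.
Proof.
have T1 : (0 < #|T|)%N by rewrite card_gt0.
have L0 : 0 < (2 ^ lam)%:R :> R by rewrite ltr0n expn_gt0.
split; last by rewrite -(leq_pmul2l T1) (leq_trans Tm) // mulnCA leq_mul2l.
have := le_trans (linear (subxx T)) (pr_le1 _ _).
rewrite ler_pdivrMr ?mulr_gt0 // mul1r -!natrM ler_nat => H.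
by rewrite -(leq_pmul2l T1) (leq_trans H) // mulnCA leq_mul2l.
Qed.

Lemma card_cover (A : {set I}) (s : seq nat) (Q : nat -> pred I) : A \subset T ->
  (forall i, i \in A -> exists2 J, J \in s & Q J i) ->
  (#|A| <= \sum_(J <- s) #|[set i in T | Q J i]|)%N.
Proof.
move=> AT; elim: s A AT => [|J s IH] A AT HA.
  rewrite big_nil leqn0 cards_eq0; apply/set0Pn => -[i /HA[]] //.
rewrite big_cons -(cardsID [set i | Q J i] A) leq_add //.
  by rewrite subset_leq_card //; apply/subsetP => i; rewrite !inE => /andP[/(subsetP AT)-> ->].
apply: IH; first by apply/subsetP => i; rewrite !inE => /andP[_ /(subsetP AT)].
move=> i; rewrite !inE => /andP[nQ /HA[J']]; rewrite inE => /orP[/eqP->|]; last by exists J'.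
by rewrite (negPf nQ).
Qed.

Lemma card_near J : ~~ im ->
  (#|[set i in T | near J (u i)]| * 2 ^ m <= 6 * 2 ^ ex lam gam r)%N.
Proof.
move=> /cap capz; pose Tz z := [set i in T | u i == z].
have : ([set i in T | near J (u i)] \subset Tz J.-1 :|: Tz J :|: Tz J.+1).
  by apply/subsetP => i; rewrite !inE /near => /andP[-> /=]; lia.
move=> /subset_leq_card H.
have : (#|[set i in T | near J (u i)]| <= #|Tz J.-1| + #|Tz J| + #|Tz J.+1|)%N.
  apply: leq_trans H _; apply: leq_trans (leq_card_setU _ _) _.
  by rewrite leq_add2r leq_card_setU.
have ca : (#|Tz J.-1| * 2 ^ m <= 2 * 2 ^ ex lam gam r)%N := capz _.
have cb : (#|Tz J| * 2 ^ m <= 2 * 2 ^ ex lam gam r)%N := capz _.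
have cc : (#|Tz J.+1| * 2 ^ m <= 2 * 2 ^ ex lam gam r)%N := capz _.
move=> /leq_mul /(_ (leqnn (2 ^ m))) /leq_trans; apply; rewrite !mulnDl; lia.
Qed.

(** Let [X] be the guesses for which a batch expects a hit. If at least half of the good copies have
    no guess of [X] nearby, [trial_small] applies to them. Otherwise the remaining copies, at most
    [6 * 2 ^ ex r / 2 ^ m] per guess, force [X] to be dense, and [trial_large] applies. *)
Lemma grid_trial S : (#|T| <= 2 * #|[set i in T | ok i S]|)%N ->
  (2 ^ maxn m (j - Ec))%:R / (64 * Qu%:R) <= pr R (trial_hit (e := e) (M := nM th) Ec sD (hitB S)).
Proof.
move=> TS; set TSs := [set i in T | ok i S] in TS.
pose X J := 1 <= (nM th)%:R * pr R (fun o => hitB S o J).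
have he : (Ec <= e)%N by rewrite /Ec; lia.
have Ts0 : (0 < #|{: targetT e th}|)%N.
  by rewrite !card_prod !card_ffun !muln_gt0 !expn_gt0 !pos_gt0.
have T1 : (0 < #|T|)%N by rewrite card_gt0.
have Qu0 : (0 < Qu)%N by have := bigT; have := expn_gt0 2 lam; case: (Qu) => //; rewrite muln0; lia.
have Qr : 0 < Qu%:R :> R by rewrite ltr0n.
have L0 : 0 < (2 ^ lam)%:R :> R by rewrite ltr0n expn_gt0.
have C0 : 0 < (2 ^ Ec)%:R :> R by rewrite ltr0n expn_gt0.
have lamE : (2 ^ lam = 2 ^ Ec * 2 ^ ex lam gam r)%N.
  by rewrite -expnD /Ec subnK // ex_le.
have [jb mb] := rate_bounds.
have maxj : (2 ^ (j - Ec) <= 2 ^ j)%N by rewrite leq_exp2l // leq_subr.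
have yb : (2 ^ maxn m (j - Ec) <= 8 * Qu)%N.
  by rewrite /maxn; case: ifP => _; lia.
have large c : (c = cnt Ec sD X)%N ->
    (2 ^ maxn m (j - Ec) * 2 ^ Ec <= c * 32 * Qu)%N ->
    (2 ^ maxn m (j - Ec))%:R / (64 * Qu%:R) <= pr R (trial_hit (e := e) (M := nM th) Ec sD (hitB S)).
  move=> cE cb; apply: (le_trans _ (trial_large sD he Ts0 (X := X) _)) => //.
  rewrite -cE ler_pdivrMr ?mulr_gt0 // mulrA mulrAC ler_pdivlMr //.
  have : ((2 ^ maxn m (j - Ec) * 2 ^ Ec)%:R <= (c * 32 * Qu)%:R :> R) by rewrite ler_nat.
  by rewrite !natrM; lra.
have small (U : {set I}) : U \subset TSs -> (#|TSs| <= 2 * #|U|)%N ->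
    (forall i o, i \in U -> serve o i -> exists J, [/\ J %/ 2 ^ Ec = sD, ~~ X J & hitB S o J]%N) ->
    (2 ^ maxn m (j - Ec))%:R / (64 * Qu%:R) <= pr R (trial_hit (e := e) (M := nM th) Ec sD (hitB S)).
  move=> UT UC HU.
  have UT' : U \subset T by apply: subset_trans UT _; apply/subsetP => i; rewrite inE => /andP[].
  apply: (le_trans _ (trial_small he Ts0 (X := X) (good := fun o => [exists i in U, serve o i]) _ _)).
  - apply: le_trans (ler_wpM2l _ (ler_wpM2r _ (linear UT'))); rewrite ?invr_ge0 ?divr_ge0 ?ler0n //.
    have : (#|T| <= 4 * #|U|)%N by lia.
    move=> TU.
    have H1 : (2 ^ lam * 2 ^ maxn m (j - Ec) * 2 ^ Ec <= 4 * nM th * #|U| * 2 ^ j * Qu)%N.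
      have H2 : (2 ^ maxn m (j - Ec) * 2 ^ Ec <= nM th * 2 ^ j)%N.
        rewrite ME -!expnD leq_exp2l //; lia.
      have H3 : (2 ^ lam <= 4 * #|U| * Qu)%N by nia.
      have := leq_mul H3 H2; nia.
    rewrite -(ler_nat R) !natrM in H1.
    move: L0 C0 Qr H1; move: (2 ^ lam)%:R (2 ^ Ec)%:R Qu%:R (nM th)%:R #|U|%:R => l c q n a.
    move: (2 ^ j)%:R (2 ^ _)%:R => J y l0 c0 q0 H1.
    rewrite ler_pdivrMr ?mulr_gt0 //.
    have -> : n / 2 * (a * J / (8 * l) / c) * (64 * q) = (4 * n * a * J * q) / (l * c).
      by field; rewrite !gt_eqF.
    by rewrite ler_pdivlMr ?mulr_gt0 // mulrCA mulrA.
  - by move=> J; rewrite /X -ltNge => /ltW.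
  - by move=> o /exists_inP[i iU so]; exact: HU iU so.
(* Here every guess works: either all lie in [X], or a single one outside [X] is right for all good
   copies. *)
case: (boolP im) => imb.
  have [allX|/allPn[J0 J0c nX]] := boolP (all X (cell Ec sD)).
    apply: (large _ (erefl _)); move: allX; rewrite all_count => /eqP; rewrite -/(cnt _ _ _) => ->.
    by rewrite size_iota; nia.
  apply: (small TSs) => //; first by lia.
  move=> i o; rewrite inE => /andP[iT iok] so.
  have [/(_ imb) H _] := Hhit iT iok so.
  exists J0; rewrite /hitB H; split=> //.
  by apply/eqP; rewrite -mem_cell.
pose U := [set i in TSs | ~~ has (fun J => near J (u i) && X J) (cell Ec sD)].
pose W := [set i in TSs | has (fun J => near J (u i) && X J) (cell Ec sD)].
have UW : (#|W| + #|U| = #|TSs|)%N.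
  rewrite -(cardsID [set i | has (fun J => near J (u i) && X J) (cell Ec sD)] TSs).
  by congr addn; apply: eq_card => i; rewrite !inE // andbC.
have [UC|UC] := leqP #|TSs| (2 * #|U|).
  apply: (small U) => // [|i o].
    by apply/subsetP => i; rewrite inE => /andP[].
  rewrite !inE => /andP[/andP[iT iok] /hasPn nX] so.
  have [_ /(_ imb)[J [Jd Jn JH]]] := Hhit iT iok so.
  exists J; split=> //; have := nX J; rewrite mem_cell Jd eqxx Jn; exact.
have WT : W \subset T.
  by apply/subsetP => i; rewrite !inE => /andP[/andP[]].
have Wc : (#|W| * 2 ^ m <= cnt Ec sD X * (6 * 2 ^ ex lam gam r))%N.
  have := @card_cover W [seq J <- cell Ec sD | X J] (fun J i => near J (u i)) WT.
  move=> /(_ _)/(leq_trans _) H.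
  apply: (@leq_trans ((\sum_(J <- [seq J <- cell Ec sD | X J]) #|[set i in T | near J (u i)]|) * 2 ^ m)).
    rewrite leq_mul2r H ?orbT // => i; rewrite inE => /andP[_ /hasP[J Jc /andP[Jn XJ]]].
    by exists J; rewrite // mem_filter XJ.
  rewrite big_distrl /= /cnt -size_filter -sum1_size big_distrl /=.
  by apply: leq_sum => J _; rewrite mul1n card_near.
have c0 : (0 < cnt Ec sD X)%N.
  by move: Wc; case: (cnt _ _ _) => //; rewrite mul0n leqn0 muln_eq0 expn_eq0 /=; lia.
apply: (large _ (erefl _)); move: Wc c0; set c := cnt _ _ _ => Wc c0.
have mE : (2 ^ m * 2 ^ Ec <= c * 32 * Qu)%N.
  have TW : (#|T| <= 4 * #|W|)%N by lia.
  have e0 : (0 < 2 ^ ex lam gam r)%N by rewrite expn_gt0.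
  rewrite -(leq_pmul2r e0) -mulnA -lamE.
  apply: (@leq_trans (2 ^ m * (4 * #|W| * Qu))).
    by rewrite leq_mul2l (leq_trans bigT) ?orbT // leq_mul2r TW orbT.
  apply: (@leq_trans (4 * Qu * (c * (6 * 2 ^ ex lam gam r)))).
    by have := leq_mul (leqnn (4 * Qu)%N) Wc; lia.
  by have := leq0n (Qu * (c * 2 ^ ex lam gam r))%N; lia.
(* If [j - Ec] exceeds [m], one guess in [X] is enough, since [2 ^ j <= 8 * Qu]. *)
rewrite /maxn; case: ltnP => // mj'.
apply: (@leq_trans (2 ^ j)); first by rewrite -expnD leq_exp2l //; lia.
nia.
Qed.

Lemma body_win : 2^-1 <= winpr R r (body e lam gam r s0 th) x F P.
Proof.
have he : (Ec <= e)%N by rewrite /Ec; lia.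
have Ts0 : (0 < #|{: targetT e th}|)%N.
  by rewrite !card_prod !card_ffun !muln_gt0 !expn_gt0 !pos_gt0.
have Qu0 : (0 < Qu)%N by have := bigT; have := expn_gt0 2 lam; case: (Qu) => //; rewrite muln0; lia.
pose p : R := (2 ^ maxn m (j - Ec))%:R / (64 * Qu%:R).
have p0 : 0 <= p by rewrite divr_ge0 ?mulr_ge0 ?ler0n.
have HB : (8 * (nJ th * nM th) <= nB th * 2 ^ Ec)%N.
  rewrite BE ME (_ : 128 * nJ th * _ = 8 * (nJ th * (2 ^ 4 * 2 ^ Ec)))%N; last by lia.
  by rewrite !leq_mul2l -expnD leq_exp2l //; apply/orP; right; apply/orP; right; lia.
(* [27 / 40 = 1 - 1 / 5 - 1 / 8]: no trial hits with probability at most [(1 + 4)^-1], and too many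
   candidates cost 1/8. Times the 4/5 of good grids this still exceeds 1/2. *)
have H S : (#|T| <= 2 * #|[set i in T | ok i S]|)%N -> 27 / 40 <= pr R
    (fun v => has132 F (P ++ asked (body e lam gam r s0 th) x (S, v) F r)).
  move=> /grid_trial pp.
  apply: le_trans (_ : 1 - (1 + (nJ th)%:R * p)^-1 - 8^-1 <= _).
    have : 4 <= (nJ th)%:R * p.
      rewrite /p mulrA ler_pdivlMr ?mulr_gt0 ?ltr0n //.
      by move: JE; rewrite -(ler_nat R) !natrM; lra.
    move: (_ * p) => a a4; have : (1 + a)^-1 <= 5^-1 by rewrite lef_pV2 ?posrE; lra.
    lra.
  pose cnd (o : targetT e th) := foc lam gam zW S (bf lam zW P o F) 1.
  apply: le_trans (trials_win he Ts0 cnd p0 pp HB) _; apply: pr_mono => v.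
  move=> /andP[cB /existsP[b /existsP[a ha]]].
  exact: (@body_hit (S, v) b a).
have := pr_pair_ge (Q := fun (S : gridT e r th) (v : {ffun 'I_(nJ th) -> trialT e th}) =>
  has132 F (P ++ asked (body e lam gam r s0 th) x (S, v) F r)) H.
have -> : pr R (fun w : bodyT e r th => has132 F (P ++
  asked (body e lam gam r s0 th) x (w.1, w.2) F r)) = winpr R r (body e lam gam r s0 th) x F P.
  by apply: eq_pr => -[].
by apply: le_trans; have := grid_good; lra.
Qed.

End Win.
End BodyWin.

(** Rounded by [bucket], the fiber sizes fall into [h + 1] classes. Passing to one class keeps or
    drops whole fibers, so the sizes of those kept do not change. *)
Lemma pigeon_fiber (I : finType) (T : {set I}) (key : I -> nat) h :
  T != set0 -> (forall z, #|[set i in T | key i == z]| <= 2 ^ h) ->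
  exists j (T' : {set I}), [/\ j <= h, T' \subset T, #|T| <= h.+1 * #|T'| &
    forall i, i \in T' -> 2 ^ h <= #|[set k in T' | key k == key i]| * 2 ^ j <= 2 * 2 ^ h].
Proof.
move=> T0 Tf; pose fib i := #|[set k in T | key k == key i]|.
pose Q (j : 'I_h.+1) i := 2 ^ h <= fib i * 2 ^ j <= 2 * 2 ^ h.
have HP i : i \in T -> exists j, Q j i.
  move=> iT; have [|u [uh H1 H2]] := @bucket (fib i) h.
    by rewrite Tf andbT card_gt0; apply/set0Pn; exists i; rewrite inE iT eqxx.
  by exists (Ordinal (n := h.+1) uh); rewrite /Q H1.
have T1 : 0 < #|T| by rewrite card_gt0.
have [j] := pigeonhole T1 HP.
rewrite card_ord => jT; exists j, [set i in T | Q j i]; split=> //.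
- by rewrite -ltnS.
- by apply/subsetP => i; rewrite inE => /andP[].
move=> i; rewrite inE => /andP[iT Qi]; suff -> : [set k in [set i in T | Q j i] | key k == key i] = [set k in T | key k == key i] by [].
apply/setP => k; rewrite !inE; case: (k \in T) => //=.
by case: eqP => [E|]; rewrite ?andbF // andbT /Q /fib E.
Qed.

Lemma fiber_cover (I : finType) (key : I -> nat) (U : {set I}) j a L z D : z <= L ->
  (forall i, i \in U -> key i %/ 2 ^ (L - z) = D) ->
  (forall c, #|[set i in U | key i == c]| * 2 ^ j <= a * 2 ^ z) ->
  #|U| * 2 ^ j <= a * cnt L D (fun p => [exists i in U, key i == p %/ 2 ^ z]).
Proof.
move=> zL keyD fib; pose K c := [exists i in U, key i == c].
have HU : #|U| <= \sum_(c <- cell (L - z) D) #|[set i in U | key i == c]|.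
  apply: card_cover => // i iU; exists (key i) => //=.
  by rewrite mem_cell keyD.
apply: (leq_trans (leq_mul HU (leqnn (2 ^ j)))).
rewrite (cnt_split _ _ zL) -[iota _ _]/(cell (L - z) D) big_distrl /= big_distrr /=.
apply: leq_sum => c _; have [Kc|nKc] := boolP (K c).
  rewrite (leq_trans (fib c)) // leq_mul2l (eq_cnt (Q := predT)) => [|p]; last first.
    by rewrite mem_cell => /eqP ->.
  by rewrite /cnt count_predT size_iota leqnn orbT.
rewrite (_ : [set i in U | _] = set0) ?cards0 ?mul0n //.
apply/setP => i; rewrite !inE; apply: contraNF nKc => /andP[iU kc].
by apply/exists_inP; exists i.
Qed.

Section Linear.
Context (R : realFieldType) (e lam : nat) (th : params) (zW : nat).
Variables (I : finType) (key : I -> nat) (j a : nat) (U : {set I}).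
Variable G : I -> pred ({ffun 'I_(nt th) -> pos e} * {ffun 'I_(nt th) -> pos e}).
Hypotheses (le : lam <= e) (zl : zx th <= lam).
Hypothesis keyD : forall i, i \in U -> key i %/ 2 ^ (lam - zx th) = pdom th zW.
Hypothesis fib : forall z, #|[set i in U | key i == z]| * 2 ^ j <= a * 2 ^ zx th.
Local Open Scope ring_scope.
Hypothesis HG : forall i, i \in U -> a%:R / 8 <= pr R (G i).

(** A cell carries at most [a * 2 ^ (zx - j)] copies, so the cells of [U] cover at least
    [#|U| * 2 ^ j / a] positions. The random cell is one of them in this proportion and then serves
    with probability [a / 8]; the factor [a] cancels. *)
Lemma linear_cells :
  #|U|%:R * (2 ^ j)%:R / (8 * (2 ^ lam)%:R) <=
  pr R (fun o : targetT e th => [exists i in U, (zc lam zW o == key i) && G i o.2]).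
Proof.
pose K z := [exists i in U, key i == z].
pose D := pdom th zW.
have H1 : (#|U| * 2 ^ j <= a * cnt lam D (fun p => K (p %/ 2 ^ zx th)))%N.
  exact: fiber_cover.
have := pr_pair_ge (R := R) (A := fun y : pos e => K (smp lam D y %/ 2 ^ zx th)%N) (c := a%:R / 8)
  (Q := fun y g => [exists i in U, (zc lam zW (y, g) == key i) && G i g]).
rewrite (pr_smp R D (fun p => K (p %/ 2 ^ zx th)%N) le) => H2.
apply: le_trans (H2 _) => [|y /exists_inP[i iU /eqP ki]]; last first.
  apply: le_trans (HG iU) _; apply: pr_mono => g Gg.
  by apply/exists_inP; exists i; rewrite // Gg andbT /zc -/D ki.
have L0 : 0 < (2 ^ lam)%:R :> R by rewrite ltr0n expn_gt0.
move: H1; rewrite -(ler_nat R) !natrM => H1.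
rewrite ler_pdivrMr ?mulr_gt0 //.
set c := (cnt _ _ _)%:R in H1 *; move: (2 ^ lam)%:R L0 => l l0.
have -> : c / l * (a%:R / 8) * (8 * l) = a%:R * c by field; rewrite gt_eqF.
exact: H1.
Qed.

End Linear.

(** * Targets *)

Lemma double_double s c : 2 * (2 * (s * c)) = c * (s * 2 ^ 2).
Proof. by lia. Qed.

Lemma subn_split a b c : a <= b -> b <= c -> c - a = (b - a) + (c - b).
Proof. by lia. Qed.

Lemma lt_of_16_8 a b n : 16 * a < n -> n <= 8 * b -> a < b.
Proof. by lia. Qed.

(** [13 / 16 = 1 - 1 / 8 - 1 / 16] is the share left to the value f(l) in a cell where one side
    takes less than 1/8 and the other less than 1/16. *)
Lemma mostly_equal a b c n : 8 * a < n -> 16 * b < n -> a + c + b = n -> 13 * n <= 16 * c.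
Proof. by lia. Qed.

Lemma near_mem a b : near a b -> a \in [:: b.-1; b; b.+1].
Proof. by rewrite /near !inE; lia. Qed.

Lemma near_refl a : near a a.
Proof. by rewrite /near leqnSn. Qed.

Lemma cap_sum (I : finType) (T : {set I}) (g : I -> nat) h h' b c z : h' <= h ->
  (forall D, #|[set i in T | g i %/ 2 ^ h' == D]| * 2 ^ b <= c * 2 ^ h') ->
  #|[set i in T | g i %/ 2 ^ h == z]| * 2 ^ b <= c * 2 ^ h.
Proof.
move=> hh H.
have : #|[set i in T | g i %/ 2 ^ h == z]| <=
    \sum_(D <- cell (h - h') z) #|[set i in T | g i %/ 2 ^ h' == D]|.
  apply: card_cover => [|i].
    by apply/subsetP => i; rewrite inE => /andP[].
  rewrite inE => /andP[iT /eqP iz]; exists (g i %/ 2 ^ h') => //=.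
  by rewrite mem_cell divn_exp2 // iz.
move=> H'; apply: leq_trans (leq_mul H' (leqnn (2 ^ b))) _.
rewrite big_distrl /=; apply: leq_trans (leq_sum _ (fun D _ => H D)) _.
rewrite big_const_seq count_predT size_iota iter_addn_0 -mulnA -expnD subnKC //.
Qed.

Section Instances.
Context {d : Order.disp_t} {V : orderType d}.
Variables (R : realFieldType) (e lam gam r s0 K Q u1 : nat).
Variables (F : nat -> V) (x : shareT e s0).
Let zW := zw lam x.
Let P := P0 lam x.
Let ab := above (map F P).
Let Qu := Q * 2 ^ u1.
Let Ec := lam - ex lam gam r.

(* [2 ^ - m] is the density of the values sought in the searched cells, and
   [2 ^ j / 2 ^ lam] the order of the probability that a random target serves a
   given copy. *)
Definition mkth (k : kind) (z m j : nat) : params :=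
  Params k z (20 * K * 2 ^ m) (if k is Ext _ then 2 ^ (j - 2) else 8 * 2 ^ j)
    (2 ^ (lam - ex lam gam r + m - j))
    (256 * Q * 2 ^ (u1 - maxn m (j - (lam - ex lam gam r))))
    (128 * (256 * Q * 2 ^ (u1 - maxn m (j - (lam - ex lam gam r))))).

Hypotheses (r0 : 0 < r) (rK : r < K) (le : lam <= e) (top : lam <= gam * r.+1).
Hypothesis zWe : zW.+2 <= 2 ^ (e - lam).

Variables (I : finType) (ti tj tk : I -> nat).
Hypotheses (ti_inj : injective ti) (tj_inj : injective tj) (tk_inj : injective tk).

Definition inW (i : I) : Prop :=
  [/\ ti i < tj i < tk i, (F (ti i) < F (tk i) < F (tj i))%O,
      ti i %/ 2 ^ lam = zW, tk i %/ 2 ^ lam = zW.+1 & ab (F (tk i))].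

(** The bounds on [j] and [m] are recorded because the query cost of the parameters depends on
    them. *)
Definition concl (th : params) (m j : nat) : Prop :=
  [/\ (2^-1 <= winpr R r (body e lam gam r s0 th) x F P)%R,
      2 ^ j <= 8 * Qu, 2 ^ m <= 2 * Qu & m <= j + 4].

Lemma mk_win (T : {set I}) k z m j (serve : targetT e (mkth k z m j) -> I -> bool)
    (ok : I -> pred (gridT e r (mkth k z m j))) (im : bool) (u : I -> nat) :
  (forall U : {set I}, U \subset T ->
    #|U|%:R * (2 ^ j)%:R / (8 * (2 ^ lam)%:R) <= pr R (fun o => [exists i in U, serve o i]))%R ->
  (forall i, i \in T -> pr R (fun S => ~~ ok i S) <= 10^-1)%R ->
  (forall S i o, i \in T -> ok i S -> serve o i ->
    (im -> imm lam gam F x S o) /\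
    (~~ im -> exists J, [/\ J %/ 2 ^ Ec = sdom (mkth k z m j) zW, near J (u i) &
       hitB lam gam F x S o J])) ->
  (~~ im -> forall z, #|[set i in T | u i == z]| * 2 ^ m <= 2 * 2 ^ ex lam gam r) ->
  T != set0 -> 2 ^ lam <= #|T| * Qu -> #|T| * 2 ^ m <= 2 * 2 ^ lam -> m <= j + 4 ->
  concl (mkth k z m j) m j.
Proof.
move=> lin Hok Hhit cap T0 bigT Tm mj.
have [jb mb] := rate_bounds lin T0 bigT Tm.
split=> //; apply: (body_win r0 le lin Hok Hhit cap T0 bigT Tm mj) => //=.
rewrite /Qu -!mulnA !leq_mul2l -expnD leq_exp2l //; apply/orP; right; apply/orP; right.
lia.
Qed.

Lemma mem_P0 p : p \in P -> p %/ 2 ^ lam = zW.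
Proof. by move=> /mapP[i _ ->]; rewrite smp_div. Qed.

Lemma sl_div th (S : gridT e r th) t z p : p \in sl lam gam S t z -> p %/ 2 ^ ex lam gam t = z.
Proof. by move=> /mapP[i _ ->]; rewrite smp_div. Qed.

Lemma lev_dom th (S : gridT e r th) t c p :
  p \in lev lam gam zW S t c -> p %/ 2 ^ lam = sdom th zW.
Proof.
move=> /flattenP[_ /mapP[z zk ->] ps].
by rewrite -(kids_dom zk) -(sl_div ps) divn_exp2 // ex_le.
Qed.

Lemma P1_cell th (o : targetT e th) p : p \in P1 lam zW o -> p %/ 2 ^ zx th = zc lam zW o.
Proof. by move=> /mapP[i _ ->]; rewrite smp_div. Qed.

Lemma P2_cell th (o : targetT e th) p : p \in P2 lam zW o -> p %/ 2 ^ zx th = (zc lam zW o).+1.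
Proof. by move=> /mapP[i _ ->]; rewrite smp_div. Qed.

Lemma div_lt p q h : p %/ 2 ^ h < q %/ 2 ^ h -> p < q.
Proof. by move=> H; rewrite ltnNge; apply: contraL H => /(leq_div2r (2 ^ h)); rewrite -leqNgt. Qed.

(** * Ranks of f(l) in its cells, and the search of the right half *)

Definition pl (p q : nat) : bool := (F p < F q)%O || ((F p == F q) && (p <= q)).

Lemma pl_refl : reflexive pl. Proof. by move=> p; rewrite /pl eqxx leqnn orbT. Qed.

Lemma pl_trans : transitive pl.
Proof.
move=> q p s; rewrite /pl => /orP[pq|/andP[/eqP-> pq]] /orP[qs|/andP[/eqP<- qs]].
- by rewrite (lt_trans pq qs).
- by rewrite pq.
- by rewrite qs.
- by rewrite eqxx (leq_trans pq qs) orbT.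
Qed.

Lemma pl_total : total pl.
Proof.
move=> p q; rewrite /pl; case: (ltgtP (F p) (F q)) => //= _; exact: leq_total.
Qed.

Lemma pl_le p q : pl p q -> (F p <= F q)%O.
Proof. by rewrite /pl => /orP[/ltW|/andP[/eqP->]]. Qed.

(** Ranks of l in its level-[t] cell, with ties ordered by position so that copies have distinct
    ranks. From below only values exceeding a sample of the left half count, as only these can end
    an inversion that completes to a copy. *)
Definition upc t i := cnt (ex lam gam t) (tk i %/ 2 ^ ex lam gam t) (pl (tk i)).
Definition dnc t i :=
  cnt (ex lam gam t) (tk i %/ 2 ^ ex lam gam t) (fun p => ab (F p) && pl p (tk i)).

Definition rdense b i := forall t, t <= r ->
  2 ^ ex lam gam t <= upc t i * 2 ^ b /\ 2 ^ ex lam gam t <= dnc t i * 2 ^ b.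

(** Together with [rdense]: the density [2 ^ - b] is attained up to a factor 2 at this level and on
    this side. *)
Definition tight (up : bool) t b i : bool :=
  (if up then upc t i else dnc t i) * 2 ^ b <= 2 * 2 ^ ex lam gam t.

(** The extreme copy of a cell has all other copies of the cell in its rank count, which is capped;
    larger cells are unions of such cells. *)
Lemma tight_cap (T : {set I}) up t b h z : t <= r -> ex lam gam t <= h ->
  (forall i, i \in T -> inW i /\ tight up t b i) ->
  #|[set i in T | tk i %/ 2 ^ h == z]| * 2 ^ b <= 2 * 2 ^ h.
Proof.
move=> tr th HT; apply: (cap_sum _ th) => D; set A := [set i in T | _].
have [->|/set0Pn[i0 i0A]] := eqVneq A set0; first by rewrite cards0 mul0n.
have AT i : i \in A -> [/\ inW i, tight up t b i & tk i %/ 2 ^ ex lam gam t = D].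
  by rewrite inE => /andP[/HT[? ?] /eqP ?].
pose ord : rel nat := fun p q => if up then pl p q else pl q p.
have ordr : reflexive ord by move=> p; rewrite /ord; case: (up); rewrite pl_refl.
have ordt : transitive ord.
  move=> q p s; rewrite /ord; case: (up) => H1 H2; [exact: pl_trans H1 H2 | exact: pl_trans H2 H1].
have ordT : total ord by move=> p q; rewrite /ord; case: (up); exact: pl_total.
case: (extremumP tk ordr ordt ordT (P := mem A) i0A) => i /AT[iW it iD] imin.
apply: leq_trans it; rewrite leq_mul2r; apply/orP; right.
have kP k : k \in A -> tk k %/ 2 ^ ex lam gam t = D /\ ab (F (tk k)).
  by move=> /AT[[]].
have {}imin k : k \in A -> ord (tk i) (tk k) by exact: imin.
rewrite /upc /dnc iD; move: imin; rewrite /ord; case: (up) => imin;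
  apply: (card_le_cnt tk_inj) => k kA; have [kD kab] := kP _ kA; split=> //.
  exact: imin.
by rewrite kab; exact: imin.
Qed.

Lemma cell_lt_e i t c : tk i %/ 2 ^ lam = zW.+1 -> c = tk i %/ 2 ^ ex lam gam t -> c < 2 ^ e.
Proof.
move=> iz ->; apply: leq_ltn_trans (leq_div _ _) _.
rewrite -(subnK le) expnD -ltn_divLR ?expn_gt0 // iz.
exact: zWe.
Qed.

(** Level 0 consists of single positions, so [tmin = 1] and the search ends by querying l itself,
    which is [found]. [rdense] supplies both sides of the target in the very cell of l at each
    level, [tight] supplies the cap. *)
Lemma right_win (T : {set I}) k z b j (serve : targetT e (mkth k z b j) -> I -> bool) up tR :
  sdom (mkth k z b j) zW = zW.+1 -> tR <= r ->
  (forall i, i \in T -> [/\ inW i, rdense b i & tight up tR b i]) ->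
  (forall U : {set I}, U \subset T ->
    #|U|%:R * (2 ^ j)%:R / (8 * (2 ^ lam)%:R) <= pr R (fun o => [exists i in U, serve o i]))%R ->
  (forall i o, i \in T -> serve o i ->
    [/\ forall p, ab (F p) -> (F p <= F (tk i))%O -> bf lam zW P o F p || fd lam zW P o F p,
        forall p, (F (tk i) <= F p)%O -> af lam zW P o F p || fd lam zW P o F p,
        fd lam zW P o F (tk i) &
        forall q, (forall p, p \in q -> p %/ 2 ^ lam = zW.+1) ->
          wins (bf lam zW P o F) (af lam zW P o F) (fd lam zW P o F) q ->
          has132 F (P ++ (P1 lam zW o ++ P2 lam zW o) ++ q)]) ->
  T != set0 -> 2 ^ lam <= #|T| * Qu -> b <= j + 4 ->
  concl (mkth k z b j) b j.
Proof.
move=> sD tRr HT lin Hst T0 bigT bj.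
have K0 : 0 < K by lia.
have capT h z' : ex lam gam tR <= h ->
    #|[set i in T | tk i %/ 2 ^ h == z']| * 2 ^ b <= 2 * 2 ^ h.
  by move=> hh; apply: (tight_cap (up := up) z' tRr hh) => i /HT[].
pose E t i (S : gridT e r (mkth k z b j)) :=
  has (fun p => ab (F p) && pl p (tk i)) (sl lam gam S t (tk i %/ 2 ^ ex lam gam t)).
pose E' t i (S : gridT e r (mkth k z b j)) :=
  has (pl (tk i)) (sl lam gam S t (tk i %/ 2 ^ ex lam gam t)).
apply: (mk_win (ok := fun i S => all (fun t => E t i S && E' t i S) (iota 1 r))
  (im := false) (u := fun i => tk i %/ 2 ^ ex lam gam r) lin) => //.
- move=> i iT; have [iW id _] := HT i iT; have [_ _ _ iz _] := iW.
  apply: (@grid_all R e lam gam r s0 (mkth k z b j) x K b K0 erefl le) => [|t|t];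
    rewrite ?size_iota; first exact: ltnW.
    rewrite mem_iota => /andP[t1 tr].
    apply: (@grid_miss R e lam gam r s0 (mkth k z b j) x K b K0 erefl le); [lia|exact: cell_lt_e iz erefl|].
    by have [_] := id t (ltac:(lia)).
  rewrite mem_iota => /andP[t1 tr].
  apply: (@grid_miss R e lam gam r s0 (mkth k z b j) x K b K0 erefl le); [lia|exact: cell_lt_e iz erefl|].
  by have [] := id t (ltac:(lia)).
- move=> S i o iT /allP okS so; split=> // _; rewrite sD.
  have [iW id _] := HT i iT; have [_ _ _ iz _] := iW.
  have [Hb Ha Hf Hw] := Hst i o iT so.
  have HH := @chain_wins lam gam r zW.+1 (sl lam gam S) (bf lam zW P o F) (af lam zW P o F)
    (fd lam zW P o F) (tk i) 1 top (@sl_div _ S) iz (ltac:(lia)).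
  have levW t c : forall p, p \in qlev lam gam zW.+1 (sl lam gam S) t c -> p %/ 2 ^ lam = zW.+1.
    by move=> p; have := @lev_dom _ S t c p; rewrite /lev sD.
  case: HH.
  + move=> t tr; right; exists (tk i %/ 2 ^ ex lam gam t); split.
    * exact: near_refl.
    * by rewrite divn_exp2 ?ex_le.
    have /okS/andP[/hasP[p ps /andP[pab ppl]] _] : t \in iota 1 r by rewrite mem_iota; lia.
    by apply/hasP; exists p => //; apply: Hb => //; exact: pl_le.
  + move=> t tr; right; exists (tk i %/ 2 ^ ex lam gam t); split.
    * exact: near_refl.
    * by rewrite divn_exp2 ?ex_le.
    have /okS/andP[_ /hasP[p ps ppl]] : t \in iota 1 r by rewrite mem_iota; lia.
    by apply/hasP; exists p => //; apply: Ha; exact: pl_le.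
  + have ex0 : ex lam gam 0 = 0 by rewrite /ex muln0 minn0.
    move=> q Hq; rewrite /wins; apply/orP; left; apply/hasP; exists (tk i) => //.
    apply: (Hq (tk i)); first by rewrite ex0 subn0.
    have ns0 : 0 < 20 * K * 2 ^ b by rewrite !muln_gt0 K0 expn_gt0.
    by apply/mapP; exists (Ordinal ns0); rewrite ?mem_enum // ex0 smp0.
  + move=> w0; exists (tk i %/ 2 ^ ex lam gam r); split.
    * by rewrite divn_exp2 ?ex_le.
    * exact: near_refl.
    rewrite /hitB; apply/orP; left; rewrite /imm -/zW /lev sD; apply: Hw; first exact: levW.
    by move: w0; rewrite subn0.
  case=> _ fn fdom [k' /andP[k0 kr] wk].
  exists (focusn lam gam r zW.+1 (sl lam gam S) (bf lam zW P o F) 1); split=> //.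
  rewrite /hitB -/zW -/P /foc sD eqxx /=; apply/orP; right; apply/existsP.
  have kr' : k' < r.+1 by [].
  exists (Ordinal kr'); rewrite k0 /=; rewrite /lev sD.
  by apply: Hw wk; exact: levW.
- by move=> _ z'; apply: capT; apply: ex_mono.
have := capT lam zW.+1 (ex_le _ _ _).
rewrite (_ : [set i in T | _] = T) //; apply/setP => i; rewrite inE.
by case iT: (i \in T) => //=; have [[_ _ _ -> _] _ _] := HT _ iT; rewrite eqxx.
Qed.

Lemma has_low (l : seq nat) (v : V) :
  has (fun q : nat * V => (q.2 < v)%O) [seq (p, F p) | p <- l] = has (fun p => (F p < v)%O) l.
Proof. by rewrite has_map. Qed.

Lemma has_high (l : seq nat) (v : V) :
  has (fun q : nat * V => (v < q.2)%O) [seq (p, F p) | p <- l] = has (fun p => (v < F p)%O) l.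
Proof. by rewrite has_map. Qed.

Lemma take1_enum n (n0 : 0 < n) (T : Type) (f : 'I_n -> T) :
  take 1 [seq f i | i <- enum 'I_n] = [:: f (Ordinal n0)].
Proof.
case: n n0 f => // n n0 f; rewrite enum_ordSl /= take0; congr [:: f _].
exact: val_inj.
Qed.

Lemma above_P v : ab v -> exists2 p, p \in P & (F p < v)%O.
Proof. by move=> /hasP[y /mapP[p pP ->] yv]; exists p. Qed.

Lemma P_lt p q : p \in P -> q %/ 2 ^ lam = zW.+1 -> p < q.
Proof. by move=> /mem_P0 pz qz; apply: (@div_lt _ _ lam); rewrite pz qz. Qed.

Definition cB z c i := cnt z c (fun p => (F p < F (tk i))%O).
Definition cA z c i := cnt z c (fun p => (F (tk i) < F p)%O).

(** In the copy with the least f(l), this value is below f(j) for all copies of [A], so its count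
    contains all their [tj]. *)
Lemma count_A (A : {set I}) z c b : (forall i, i \in A -> [/\ inW i, tj i %/ 2 ^ z = c &
    cA z c i * 2 ^ b <= 2 * 2 ^ z]) -> #|A| * 2 ^ b <= 2 * 2 ^ z.
Proof.
have [->|/set0Pn[i0 i0A] HA] := eqVneq A set0; first by rewrite cards0 mul0n.
case: (@Order.TotalTheory.arg_minP _ _ I i0 (mem A) (fun i => F (tk i)) i0A) => i /HA[_ _ ic] imin.
apply: leq_trans ic; rewrite leq_mul2r; apply/orP; right.
apply: (card_le_cnt tj_inj) => k kA; have [[_ /andP[_ kv] _ _ _] kc _] := HA k kA.
by split=> //; apply: le_lt_trans kv; exact: imin.
Qed.

Lemma count_B (A : {set I}) z c b : (forall i, i \in A -> [/\ inW i, ti i %/ 2 ^ z = c &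
    cB z c i * 2 ^ b <= 2 * 2 ^ z]) -> #|A| * 2 ^ b <= 2 * 2 ^ z.
Proof.
have [->|/set0Pn[i0 i0A] HA] := eqVneq A set0; first by rewrite cards0 mul0n.
case: (@Order.TotalTheory.arg_maxP _ _ I i0 (mem A) (fun i => F (tk i)) i0A) => i /HA[_ _ ic] imax.
apply: leq_trans ic; rewrite leq_mul2r; apply/orP; right.
apply: (card_le_cnt ti_inj) => k kA; have [[_ /andP[kv _] _ _ _] kc _] := HA k kA.
by split=> //; apply: lt_le_trans kv _; exact: imax.
Qed.

Lemma hit_ge n h z (X : pred nat) c a : h <= e -> c <= cnt h z X -> a * 2 ^ h <= n * c ->
  (1 - (1 + a%:R)^-1 <=
   pr R (fun f : {ffun 'I_n -> pos e} => [exists i, X (smp h z (f i))]))%R.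
Proof.
move=> he cX ac; apply: le_trans (pr_smp_hit R z X n he).
have h0 : (0 < (2 ^ h)%:R :> R)%R by rewrite ltr0n expn_gt0.
rewrite lerD2l lerN2 lef_pV2 ?posrE; last 2 first.
- by rewrite ltr_pwDl ?ltr01 // mulr_ge0 ?divr_ge0 ?ler0n.
- by rewrite ltr_pwDl ?ltr01 ?ler0n.
rewrite lerD2l mulrA ler_pdivlMr // -!natrM ler_nat (leq_trans ac) //.
by rewrite leq_mul2l cX orbT.
Qed.

(** * Targets that bracket f(l) by two adjacent cells *)

Definition pair_data z j (Zp : I -> nat) i :=
  [/\ Zp i %/ 2 ^ (lam - z) = zW, (Zp i).+1 %/ 2 ^ (lam - z) = zW,
      2 ^ z <= cB z (Zp i) i * 2 ^ j, 2 ^ z <= cA z (Zp i).+1 i * 2 ^ j &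
      (cA z (Zp i).+1 i * 2 ^ j <= 2 * 2 ^ z) && (tj i %/ 2 ^ z == (Zp i).+1) ||
      (cB z (Zp i) i * 2 ^ j <= 2 * 2 ^ z) && (ti i %/ 2 ^ z == Zp i)].

(** Each copy has its [tj] or its [ti] in a cell whose count is capped. By [count_A] and [count_B] a
    pair of cells carries at most [2 * 2 ^ (z - j)] copies of either sort, whence [a = 4]. *)
Lemma pair_win (T : {set I}) z b j up tR Zp : z <= lam -> tR <= r ->
  (forall i, i \in T -> [/\ inW i, rdense b i, tight up tR b i & pair_data z j Zp i]) ->
  T != set0 -> 2 ^ lam <= #|T| * Qu -> b <= j + 4 -> concl (mkth Pair z b j) b j.
Proof.
move=> zl tRr HT T0 bigT bj.
pose G i (g : {ffun 'I_(8 * 2 ^ j) -> pos e} * {ffun 'I_(8 * 2 ^ j) -> pos e}) :=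
  [exists a, (F (smp z (Zp i) (g.1 a)) < F (tk i))%O] &&
  [exists a, (F (tk i) < F (smp z (Zp i).+1 (g.2 a)))%O].
pose serve (o : targetT e (mkth Pair z b j)) i := (zc lam zW o == Zp i) && G i o.2.
have ze : z <= e := leq_trans zl le.
apply: (right_win (T := T) (serve := serve) (up := up) (tR := tR)) => //.
- by move=> i /HT[].
- move=> U /subsetP UT; apply: (linear_cells (th := mkth Pair z b j) (a := 4)) => //.
  + by move=> i /UT/HT[_ _ _ []].
  + move=> c /=; rewrite (_ : 4 * 2 ^ z = 2 * 2 ^ z + 2 * 2 ^ z); last by lia.
    rewrite -(cardsID [set i | (cA z (Zp i).+1 i * 2 ^ j <= 2 * 2 ^ z) && (tj i %/ 2 ^ z == (Zp i).+1)]) mulnDl.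
    apply: leq_add.
      apply: (@count_A _ _ c.+1) => i; rewrite !inE.
      move=> /andP[/andP[/UT/HT[iW _ _ _] /eqP zi]]; rewrite zi => /andP[H /eqP H'].
      by split.
    apply: (@count_B _ _ c) => i; rewrite !inE => /andP[/negPf nA /andP[iU /eqP zi]].
    have [iW _ _ [_ _ _ _]] := HT i (UT i iU); rewrite nA zi => /andP[H /eqP H'].
    by split.
  + move=> i /UT/HT[_ _ _ [_ _ Bc Ac _]].
    have B8 : 8 * 2 ^ z <= 8 * 2 ^ j * cB z (Zp i) i by rewrite -mulnA leq_mul2l [_ ^ j * _]mulnC Bc.
    have A8 : 8 * 2 ^ z <= 8 * 2 ^ j * cA z (Zp i).+1 i by rewrite -mulnA leq_mul2l [_ ^ j * _]mulnC Ac.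
    have H1 := hit_ge ze (leqnn (cB z (Zp i) i)) B8.
    have H2 := hit_ge ze (leqnn (cA z (Zp i).+1 i)) A8.
    have G0 : 0 < #|{: {ffun 'I_(8 * 2 ^ j) -> pos e}}| by rewrite card_ffun expn_gt0 pos_gt0.
    have GG0 : 0 < #|{: {ffun 'I_(8 * 2 ^ j) -> pos e} * {ffun 'I_(8 * 2 ^ j) -> pos e}}|.
      by rewrite card_prod muln_gt0 G0.
    rewrite -(pr_fst R _ G0) in H1; rewrite -(pr_snd R _ G0) in H2.
    have E9 : (1 + 8%:R = 9 :> R)%R by rewrite addrC natr1.
    by rewrite E9 in H1 H2; apply: le_trans (pr_predI GG0 H1 H2); lra.
- move=> i o iT /andP[/eqP zi /andP[/existsP[a1 Fa1] /existsP[a2 Fa2]]].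
  have [iW _ _ [Z1 Z2 _ _ _]] := HT i iT.
  set q1 := smp _ _ _ in Fa1; set q2 := smp _ _ _ in Fa2.
  have q1P : q1 \in P1 lam zW o by apply/mapP; exists a1; rewrite ?mem_enum // zi.
  have q2P : q2 \in P2 lam zW o by apply/mapP; exists a2; rewrite ?mem_enum // zi.
  have low v : (F (tk i) <= v)%O -> has (fun p => (F p < v)%O) (P1 lam zW o).
    by move=> iv; apply/hasP; exists q1 => //; exact: lt_le_trans iv.
  have high v : (v <= F (tk i))%O -> has (fun p => (v < F p)%O) (P2 lam zW o).
    by move=> iv; apply/hasP; exists q2 => //; exact: le_lt_trans Fa2.
  rewrite /bf /af /fd /st /=; split.
  + move=> p pab pv; rewrite !has_low !has_high.
    by rewrite -/ab pab high //= andbT; case: has.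
  + move=> p pv; rewrite !has_low !has_high.
    by rewrite low //=; case: has.
  + by rewrite has_low has_high low // high.
  move=> q qD /orP[/hasP[p pq fp]|/hasP[p pq /andP[Bp /hasP[p' p'q /andP[pp' Ap']]]]]; apply/has132P.
    move: fp; rewrite has_low has_high.
    move=> /andP[/hasP[s sP sv] /hasP[s' sP' sv']]; exists s, s', p; split.
    * by rewrite !mem_cat sP !orbT.
    * by rewrite !mem_cat sP' !orbT.
    * by rewrite !mem_cat pq !orbT.
    have sc := P1_cell sP; have sc' := P2_cell sP'; rewrite /= in sc sc'.
    rewrite sv sv' !andbT (@div_lt _ _ z) ?sc ?sc' //=.
    by apply: (@div_lt _ _ lam); rewrite (qD _ pq) -(divn_exp2 _ zl) sc' zi Z2.
  (* The inversion is completed by a sample [x0] of the left half: its first value is at least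
     [F s], its second one is below [F s] and above [F x0]. *)
  move: Ap' Bp; rewrite has_low !has_high.
  move=> /and3P[/above_P[x0 x0P x0v] _ /hasP[s sP sv]] /hasPn/(_ s sP); rewrite -leNgt => sp.
  exists x0, p, p'; split; rewrite ?mem_cat ?x0P ?pq ?p'q ?orbT //.
  by rewrite pp' x0v (P_lt x0P (qD _ pq)) (lt_le_trans sv sp).
Qed.

(** * Targets that equal f(l), from a nearly constant cell *)

Definition tie_data z (left : bool) (Zp : I -> nat) i :=
  let E := if left then Zp i else (Zp i).+1 in
  let C := if left then (Zp i).+1 else Zp i in
  [/\ Zp i %/ 2 ^ (lam - z) = zW, (Zp i).+1 %/ 2 ^ (lam - z) = zW,
      13 * 2 ^ z <= 16 * cnt z E (fun p => F p == F (tk i)),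
      ti i %/ 2 ^ z = C & tj i %/ 2 ^ z = C].

(** Two distinct values cannot both fill 13/16 of one cell. *)
Lemma tie_value z left Zp i k : tie_data z left Zp i -> tie_data z left Zp k ->
  Zp i = Zp k -> F (tk i) = F (tk k).
Proof.
move=> [_ _ Ei _ _] [_ _ Ek _ _] E; rewrite E in Ei.
apply/eqP; apply: contraT => ne; exfalso.
set c := if left then _ else _ in Ei Ek.
have := cnt_predC z c (fun p => F p == F (tk k)).
have : cnt z c (fun p => F p == F (tk i)) <= cnt z c (predC (fun p => F p == F (tk k))).
  by apply: cnt_mono => p _ /= /eqP ->.
have : 0 < 2 ^ z by rewrite expn_gt0.
lia.
Qed.

(* All targets of one cell have the same value, so splitting their pairs
   (ti, tj) at the median of the positions ti makes every sampled ti of the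
   first half precede every sampled tj of the second half. *)
Lemma tie_win (T : {set I}) z b j up tR left Zp : z <= lam -> tR <= r ->
  (forall i, i \in T -> [/\ inW i, rdense b i, tight up tR b i & tie_data z left Zp i]) ->
  (forall i, i \in T -> 2 ^ z <= #|[set k in T | Zp k == Zp i]| * 2 ^ j <= 2 * 2 ^ z) ->
  T != set0 -> 2 ^ lam <= #|T| * Qu -> b <= j + 4 -> concl (mkth (Tie left) z b j) b j.
Proof.
move=> zl tRr HT Hfib T0 bigT bj.
have n0 : 0 < 8 * 2 ^ j by rewrite muln_gt0 expn_gt0.
pose fE (g : {ffun 'I_(8 * 2 ^ j) -> pos e} * {ffun 'I_(8 * 2 ^ j) -> pos e}) :=
  if left then g.1 else g.2.
pose fC (g : {ffun 'I_(8 * 2 ^ j) -> pos e} * {ffun 'I_(8 * 2 ^ j) -> pos e}) :=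
  if left then g.2 else g.1.
pose cE i := if left then Zp i else (Zp i).+1.
pose cC i := if left then (Zp i).+1 else Zp i.
pose G i g := (F (smp z (cE i) (fE g (Ordinal n0))) == F (tk i)) &&
  crosses (F (tk i)) [seq (p, F p) | p <- [seq smp z (cC i) (fC g a) | a <- enum 'I_(8 * 2 ^ j)]].
pose serve (o : targetT e (mkth (Tie left) z b j)) i := (zc lam zW o == Zp i) && G i o.2.
have ze : z <= e := leq_trans zl le.
apply: (right_win (T := T) (serve := serve) (up := up) (tR := tR)) => //.
- by move=> i /HT[].
- move=> U /subsetP UT; apply: (linear_cells (th := mkth (Tie left) z b j) (a := 2)) => //.
  + by move=> i /UT/HT[_ _ _ []].
  + move=> c /=; have [->|/set0Pn[i]] := eqVneq [set i in U | Zp i == c] set0.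
      by rewrite cards0.
    rewrite inE => /andP[/UT iT /eqP <-]; have /andP[_] := Hfib i iT; apply: leq_trans.
    rewrite leq_mul2r subset_leq_card ?orbT //; apply/subsetP => k.
    by rewrite !inE => /andP[/UT -> ->].
  + move=> i /UT iT; have [iW _ _ id] := HT i iT.
    have /andP[fib _] := Hfib i iT; set A := [set k in T | Zp k == Zp i] in fib.
    have A0 : A != set0 by apply/set0Pn; exists i; rewrite inE iT eqxx.
    have AP k : k \in A -> [/\ inW k, F (tk k) = F (tk i), ti k %/ 2 ^ z = cC i & tj k %/ 2 ^ z = cC i].
      rewrite inE => /andP[kT /eqP kz]; have [kW _ _ kd] := HT k kT.
      rewrite (tie_value kd id kz); split=> //; move: kd => [_ _ _]; rewrite kz //.
    have [m0 [M1 M2]] := median ti A0.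
    pose X1 p := (p <= m0) && (F p < F (tk i))%O.
    pose X2 p := (m0 < p) && (F (tk i) < F p)%O.
    have c1 : #|[set k in A | (ti k <= m0)%O]| <= cnt z (cC i) X1.
      apply: (card_le_cnt ti_inj) => k; rewrite inE => /andP[/AP[[_ /andP[kv _] _ _ _] kE kc _] km].
      by rewrite /X1 -kE kv andbT; split.
    have c2 : #|[set k in A | (m0 <= ti k)%O]| <= cnt z (cC i) X2.
      apply: (card_le_cnt tj_inj) => k; rewrite inE.
      move=> /andP[/AP[[/andP[ij _] /andP[_ kv] _ _ _] kE _ kc] km].
      by rewrite /X2 -kE kv andbT; split=> //; apply: leq_ltn_trans ij.
    (* A half of the fiber has density at least [2 ^ - (j + 1)], so [8 * 2 ^ j] samples expect 4 of
       its positions and miss them all with probability at most 1/5. *)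
    have N1 : 4 * 2 ^ z <= 8 * 2 ^ j * #|[set k in A | (ti k <= m0)%O]|.
      apply: (@leq_trans (4 * 2 ^ j * #|A|)); first by rewrite -mulnA leq_mul2l [_ ^ j * _]mulnC fib.
      by rewrite -[8]/(4 * 2) -!mulnA leq_mul2l mulnCA leq_mul2l M1 orbT.
    have N2 : 4 * 2 ^ z <= 8 * 2 ^ j * #|[set k in A | (m0 <= ti k)%O]|.
      apply: (@leq_trans (4 * 2 ^ j * #|A|)); first by rewrite -mulnA leq_mul2l [_ ^ j * _]mulnC fib.
      by rewrite -[8]/(4 * 2) -!mulnA leq_mul2l mulnCA leq_mul2l M2 orbT.
    have H1 := hit_ge ze c1 N1; have H2 := hit_ge ze c2 N2.
    have H3 : (1 - 3 / 16 <= pr R (fun f : {ffun 'I_(8 * 2 ^ j) -> pos e} =>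
        F (smp z (cE i) (f (Ordinal n0))) == F (tk i)))%R.
      rewrite (pr_ffun_coord R _ (fun y : pos e => F (smp z (cE i) y) == F (tk i))) ?pos_gt0 //.
      rewrite (pr_smp R _ (fun p => F p == F (tk i)) ze) ler_pdivlMr ?ltr0n ?expn_gt0 //.
      have [_ _ + _ _] := id; rewrite -/(cE i) -(ler_nat R) !natrM; lra.
    have G0 : 0 < #|{: {ffun 'I_(8 * 2 ^ j) -> pos e}}| by rewrite card_ffun expn_gt0 pos_gt0.
    have GG0 : 0 < #|{: {ffun 'I_(8 * 2 ^ j) -> pos e} * {ffun 'I_(8 * 2 ^ j) -> pos e}}|.
      by rewrite card_prod muln_gt0 G0.
    have prE (X : pred {ffun 'I_(8 * 2 ^ j) -> pos e}) : pr R X = pr R (fun g => X (fE g)).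
      by rewrite /fE; case: (left); rewrite ?(pr_fst R _ G0) ?(pr_snd R _ G0).
    have prC (X : pred {ffun 'I_(8 * 2 ^ j) -> pos e}) : pr R X = pr R (fun g => X (fC g)).
      by rewrite /fC; case: (left); rewrite ?(pr_fst R _ G0) ?(pr_snd R _ G0).
    have E5 : (1 + 4%:R = 5 :> R)%R by rewrite addrC natr1.
    rewrite prE in H3; rewrite E5 prC in H1; rewrite E5 prC in H2.
    have HH := pr_predI GG0 H3 (pr_predI GG0 H1 H2).
    apply: (le_trans (le_trans _ HH)); first by lra.
    apply: pr_mono => g.
    move=> /andP[gE /andP[/existsP[a1 /andP[a1m a1v]] /existsP[a2 /andP[a2m a2v]]]].
    rewrite /G gE /=; apply/hasP; exists (smp z (cC i) (fC g a1), F (smp z (cC i) (fC g a1))).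
      by apply: (map_f (fun p => (p, F p))); apply: (map_f (fun a => smp z (cC i) (fC g a))); rewrite mem_enum.
    apply/hasP; exists (smp z (cC i) (fC g a2), F (smp z (cC i) (fC g a2))).
      by apply: (map_f (fun p => (p, F p))); apply: (map_f (fun a => smp z (cC i) (fC g a))); rewrite mem_enum.
    by rewrite /= a1v a2v (leq_ltn_trans a1m a2m).
- move=> i o iT /andP[/eqP zi /andP[/eqP gE gC]].
  have [iW _ _ [Z1 Z2 _ _ _]] := HT i iT.
  pose LE := if left then P1 lam zW o else P2 lam zW o.
  pose LC := if left then P2 lam zW o else P1 lam zW o.
  have tE : take 1 [seq (p, F p) | p <- LE] = [:: (smp z (cE i) (fE o.2 (Ordinal n0)), F (tk i))].
    rewrite -map_take /LE /P1 /P2 zi /fE /cE -gE /fE /cE.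
    by case: (left); rewrite take1_enum.
  have cr : crosses (F (tk i)) [seq (p, F p) | p <- LC].
    by move: gC; rewrite /LC /P1 /P2 zi /cC /fC; case: (left).
  have LEC : take 1 (if left then [seq (p, F p) | p <- P1 lam zW o] else [seq (p, F p) | p <- P2 lam zW o]) =
      take 1 [seq (p, F p) | p <- LE] by rewrite /LE; case: (left).
  have LCC : (if left then [seq (p, F p) | p <- P2 lam zW o] else [seq (p, F p) | p <- P1 lam zW o]) =
      [seq (p, F p) | p <- LC] by rewrite /LC; case: (left).
  rewrite /bf /af /fd /st /= LEC LCC tE /= !orbF; split.
  + move=> p pab pv; rewrite -/ab pab /= !orbF; case: ltgtP pv => //= E _.
    by rewrite E cr.
  + move=> p pv; rewrite /= !orbF; case: ltgtP pv => //= E _.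
    by rewrite -E cr.
  + by rewrite eqxx cr.
  have LCP q : q \in LC -> q \in P1 lam zW o ++ P2 lam zW o /\ q %/ 2 ^ lam = zW.
    have P1z : q \in P1 lam zW o -> q %/ 2 ^ lam = zW.
      by move=> qL; rewrite -(divn_exp2 _ zl) (P1_cell qL) zi.
    have P2z : q \in P2 lam zW o -> q %/ 2 ^ lam = zW.
      by move=> qL; rewrite -(divn_exp2 _ zl) (P2_cell qL) zi.
    move: P1z P2z; rewrite /LC mem_cat => P1z P2z.
    by case: ifP => _ qL; rewrite qL ?orbT; split; auto.
  move=> q qD /orP[/hasP[p pq]|/hasP[p pq /andP[Bp /hasP[p' p'q /andP[pp' Ap']]]]]; last first.
    move: Ap' Bp; rewrite /= !orbF => /andP[/above_P[x0 x0P x0v] p'v] pv; apply/has132P.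
    exists x0, p, p'; split; rewrite ?mem_cat ?x0P ?pq ?p'q ?orbT //.
    by rewrite pp' x0v (P_lt x0P (qD _ pq)) (lt_trans p'v pv).
  rewrite /= orbF => /andP[/eqP pv _].
  move: cr => /hasP[_ /mapP[s sL ->] /hasP[_ /mapP[s' sL' ->] /and3P[/= ss sv sv']]].
  have [sP _] := LCP _ sL; have [sP' sc'] := LCP _ sL'.
  apply/has132P; exists s, s', p; split.
  + by rewrite mem_cat [X in _ || X]mem_cat sP orbT.
  + by rewrite mem_cat [X in _ || X]mem_cat sP' orbT.
  + by rewrite !mem_cat pq !orbT.
  by rewrite ss -pv sv sv' /= andbT; apply: (@div_lt _ _ lam); rewrite sc' (qD _ pq).
Qed.

(** Split the copies of one cell at the median [m0] of f(l). A sampled j of the upper half exceeds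
    [m0], a sampled l of the lower half does not, so they form an inversion even if they stem from
    different copies, and a value of [P] completes it. Nothing has to be searched: [im] holds and
    [m = 0]. *)
Lemma inv_win (T : {set I}) w j Zp : w <= lam ->
  (forall i, i \in T -> [/\ inW i, Zp i %/ 2 ^ (lam - w) = zW.+1, tj i %/ 2 ^ w = Zp i &
     tk i %/ 2 ^ w = (Zp i).+1]) ->
  (forall i, i \in T -> 2 ^ w <= #|[set k in T | Zp k == Zp i]| * 2 ^ j <= 2 * 2 ^ w) ->
  T != set0 -> 2 ^ lam <= #|T| * Qu -> concl (mkth Inv w 0 j) 0 j.
Proof.
move=> wl HT Hfib T0 bigT.
pose G i (g : {ffun 'I_(8 * 2 ^ j) -> pos e} * {ffun 'I_(8 * 2 ^ j) -> pos e}) :=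
  [exists a, [exists a', (F (smp w (Zp i).+1 (g.2 a')) < F (smp w (Zp i) (g.1 a)))%O &&
    ab (F (smp w (Zp i).+1 (g.2 a')))]].
pose serve (o : targetT e (mkth Inv w 0 j)) i := (zc lam zW o == Zp i) && G i o.2.
have we : w <= e := leq_trans wl le.
apply: (mk_win (T := T) (serve := serve) (ok := fun _ _ => true) (im := true) (u := fun=> 0)) => //.
- move=> U /subsetP UT; apply: (linear_cells (th := mkth Inv w 0 j) (a := 2)) => //.
  + by move=> i /UT/HT[].
  + move=> c /=; have [->|/set0Pn[i]] := eqVneq [set i in U | Zp i == c] set0.
      by rewrite cards0.
    rewrite inE => /andP[/UT iT /eqP <-]; have /andP[_] := Hfib i iT; apply: leq_trans.
    rewrite leq_mul2r subset_leq_card ?orbT //; apply/subsetP => k.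
    by rewrite !inE => /andP[/UT -> ->].
  + move=> i /UT iT.
    have /andP[fib _] := Hfib i iT; set A := [set k in T | Zp k == Zp i] in fib.
    have A0 : A != set0 by apply/set0Pn; exists i; rewrite inE iT eqxx.
    have AP k : k \in A -> [/\ inW k, tj k %/ 2 ^ w = Zp i & tk k %/ 2 ^ w = (Zp i).+1].
      by rewrite inE => /andP[/HT[kW _ jz kz] /eqP <-].
    have [m0 [M1 M2]] := median (fun i => F (tk i)) A0.
    pose X1 p := (m0 < F p)%O.
    pose X2 p := ab (F p) && (F p <= m0)%O.
    have c1 : #|[set k in A | (m0 <= F (tk k))%O]| <= cnt w (Zp i) X1.
      apply: (card_le_cnt tj_inj) => k; rewrite inE => /andP[/AP[[_ /andP[_ kv] _ _ _] kj _] km].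
      by split=> //; apply: le_lt_trans kv.
    have c2 : #|[set k in A | (F (tk k) <= m0)%O]| <= cnt w (Zp i).+1 X2.
      apply: (card_le_cnt tk_inj) => k; rewrite inE => /andP[/AP[[_ _ _ _ kab] _ kk] km].
      by split=> //; rewrite /X2 kab.
    have N1 : 4 * 2 ^ w <= 8 * 2 ^ j * #|[set k in A | (m0 <= F (tk k))%O]|.
      apply: (@leq_trans (4 * 2 ^ j * #|A|)); first by rewrite -mulnA leq_mul2l [_ ^ j * _]mulnC fib.
      by rewrite -[8]/(4 * 2) -!mulnA leq_mul2l mulnCA leq_mul2l M2 orbT.
    have N2 : 4 * 2 ^ w <= 8 * 2 ^ j * #|[set k in A | (F (tk k) <= m0)%O]|.
      apply: (@leq_trans (4 * 2 ^ j * #|A|)); first by rewrite -mulnA leq_mul2l [_ ^ j * _]mulnC fib.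
      by rewrite -[8]/(4 * 2) -!mulnA leq_mul2l mulnCA leq_mul2l M1 orbT.
    have H1 := hit_ge we c1 N1; have H2 := hit_ge we c2 N2.
    have G0 : 0 < #|{: {ffun 'I_(8 * 2 ^ j) -> pos e}}| by rewrite card_ffun expn_gt0 pos_gt0.
    have GG0 : 0 < #|{: {ffun 'I_(8 * 2 ^ j) -> pos e} * {ffun 'I_(8 * 2 ^ j) -> pos e}}|.
      by rewrite card_prod muln_gt0 G0.
    have E5 : (1 + 4%:R = 5 :> R)%R by rewrite addrC natr1.
    rewrite E5 -(pr_fst R _ G0) in H1; rewrite E5 -(pr_snd R _ G0) in H2.
    have HH := pr_predI GG0 H1 H2.
    apply: (le_trans (le_trans _ HH)); first by lra.
    apply: pr_mono => g /andP[/existsP[a aX] /existsP[a' /andP[a'b a'm]]].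
    apply/existsP; exists a; apply/existsP; exists a'; rewrite a'b andbT.
    exact: le_lt_trans a'm aX.
- by move=> i _; rewrite /pr (eq_card (B := pred0)) // card0 mul0r invr_ge0 ler0n.
- move=> S i o iT _ /andP[/eqP zi /existsP[a /existsP[a' /andP[lt abv]]]]; split=> // _.
  have [iW Z1 _ _] := HT i iT.
  set p := smp w (Zp i) _ in lt; set p' := smp w (Zp i).+1 _ in lt abv.
  have pP : p \in P1 lam zW o by apply/mapP; exists a; rewrite ?mem_enum // zi.
  have p'P : p' \in P2 lam zW o by apply/mapP; exists a'; rewrite ?mem_enum // zi.
  have [x0 x0P x0v] := above_P abv.
  apply/has132P; exists x0, p, p'; split.
  + by rewrite mem_cat x0P.
  + by rewrite !mem_cat pP !orbT.
  + by rewrite !mem_cat p'P !orbT.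
  rewrite x0v lt !andbT (P_lt x0P) /=; last first.
    by rewrite /p -(divn_exp2 _ wl) smp_div.
  by apply: (@div_lt _ _ w); rewrite /p /p' !smp_div.
- rewrite expn0 muln1 (leq_trans _ (leq_pmull _ _)) // -[X in _ <= X](size_iota (zW.+1 * 2 ^ lam)).
  rewrite -(count_predT (iota _ _)) -/(cell _ _) -/(cnt _ _ _).
  by apply: (card_le_cnt tk_inj) => i /HT[[]].
Qed.

(** * Extremal targets and the search of the left half *)

Lemma powdiff (a b : R) s : (0 <= b <= a ->
  s.+1%:R * (a - b) * b ^+ s <= a ^+ s.+1 - b ^+ s.+1)%R.
Proof.
move=> /andP[b0 ba]; elim: s => [|s IH]; first by rewrite !expr1 expr0 mulr1 mul1r.
have bs := exprn_ge0 s b0; have a0 := le_trans b0 ba.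
have := ler_wpM2l a0 IH.
have : (0 <= (a - b) * (s.+1%:R * (a - b) * b ^+ s))%R.
  by rewrite !mulr_ge0 ?subr_ge0 ?ler0n.
rewrite -(natr1 s.+1) !exprS; move: s.+1%:R%R (b ^+ s)%R (a ^+ s)%R => n u v; nra.
Qed.

(** The early-side requirement of the chain with samples replaced by densities; [balB] is the
    late-side one. In the left half the higher values are expected before the lower ones. *)
Definition balA m t i : Prop :=
  ti i %/ 2 ^ ex lam gam t = zW * 2 ^ (lam - ex lam gam t) \/
  exists z, [/\ near z (ti i %/ 2 ^ ex lam gam t), z %/ 2 ^ (lam - ex lam gam t) = zW &
    2 ^ ex lam gam t <= cA (ex lam gam t) z i * 2 ^ m].

Definition balB m t i : Prop :=
  (ti i %/ 2 ^ ex lam gam t).+1 = zW.+1 * 2 ^ (lam - ex lam gam t) \/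
  exists z, [/\ near z (ti i %/ 2 ^ ex lam gam t), z %/ 2 ^ (lam - ex lam gam t) = zW &
    2 ^ ex lam gam t <= cB (ex lam gam t) z i * 2 ^ m].

(** At scale [w] the two sibling cells supply the final inversion; at larger scales the balance
    conditions keep the focus near the copy. *)
Definition left_data w m i : Prop :=
  [/\ ~~ odd (ti i %/ 2 ^ w), tj i %/ 2 ^ w = (ti i %/ 2 ^ w).+1,
      2 ^ w <= cB w (ti i %/ 2 ^ w) i * 2 ^ m, 2 ^ w <= cA w (tj i %/ 2 ^ w) i * 2 ^ m &
      forall t, t <= r -> w < ex lam gam t -> balA m t i /\ balB m t i].

Definition beats (up : bool) k p : bool :=
  [&& ab (F p), p != k & if up then pl k p else pl p k].

Lemma precE p q : prec (p, F p) (q, F q) = (p != q) && pl p q.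
Proof.
rewrite /prec /pl /=; case: (ltgtP (F p) (F q)) => [E|E|E] /=.
- by rewrite andbT; apply/esym; apply: contraTneq E => ->; rewrite ltxx.
- by rewrite andbF.
- by rewrite ltn_neqAle.
Qed.

Lemma extremal_sel up (L : seq nat) k : ab (F k) -> k \in L -> ~~ has (beats up k) L ->
  forall q, (q \in extremal up (map F P) [seq (p, F p) | p <- L]) -> q = (k, F k).
Proof.
move=> abk kL nb q; rewrite mem_filter => /andP[/andP[abq nq] /mapP[p pL E]].
rewrite E in abq nq *; suff -> : p = k by [].
apply/eqP; apply: contraT => pk.
have Hk : ~~ (if up then pl k p else pl p k).
  by move/hasPn: nb => /(_ p pL); rewrite /beats /= -/ab in abq *; rewrite abq pk.
move/hasPn: nq => /(_ (k, F k)) /=; rewrite (map_f (fun p => (p, F p)) kL) => /(_ isT).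
rewrite -/ab abk /= !precE (eq_sym k) pk /=; move: Hk.
by have := pl_total k p; case: (up) => + /negPf H1 /negPf H2; rewrite H1 H2.
Qed.

Lemma sel_extremal up (L : seq nat) k : ab (F k) -> k \in L -> ~~ has (beats up k) L ->
  (k, F k) \in extremal up (map F P) [seq (p, F p) | p <- L].
Proof.
move=> abk kL nb; rewrite mem_filter (map_f (fun p => (p, F p)) kL) andbT -/ab abk /=.
apply/hasPn => _ /mapP[p pL ->] /=; rewrite !precE.
move/hasPn: nb => /(_ p pL); apply: contra => /andP[abp]; rewrite /beats abp /=.
by case: (up) => /andP[]; rewrite 1?eq_sym => -> ->.
Qed.

Section Ext.
Variables (up : bool) (tR m j : nat).
Hypothesis tRr : tR <= r.
Let th := mkth (Ext up) (ex lam gam tR) m j.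

Definition ext_serve (o : targetT e th) i : bool :=
  (zc lam zW o == tk i %/ 2 ^ ex lam gam tR) &&
  (tk i \in P1 lam zW o) && ~~ has (beats up (tk i)) (P1 lam zW o).

(** The random cell is the right one with probability [2 ^ h / 2 ^ lam]. Then [s = 2 ^ (j - 2)]
    samples contain [tk i] with probability of order [s / 2 ^ h], and with constant probability
    nothing that beats it, because at most [2 * 2 ^ (h - j)] positions are as good. *)
Lemma ext_serve_pr i : inW i -> tight up tR j i ->
  ((2 ^ j)%:R / (8 * (2 ^ lam)%:R) <= pr R (fun o => ext_serve o i))%R.
Proof.
move=> iW it; set h := ex lam gam tR; set H := tk i %/ 2 ^ h.
have hl : h <= lam := ex_le _ _ _; have he : h <= e := leq_trans hl le.
set s := 2 ^ (j - 2); have s0' : 0 < s by rewrite expn_gt0.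
pose Y1 (y : pos e) := ~~ beats up (tk i) (smp h H y).
pose Y2 (y : pos e) := ~~ (beats up (tk i) (smp h H y) || (smp h H y == tk i)).
have h0 : (0 < (2 ^ h)%:R :> R)%R by rewrite ltr0n expn_gt0.
pose cb := cnt h H (beats up (tk i)).
have cb1 : cb + 1 = cnt h H (fun p => beats up (tk i) p || (p == tk i)).
  have := count_predUI (beats up (tk i)) (pred1 (tk i)) (cell h H).
  rewrite (@eq_count _ (predI _ _) pred0) ?count_pred0 ?addn0; last first.
    by move=> p /=; rewrite /beats; case: (p == tk i); rewrite ?andbF.
  by rewrite (count_uniq_mem (tk i)) ?iota_uniq // mem_cell eqxx => <-.
have cbt : (cb + 1) * 2 ^ j <= 2 * 2 ^ h.
  apply: leq_trans it; rewrite leq_mul2r; apply/orP; right; rewrite cb1 /upc /dnc -/h -/H.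
  have [_ _ _ _ iab] := iW; case: (up); apply: cnt_mono => p _; rewrite /beats.
    by case/orP => [/and3P[]|/eqP ->] //; rewrite pl_refl.
  by case/orP => [/and3P[-> _ ->]|/eqP ->] //; rewrite iab pl_refl.
have p1 : (pr R Y1 = 1 - cb%:R / (2 ^ h)%:R)%R.
  by rewrite /Y1 pr_predC ?pos_gt0 // (pr_smp R H (beats up (tk i)) he).
have p2 : (pr R Y2 = 1 - (cb + 1)%:R / (2 ^ h)%:R)%R.
  rewrite /Y2 pr_predC ?pos_gt0 // cb1.
  by rewrite (pr_smp R H (fun p => beats up (tk i) p || (p == tk i)) he).
have p2x : (0 <= ((cb + 1)%:R : R) / (2 ^ h)%:R <= 1)%R.
  apply/andP; split; first exact: divr_ge0 (ler0n _ _) (ler0n _ _).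
  by rewrite ler_pdivrMr // mul1r ler_nat cb1; exact: cnt_le.
pose sel (f : {ffun 'I_s -> pos e}) :=
  [exists a, smp h H (f a) == tk i] && [forall a, Y1 (f a)].
have F0 : 0 < #|{: {ffun 'I_s -> pos e}}| by rewrite card_ffun expn_gt0 pos_gt0.
have selP : (s%:R / (2 * (2 ^ h)%:R) <= pr R sel)%R.
  have all1 := pr_ffun_all R ('I_s : finType) Y1; have all2 := pr_ffun_all R ('I_s : finType) Y2.
  have split12 : (pr R (fun f : {ffun 'I_s -> pos e} => [forall a, Y1 (f a)]) <=
      pr R sel + pr R (fun f : {ffun 'I_s -> pos e} => [forall a, Y2 (f a)]))%R.
    apply: le_trans (pr_predU _ _ _); apply: pr_mono => f fY1; rewrite /sel fY1 andbT.
    case: existsP => //= nex; apply/forallP => a; rewrite /Y2 negb_or.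
    rewrite -/(Y1 (f a)) (forallP fY1 a) /=; apply/negP => fa; apply: nex.
    by exists a.
  (* The difference of the two powers is the probability that no sample beats [tk i] and some sample
     equals it. *)
  have : (s%:R / (2 * (2 ^ h)%:R) <= pr R Y1 ^+ s - pr R Y2 ^+ s)%R.
    have ba : (0 <= pr R Y2 <= pr R Y1)%R.
      by rewrite pr_ge0 p1 p2 lerD2l lerN2 ler_pM2r ?invr_gt0 // ler_nat leq_addr.
    have sE : s = s.-1.+1 by rewrite prednK.
    rewrite sE; apply: le_trans (powdiff s.-1 ba).
    have -> : (pr R Y1 - pr R Y2 = (2 ^ h)%:R^-1)%R.
      by rewrite p1 p2 natrD mulrDl mul1r; lra.
    have bern : (2^-1 <= pr R Y2 ^+ s.-1)%R.
      rewrite p2; apply: le_trans (bernoulli_sub _ p2x).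
      have : (s.-1%:R * ((cb + 1)%:R / (2 ^ h)%:R) <= 2^-1 :> R)%R; last by lra.
      rewrite mulrA ler_pdivrMr // -natrM.
      (* For [j >= 2] this is the cap on [cb + 1]; for [j < 2] the exponent is truncated and
         [s = 1]. *)
      have : 2 * (s.-1 * (cb + 1)) <= 2 ^ h.
        case: (leqP 2 j) => j2; last first.
          by rewrite /s (eqP (_ : j - 2 == 0)) ?expn0 ?mul0n ?muln0 ?expn_gt0 // subn_eq0 ltnW.
        have := cbt; rewrite -{1}(subnK j2) expnD -/s => H4.
        have : s.-1 * (cb + 1) <= s * (cb + 1) by rewrite leq_mul2r leq_pred orbT.
        rewrite -(leq_pmul2l (isT : 0 < 2)) => H5; apply: leq_trans H5 _.
        rewrite -(leq_pmul2l (isT : 0 < 2)); apply: leq_trans H4.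
        by rewrite double_double.
      by rewrite -(ler_nat R) natrM; lra.
    rewrite -sE invfM [(2^-1 * _)%R]mulrC mulrA.
    by apply: ler_wpM2l bern; rewrite divr_ge0 ?ler0n.
  by move: split12; rewrite all1 all2 !card_ord; lra.
have sj : 2 ^ j <= 4 * s by rewrite /s -[4]/(2 ^ 2) -expnD leq_exp2l //; lia.
have G0 : 0 < #|{: {ffun 'I_s -> pos e}}| by [].
have := @pr_pair_ge R _ _ (fun (y : pos e) (g : {ffun 'I_s -> pos e} * {ffun 'I_s -> pos e}) =>
  ext_serve (y, g) i) (fun y : pos e => smp lam zW.+1 y %/ 2 ^ h == H)
  (s%:R / (2 * (2 ^ h)%:R))%R.
rewrite (pr_smp R zW.+1 (fun p => p %/ 2 ^ h == H)%N le) => PP.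
apply: le_trans (PP _) => [|y /eqP yH].
  have : 2 ^ h <= cnt lam zW.+1 (fun p => p %/ 2 ^ h == H).
    rewrite (cnt_split _ _ hl).
    have HI : H \in cell (lam - h) zW.+1.
      by have [_ _ _ iz _] := iW; rewrite mem_cell divn_exp2 // iz.
    rewrite (big_rem H HI) /= (leq_trans _ (leq_addr _ _)) //.
    rewrite (eq_cnt (Q := predT)) => [|p]; first by rewrite /cnt count_predT size_iota.
    by rewrite mem_cell => ->.
  move: (cnt _ _ _) => c; rewrite -(ler_nat R) => hc; move: sj; rewrite -(ler_nat R) natrM => sj.
  have L0 : (0 < (2 ^ lam)%:R :> R)%R by rewrite ltr0n expn_gt0.
  rewrite ler_pdivrMr ?mulr_gt0 //.
  move: (2 ^ lam)%:R%R (2 ^ h)%:R%R c%:R%R s%:R%R (2 ^ j)%:R%R L0 h0 hc sj (ler0n R s) => l hh cc ss jj L0 h0' hc sj ss0.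
  have -> : (cc / l * (ss / (2 * hh)) * (8 * l) = 4 * ss * (cc / hh))%R by field; rewrite !gt_eqF.
  have : (1 <= cc / hh)%R by rewrite ler_pdivlMr // mul1r.
  nra.
apply: le_trans selP _; rewrite -(pr_fst R sel G0); apply: pr_mono => g /andP[/existsP[a /eqP fa] /forallP fY].
have zcE : zc lam zW ((y, g) : targetT e th) = H by [].
rewrite /ext_serve zcE eqxx /=; apply/andP; split.
  by apply/mapP; exists a; rewrite ?mem_enum // zcE -fa.
by apply/hasPn => p /mapP[a' _ ->]; rewrite zcE; exact: fY.
Qed.

(** A sample has one extremal position, so a target serves at most one copy and the probabilities of
    distinct copies add up. *)
Lemma ext_linear (U : {set I}) : (forall i, i \in U -> inW i /\ tight up tR j i) ->
  (#|U|%:R * (2 ^ j)%:R / (8 * (2 ^ lam)%:R) <=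
   pr R (fun o : targetT e th => [exists i in U, ext_serve o i]))%R.
Proof.
move=> HU; have := pr_disjoint R (A := mem U) (P := fun o : targetT e th => [exists i in U, ext_serve o i])
  (Q := fun i o => ext_serve o i).
move=> PD; apply: le_trans (PD _ _) => [|i o iU so|i k o iU kU].
- rewrite -mulrA mulr_natl -sumr_const; apply: ler_sum => i /HU[iW it]; exact: ext_serve_pr.
- by apply/exists_inP; exists i.
move=> /andP[/andP[_ iP] /hasPn ni] /andP[/andP[_ kP] /hasPn nk].
apply: tk_inj; apply/eqP; apply: contraT => ne.
have [[_ _ _ _ iab] _] := HU i iU; have [[_ _ _ _ kab] _] := HU k kU.
have := ni _ kP; have := nk _ iP; rewrite /beats iab kab (eq_sym (tk k)) ne /=.
by have := pl_total (tk i) (tk k); case: (up) => /orP[->|->].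
Qed.

End Ext.

Definition sided w i := ~~ odd (ti i %/ 2 ^ w) && (tj i %/ 2 ^ w == (ti i %/ 2 ^ w).+1).

Lemma above_split w i h : sided w i -> w < h -> tj i %/ 2 ^ h = ti i %/ 2 ^ h.
Proof.
move=> /andP[ev /eqP sp] wh.
rewrite -(divn_exp2 (tj i) (ltnW wh)) -(divn_exp2 (ti i) (ltnW wh)) sp.
rewrite -(subnK (_ : 0 < h - w)) ?subn_gt0 // addn1 expnS !divnMA !divn2.
by rewrite -[_.+1./2]/(uphalf _) (uphalf_half (ti i %/ 2 ^ w)) (negPf ev).
Qed.

(** [tm] is the first level whose cells exceed [2 ^ w]. From there up the balance conditions steer
    the focus. At level [tm - 1] the cells fit into the two siblings separating i and j, where dense
    subcells show a lower and then a higher value. If [tm > r] this happens at step 0, which is the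
    case [im]. *)
Lemma left_win (T : {set I}) up tR w m j h0 : tR <= r -> w < lam -> h0 <= lam ->
  (w < ex lam gam r -> h0 <= ex lam gam r) ->
  (forall D, #|[set i in T | ti i %/ 2 ^ h0 == D]| * 2 ^ m <= 2 * 2 ^ h0) ->
  (forall i, i \in T -> [/\ inW i, tight up tR j i & left_data w m i]) ->
  T != set0 -> 2 ^ lam <= #|T| * Qu -> m <= j + 4 ->
  concl (mkth (Ext up) (ex lam gam tR) m j) m j.
Proof.
move=> tRr wl h0l h0r Hcap HT T0 bigT mj.
have K0 : 0 < K by lia.
have capT h z' : h0 <= h -> #|[set i in T | ti i %/ 2 ^ h == z']| * 2 ^ m <= 2 * 2 ^ h.
  by move=> hh; apply: cap_sum hh Hcap.
pose tm := find (fun t => w < ex lam gam t) (iota 0 r.+1).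
have ex0 : ex lam gam 0 = 0 by rewrite /ex muln0 minn0.
have tmr : tm <= r.+1 by rewrite /tm -[X in _ <= X](size_iota 0) find_size.
have tm_lt t : t < tm -> ex lam gam t <= w.
  move=> tt; have := before_find 0 tt; rewrite nth_iota ?add0n; last by lia.
  by move=> /negbT; rewrite -leqNgt.
have tm_ge t : tm <= t <= r -> w < ex lam gam t.
  move=> /andP[tt tr]; have hs : has (fun t => w < ex lam gam t) (iota 0 r.+1).
    by rewrite has_find size_iota -/tm; lia.
  have := nth_find 0 hs; rewrite -/tm nth_iota ?add0n; last by lia.
  by move=> /leq_trans; apply; apply: ex_mono.
have tm0 : 0 < tm.
  by case E: tm => //; have := tm_ge 0; rewrite E ex0; lia.
have tmb : 0 < tm <= r.+1 by rewrite tm0.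
have wtm : w < ex lam gam tm.
  have [tr|tr] := leqP tm r; first by apply: tm_ge; rewrite leqnn.
  have -> : tm = r.+1 by lia.
  by rewrite /ex (minn_idPl top).
have wt' : ex lam gam tm.-1 <= w by apply: tm_lt; lia.
pose t' := tm.-1.
pose n3 t i := let c := ti i %/ 2 ^ ex lam gam t in [:: c.-1; c; c.+1].
pose lev3 t i (X : pred nat) (S : gridT e r (mkth (Ext up) (ex lam gam tR) m j)) :=
  has (fun z => [&& near z (ti i %/ 2 ^ ex lam gam t), z %/ 2 ^ (lam - ex lam gam t) == zW &
    has X (sl lam gam S t z)]) (n3 t i).
pose fin c (X : pred nat) (S : gridT e r (mkth (Ext up) (ex lam gam tR) m j)) :=
  has (fun z => has X (sl lam gam S t' z)) (cell (w - ex lam gam t') c).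
pose A i p := (F (tk i) < F p)%O.
pose B i p := (F p < F (tk i))%O.
(* [E] asks for higher values and [E'] for lower ones. Among the levels with cells of exponent at
   most [w], only [t'] carries a condition. *)
pose E t i S := if w < ex lam gam t then
    (ti i %/ 2 ^ ex lam gam t == zW * 2 ^ (lam - ex lam gam t)) || lev3 t i (A i) S
  else (t == t') ==> fin (tj i %/ 2 ^ w) (A i) S.
pose E' t i S := if w < ex lam gam t then
    ((ti i %/ 2 ^ ex lam gam t).+1 == zW.+1 * 2 ^ (lam - ex lam gam t)) || lev3 t i (B i) S
  else (t == t') ==> fin (ti i %/ 2 ^ w) (B i) S.
have cle t c : c %/ 2 ^ (lam - ex lam gam t) = zW -> c < 2 ^ e.
  move=> cz; have cl : c < zW.+1 * 2 ^ (lam - ex lam gam t) by rewrite -ltn_divLR ?expn_gt0 ?cz.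
  apply: (leq_trans cl); rewrite -(subnK le) expnD leq_mul //; first by apply: ltnW; exact: zWe.
  by rewrite leq_exp2l // leq_subr.
have miss X t c : t <= r -> c %/ 2 ^ (lam - ex lam gam t) = zW ->
    2 ^ ex lam gam t <= cnt (ex lam gam t) c X * 2 ^ m ->
    (pr R (fun S : gridT e r (mkth (Ext up) (ex lam gam tR) m j) => ~~ has X (sl lam gam S t c)) <= (20 * K)%:R^-1)%R.
  move=> tr cz; apply: (@grid_miss R e lam gam r s0 (mkth (Ext up) (ex lam gam tR) m j) x K m K0 erefl le) => //.
  exact: cle cz.
have inv0 : (0 <= (20 * K)%:R^-1 :> R)%R by rewrite invr_ge0 ler0n.
have pr0 (X : pred (gridT e r (mkth (Ext up) (ex lam gam tR) m j))) : (forall S, X S) ->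
    (pr R (fun S => ~~ X S) <= (20 * K)%:R^-1)%R.
  move=> HX; rewrite (eq_pr R (Q := pred0)) => [|S]; first by rewrite /pr card0 mul0r.
  by rewrite /= HX.
have miss3 X t i z : t <= r -> near z (ti i %/ 2 ^ ex lam gam t) ->
    z %/ 2 ^ (lam - ex lam gam t) = zW -> 2 ^ ex lam gam t <= cnt (ex lam gam t) z X * 2 ^ m ->
    (pr R (fun S => ~~ lev3 t i X S) <= (20 * K)%:R^-1)%R.
  move=> tr nz zd zc'; apply: le_trans (miss X t z tr zd zc'); apply: pr_mono => S.
  apply: contra => hX; apply/hasP; exists z; last by rewrite nz zd eqxx.
  exact: near_mem nz.
have missf X c : c %/ 2 ^ (lam - w) = zW -> 2 ^ w <= cnt w c X * 2 ^ m ->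
    (pr R (fun S => ~~ fin c X S) <= (20 * K)%:R^-1)%R.
  move=> cz /(dense_subcell wt')[z' [z'c z'd]].
  have z'z : z' %/ 2 ^ (lam - ex lam gam t') = zW.
    have -> : lam - ex lam gam t' = (w - ex lam gam t') + (lam - w) by exact: subn_split wt' (ltnW wl).
    by rewrite expnD divnMA z'c.
  apply: le_trans (miss X t' z' _ z'z z'd); last by rewrite /t' -ltnS prednK.
  apply: pr_mono => S; apply: contra => hX; apply/hasP; exists z' => //.
  by rewrite mem_cell z'c.
have splitz i : i \in T -> tj i %/ 2 ^ w = (ti i %/ 2 ^ w).+1 /\ forall h, w < h ->
    tj i %/ 2 ^ h = ti i %/ 2 ^ h.
  move=> /HT[_ _ [odd_i tjw _ _ _]]; split=> // h.
  by apply: above_split; rewrite /sided odd_i tjw eqxx.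
have wD i : i \in T -> ti i %/ 2 ^ w %/ 2 ^ (lam - w) = zW /\ tj i %/ 2 ^ w %/ 2 ^ (lam - w) = zW.
  move=> iT; have [[_ _ iz _ _] _ _] := HT i iT.
  by rewrite !divn_exp2 ?(ltnW wl) // (splitz i iT).2.
apply: (mk_win (T := T) (serve := @ext_serve up tR m j)
  (ok := fun i S => all (fun t => E t i S && E' t i S) (iota 0 r.+1))
  (im := r < tm) (u := fun i => ti i %/ 2 ^ ex lam gam r)) => //.
- by move=> U /subsetP UT; apply: ext_linear => // i /UT/HT[].
- move=> i iT; have [iW _ [_ _ Bc Ac lv]] := HT i iT; have [wD1 wD2] := wD i iT.
  apply: (@grid_all R e lam gam r s0 (mkth (Ext up) (ex lam gam tR) m j) x K m K0 erefl le) => [|t|t];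
    rewrite ?size_iota // mem_iota => /andP[_ tr]; rewrite /E /E'.
    case wt: (w < ex lam gam t).
      have [[zf|[z [nz zd zc']]] _] := lv t tr wt.
        by apply: pr0 => S; rewrite zf eqxx.
      by apply: le_trans (miss3 _ _ _ _ tr nz zd zc'); apply: pr_mono => S; rewrite negb_or => /andP[].
    case: (t == t'); last by apply: pr0.
    by apply: missf => //.
  case wt: (w < ex lam gam t).
    have [_ [zf|[z [nz zd zc']]]] := lv t tr wt.
      by apply: pr0 => S; rewrite zf eqxx.
    by apply: le_trans (miss3 _ _ _ _ tr nz zd zc'); apply: pr_mono => S; rewrite negb_or => /andP[].
  case: eqP => [tt|_]; last by apply: pr0.
  by apply: missf => //.
- move=> S i o iT /allP okS so.
  have [iW _ [_ _ Bc Ac lv]] := HT i iT; have [_ _ iz kz iab] := iW.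
  have /andP[/andP[_ kP] nb] := so.
  have kin := sel_extremal iab kP nb; have kun := extremal_sel iab kP nb.
  have bfE p : bf lam zW P o F p = A i p.
    rewrite /bf /st /=; apply/hasP/idP => [[q /kun -> //]|Ap]; by exists (tk i, F (tk i)).
  have afE p : af lam zW P o F p = B i p.
    rewrite /af /st /=; apply/hasP/idP => [[q /kun -> //]|Bp]; by exists (tk i, F (tk i)).
  have HH := @chain_wins lam gam r zW (sl lam gam S) (bf lam zW P o F) (af lam zW P o F)
    (fd lam zW P o F) (ti i) tm top (@sl_div _ S) iz tmb.
  have Hw q : (forall p, p \in q -> p %/ 2 ^ lam = zW) ->
      wins (bf lam zW P o F) (af lam zW P o F) (fd lam zW P o F) q ->
      has132 F (P ++ (P1 lam zW o ++ P2 lam zW o) ++ q).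
    move=> qD /orP[/hasP[p _]|/hasP[p pq /andP[Bp /hasP[p' p'q /andP[pp' Ap']]]]]; first by [].
    apply/has132P; exists p, p', (tk i); rewrite bfE in Ap'; rewrite afE in Bp.
    split; rewrite ?mem_cat ?pq ?p'q ?kP ?orbT //.
    rewrite pp' [(F p < _)%O]Bp [(_ < F p')%O]Ap' !andbT /=.
    by apply: (@div_lt _ _ lam); rewrite (qD _ p'q) kz.
  have levW t c : forall p, p \in qlev lam gam zW (sl lam gam S) t c -> p %/ 2 ^ lam = zW.
    by move=> p; have := @lev_dom _ S t c p.
  have {HH} [] := HH.
  + move=> t tb; have wt := tm_ge t tb.
    have : t \in iota 0 r.+1 by rewrite mem_iota; case/andP: tb.
    move=> /okS/andP[]; rewrite /E wt => /orP[/eqP ->|/hasP[z _ /and3P[nz /eqP zd /hasP[p ps Ap]]]] _; first by left.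
    by right; exists z; split=> //; apply/hasP; exists p => //=; rewrite bfE Ap.
  + move=> t tb; have wt := tm_ge t tb.
    have : t \in iota 0 r.+1 by rewrite mem_iota; case/andP: tb.
    move=> /okS/andP[_]; rewrite /E' wt => /orP[/eqP ->|/hasP[z _ /and3P[nz /eqP zd /hasP[p ps Bp]]]]; first by left.
    by right; exists z; split=> //; apply/hasP; exists p => //=; rewrite afE Bp.
  + move=> q Hq.
    have : t' \in iota 0 r.+1 by rewrite mem_iota /t' prednK.
    move=> /okS/andP[]; rewrite /E /E' ltnNge wt' eqxx /=.
    move=> /hasP[z' z'c /hasP[p' p's Ap']] /hasP[z z0 /hasP[p ps Bp]].
    rewrite !mem_cell in z'c z0.
    have toJ y c : y %/ 2 ^ (w - ex lam gam t') = c ->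
        y %/ 2 ^ (ex lam gam tm - ex lam gam t') = c %/ 2 ^ (ex lam gam tm - w).
      move=> <-; rewrite -divnMA -expnD; congr (_ %/ 2 ^ _).
      exact: subn_split wt' (ltnW wtm).
    have pz : p %/ 2 ^ w = ti i %/ 2 ^ w.
      by rewrite -(divn_exp2 p wt') (sl_div ps) (eqP z0).
    have p'z : p' %/ 2 ^ w = tj i %/ 2 ^ w.
      by rewrite -(divn_exp2 p' wt') (sl_div p's) (eqP z'c).
    rewrite /wins; apply/orP; right; apply/hasP; exists p.
      apply: (Hq z); last exact: ps.
      by rewrite (toJ _ _ (eqP z0)) divn_exp2 // ltnW.
    rewrite afE [B i p]Bp /=; apply/hasP; exists p'.
      apply: (Hq z'); last exact: p's.
      by rewrite (toJ _ _ (eqP z'c)) divn_exp2 ?(ltnW wtm) // (splitz i iT).2.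
    rewrite bfE [A i p']Ap' andbT; apply: (@div_lt _ _ w).
    by rewrite pz p'z (splitz i iT).1.
  + move=> w0; have imS : imm lam gam F x S o.
      rewrite /imm -/zW; apply: Hw; first exact: levW.
      by move: w0; rewrite subn0.
    split=> // _; exists (ti i %/ 2 ^ ex lam gam r); split.
    * by rewrite divn_exp2 ?ex_le.
    * exact: near_refl.
    by rewrite /hitB imS.
  case=> tr fn fdom [k' /andP[k0 kr] wk]; split=> [|_]; first by rewrite ltnNge tr.
  exists (focusn lam gam r zW (sl lam gam S) (bf lam zW P o F) 1); split=> //.
  rewrite /hitB -/zW -/P /foc eqxx /=; apply/orP; right; apply/existsP.
  have kr' : k' < r.+1 by [].
  exists (Ordinal kr'); rewrite k0 /=.
  by apply: Hw wk; exact: levW.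
- rewrite -leqNgt => tr z'; apply: capT; apply: h0r; apply: tm_ge; rewrite tr /=; exact: leqnn.
have := capT lam zW h0l.
rewrite (_ : [set i in T | _] = T) //; apply/setP => i; rewrite inE.
by case iT: (i \in T) => //=; have [[_ _ -> _ _] _ _] := HT _ iT; rewrite eqxx.
Qed.

(** * Classification of the copies *)

Definition capped (sd : bool) m h i : bool :=
  if sd then cA h (tj i %/ 2 ^ h) i * 2 ^ m <= 2 * 2 ^ h
  else cB h (ti i %/ 2 ^ h) i * 2 ^ m <= 2 * 2 ^ h.

(** Take the least [b] for which all ranks are dense; a level and side that fail at [b - 1] are
    tight. For [b = 0] everything is tight, as a count is at most the cell size. *)
Lemma rank_data i : inW i -> exists b up tR,
  [/\ b <= lam, tR <= r, rdense b i & tight up tR b i].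
Proof.
move=> [_ _ _ _ iab].
pose cs (up : bool) t := if up then upc t i else dnc t i.
have cs0 up t : 0 < cs up t.
  rewrite /cs /upc /dnc; case: (up); apply: (@cnt_gt0 _ _ _ (tk i)) => //.
    exact: pl_refl.
  by rewrite iab pl_refl.
have csle up t : cs up t <= 2 ^ ex lam gam t by rewrite /cs; case: (up); exact: cnt_le.
pose ok b := [forall t : 'I_r.+1, [forall up, 2 ^ ex lam gam t <= cs up t * 2 ^ b]].
have okP b : reflect (forall up t, t <= r -> 2 ^ ex lam gam t <= cs up t * 2 ^ b) (ok b).
  apply: (iffP forallP) => [H up t tr|H t]; last by apply/forallP => up; apply: H; rewrite -ltnS.
  by have /forallP/(_ up) := H (Ordinal (tr : t < r.+1)).
have oklam : ok lam.
  apply/okP => up t _; apply: leq_trans (leq_pmull _ (cs0 up t)).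
  by rewrite leq_exp2l // ex_le.
case: (ex_minnP (ex_intro ok lam oklam)) => b /okP okb bmin.
have blam := bmin _ oklam.
have rd : rdense b i by move=> t tr; split; [exact: (okb true)|exact: (okb false)].
case: b okb bmin blam rd => [|b] okb bmin blam rd.
  exists 0, true, 0; split=> //; rewrite /tight expn0 muln1.
  by apply: leq_trans (csle true 0) _; rewrite leq_pmull.
have /forallPn[t /forallPn[up]] : ~~ ok b by apply/negP => /bmin; rewrite ltnn.
rewrite -ltnNge => Hlt; exists b.+1, up, t; split=> //; first by rewrite -ltnS.
rewrite /tight -/(cs up t) expnS mulnCA leq_mul2l; exact: ltnW.
Qed.

Definition first t := zW * 2 ^ (lam - ex lam gam t).
Definition nears (i : I) h := let c := ti i %/ 2 ^ h in [:: c.-1; c; c.+1].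

Definition balAb m t i : bool := let h := ex lam gam t in
  (ti i %/ 2 ^ h == zW * 2 ^ (lam - h)) ||
  has (fun z => (z %/ 2 ^ (lam - h) == zW) && (2 ^ h <= cA h z i * 2 ^ m)) (nears i h).

Definition balBb m t i : bool := let h := ex lam gam t in
  ((ti i %/ 2 ^ h).+1 == zW.+1 * 2 ^ (lam - h)) ||
  has (fun z => (z %/ 2 ^ (lam - h) == zW) && (2 ^ h <= cB h z i * 2 ^ m)) (nears i h).

Lemma nears_near i h z : z \in nears i h -> near z (ti i %/ 2 ^ h).
Proof. by rewrite /near !inE; move: (ti i %/ _) => c; lia. Qed.

Lemma balAbP m t i : balAb m t i -> balA m t i.
Proof.
move=> /orP[/eqP zf|/hasP[z /nears_near zn /andP[/eqP zd zc]]]; [by left|right].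
by exists z.
Qed.

Lemma balBbP m t i : balBb m t i -> balB m t i.
Proof.
move=> /orP[/eqP zf|/hasP[z /nears_near zn /andP[/eqP zd zc]]]; [by left|right].
by exists z.
Qed.

Definition left_ok w m i : bool :=
  [&& 2 ^ w <= cB w (ti i %/ 2 ^ w) i * 2 ^ m, 2 ^ w <= cA w (tj i %/ 2 ^ w) i * 2 ^ m &
   [forall t : 'I_r.+1, (w < ex lam gam t) ==> balAb m t i && balBb m t i]].

Lemma left_okP w m i : sided w i -> left_ok w m i -> left_data w m i.
Proof.
move=> /andP[ev /eqP sp] /and3P[Bc Ac /forallP lv]; split=> // t tr wt.
have /implyP/(_ wt)/andP[/balAbP Ha /balBbP Hb] := lv (Ordinal (tr : t < r.+1)).
by split.
Qed.


Lemma in_left i h : inW i -> h <= lam -> ti i %/ 2 ^ h %/ 2 ^ (lam - h) = zW.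
Proof. by move=> [_ _ iz _ _] hl; rewrite divn_exp2. Qed.

Lemma balAbN m t i z : ~~ balAb m t i -> near z (ti i %/ 2 ^ ex lam gam t) ->
  z %/ 2 ^ (lam - ex lam gam t) = zW -> cA (ex lam gam t) z i * 2 ^ m < 2 ^ ex lam gam t.
Proof.
rewrite negb_or => /andP[_ /hasPn H] /near_mem zn zd; rewrite ltnNge.
by have := H z zn; rewrite zd eqxx.
Qed.

Lemma balBbN m t i z : ~~ balBb m t i -> near z (ti i %/ 2 ^ ex lam gam t) ->
  z %/ 2 ^ (lam - ex lam gam t) = zW -> cB (ex lam gam t) z i * 2 ^ m < 2 ^ ex lam gam t.
Proof.
rewrite negb_or => /andP[_ /hasPn H] /near_mem zn zd; rewrite ltnNge.
by have := H z zn; rewrite zd eqxx.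
Qed.

Lemma left_okN w m i : ~~ left_ok w m i -> [\/ cB w (ti i %/ 2 ^ w) i * 2 ^ m < 2 ^ w,
  cA w (tj i %/ 2 ^ w) i * 2 ^ m < 2 ^ w |
  exists t, [/\ t <= r, w < ex lam gam t & ~~ balAb m t i \/ ~~ balBb m t i]].
Proof.
rewrite /left_ok negb_and -ltnNge => /orP[|]; first by constructor 1.
rewrite negb_and -ltnNge => /orP[|/forallPn[t]]; first by constructor 2.
rewrite negb_imply negb_and => /andP[wt ft]; constructor 3; exists t; split=> //.
  by rewrite -ltnS.
by apply/orP.
Qed.

(** A violated density requirement is an upper bound on a count in the cell of [ti] or [tj], that
    is, a cap. Above scale [w] both positions share their cell. *)
Lemma left_fail w m i : inW i -> sided w i -> w <= lam -> ~~ left_ok w m i ->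
  exists h sd, [/\ w <= h <= lam, w < ex lam gam r -> h <= ex lam gam r & capped sd m.+1 h i].
Proof.
move=> iW sp wl; have cap c h : c * 2 ^ m < 2 ^ h -> c * 2 ^ m.+1 <= 2 * 2 ^ h.
  by move=> /ltnW H; rewrite expnS mulnCA leq_mul2l H.
case/left_okN => [H|H|[t [tr wt H]]].
- by exists w, false; split; rewrite ?leqnn ?wl //; [exact: ltnW|exact: cap].
- by exists w, true; split; rewrite ?leqnn ?wl //; [exact: ltnW|exact: cap].
have hl := ex_le lam gam t; have hr := ex_mono lam gam tr; have iz := in_left iW hl.
case: H => H.
  exists (ex lam gam t), true; split; rewrite ?hl ?(ltnW wt) //; apply: cap.
  by rewrite (above_split sp wt); apply: balAbN H (near_refl _) iz.
exists (ex lam gam t), false; split; rewrite ?hl ?(ltnW wt) //; apply: cap.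
exact: balBbN H (near_refl _) iz.
Qed.

(* The smallest [m] at which the left conditions hold is capped by the
   condition that fails at [m - 1]. *)
Lemma left_min w M i : inW i -> sided w i -> w <= lam -> left_ok w M i ->
  exists m h sd, [/\ m <= M, left_data w m i,
    w <= h <= lam, w < ex lam gam r -> h <= ex lam gam r & capped sd m h i].
Proof.
move=> iW sp wl ok.
case: (ex_minnP (ex_intro (fun m => left_ok w m i) M ok)) => m okm mmin.
case: m okm mmin => [|m] okm mmin.
  exists 0, w, false; split; rewrite ?leqnn ?wl //.
  - exact: left_okP.
  - exact: ltnW.
  by rewrite /capped muln1 (leq_trans (cnt_le _ _ _)) // leq_pmull.
have [|h [sd [hw hr cp]]] := @left_fail w m i iW sp wl.
  by apply/negP => /mmin; rewrite ltnn.
by exists m.+1, h, sd; split=> //; [exact: mmin|exact: left_okP].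
Qed.

(** The scarcer side determines [j], and it has to be the side holding a point of the copy, since
    that count caps the copies. Its scarcity below [2 ^ - b] gives [b <= j]. *)
Lemma pair_bucket z b i (Zp : I -> nat) : Zp i %/ 2 ^ (lam - z) = zW ->
  (Zp i).+1 %/ 2 ^ (lam - z) = zW ->
  let a := cA z (Zp i).+1 i in let c := cB z (Zp i) i in
  0 < minn a c -> minn a c * 2 ^ b < 2 ^ z ->
  (a <= c -> tj i %/ 2 ^ z = (Zp i).+1) -> (c <= a -> ti i %/ 2 ^ z = Zp i) ->
  exists j, [/\ j <= z, b <= j & pair_data z j Zp i].
Proof.
move=> Z1 Z2 a c m0 mb Ha Hc.
have [|j [jz H1 H2]] := @bucket (minn a c) z.
  by rewrite m0 /= (leq_trans (geq_minl _ _)) // cnt_le.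
exists j; split=> //.
  have : 2 ^ b < 2 ^ j by rewrite -(ltn_pmul2l m0); apply: leq_trans H1.
  by rewrite ltn_exp2l // => /ltnW.
have H1a : 2 ^ z <= a * 2 ^ j by apply: leq_trans H1 _; rewrite leq_mul2r geq_minl orbT.
have H1c : 2 ^ z <= c * 2 ^ j by apply: leq_trans H1 _; rewrite leq_mul2r geq_minr orbT.
split=> //; rewrite -/a -/c; case: (leqP a c) H2 => ac H2.
  by rewrite H2 (Ha ac) eqxx.
by rewrite H2 (Hc (ltnW ac)) eqxx orbT.
Qed.

Lemma value_count z c i : cB z c i + cnt z c (fun p => F p == F (tk i)) + cA z c i = 2 ^ z.
Proof.
rewrite /cB /cA -(cnt_predC z c (fun p => (F (tk i) < F p)%O)) addnC; congr (_ + _).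
rewrite /cnt -count_predUI (@eq_count _ (predI _ _) pred0) ?count_pred0 ?addn0; last first.
  by move=> p /=; case: ltgtP.
by apply: eq_count => p /=; case: ltgtP.
Qed.

Lemma mul_pow16 a b z : a * 2 ^ (b + 4) < 2 ^ z -> 16 * a < 2 ^ z.
Proof.
have : 0 < 2 ^ b by rewrite expn_gt0.
by rewrite expnD -[2 ^ 4]/16; move: (2 ^ b) (2 ^ z) => u v; nia.
Qed.

(** A side that is scarce at scale [w] makes the sibling cells of [ti] and [tj] a [Pair]. If higher
    values are scarce in the common cell [C] and in [C - 1], either [C - 1] has enough lower values
    and [(C - 1, C)] is a [Pair], or nearly all of [C - 1] equals f(l), a [Tie]. Scarce lower values
    are handled symmetrically with [C + 1]. *)
Lemma left_or_value w b i : inW i -> sided w i -> w < lam -> ~~ left_ok w (b + 4) i ->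
  exists z (sd : bool), z <= lam /\
    ((exists j, [/\ j <= lam, b + 4 <= j & pair_data z j (fun i => ti i %/ 2 ^ z - sd) i]) \/
     tie_data z sd (fun i => ti i %/ 2 ^ z - sd) i /\ capped sd (b + 4) z i).
Proof.
move=> iW sp wl; have wl' := ltnW wl; have [ijk vv iz kz iab] := iW.
have /andP[ij jk] := ijk; have /andP[vi vj] := vv.
have cA0 h c : tj i %/ 2 ^ h = c -> 0 < cA h c i by move=> hc; apply: cnt_gt0 hc vj.
have cB0 h c : ti i %/ 2 ^ h = c -> 0 < cB h c i by move=> hc; apply: cnt_gt0 hc vi.
have wsp : tj i %/ 2 ^ w = (ti i %/ 2 ^ w).+1 by case/andP: sp => _ /eqP.
have pairw : minn (cA w (ti i %/ 2 ^ w).+1 i) (cB w (ti i %/ 2 ^ w) i) * 2 ^ (b + 4) < 2 ^ w ->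
  exists z (sd : bool), z <= lam /\
    ((exists j, [/\ j <= lam, b + 4 <= j & pair_data z j (fun i => ti i %/ 2 ^ z - sd) i]) \/
     tie_data z sd (fun i => ti i %/ 2 ^ z - sd) i /\ capped sd (b + 4) z i).
  move=> H; exists w, false; split=> //; left.
  have [||||||j [jw bj pd]] := @pair_bucket w (b + 4) i (fun i => ti i %/ 2 ^ w - false); rewrite ?subn0 //.
  - by rewrite divn_exp2.
  - by rewrite -wsp divn_exp2 // (above_split sp wl).
  - by rewrite leq_min cA0 // cB0.
  by exists j; split=> //; exact: leq_trans wl'.
case/left_okN => [H|H|[t [tr wt H]]].
- by apply: pairw; apply: leq_ltn_trans H; rewrite leq_mul2r geq_minr orbT.
- by apply: pairw; apply: leq_ltn_trans H; rewrite wsp leq_mul2r geq_minl orbT.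
set z := ex lam gam t in wt H *; set C := ti i %/ 2 ^ z.
have zl : z <= lam := ex_le lam gam t; have CW : C %/ 2 ^ (lam - z) = zW := in_left iW zl.
have jC : tj i %/ 2 ^ z = C := above_split sp wt.
have nC : near C C := near_refl _.
exists z; case: H => H.
  have C0 : C != zW * 2 ^ (lam - z) by move: H; rewrite /balAb negb_or => /andP[].
  have D0 : 0 < 2 ^ (lam - z) by rewrite expn_gt0.
  have Cge : zW * 2 ^ (lam - z) < C by rewrite ltn_neqAle eq_sym C0 /= -leq_divRL // CW leqnn.
  have Cp : C = C.-1.+1 by rewrite prednK // (leq_ltn_trans _ Cge).
  have C1W : C.-1 %/ 2 ^ (lam - z) = zW.
    apply/eqP; rewrite eqn_leq -{1}CW leq_div2r ?leq_pred //=.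
    by rewrite leq_divRL // -ltnS -Cp.
  have nC1 : near C.-1 C by rewrite /near -Cp leqnn leqW // leq_pred.
  have A1 := balAbN H nC1 C1W; have A0 := balAbN H nC CW; rewrite -/z in A1 A0.
  exists true; split=> //.
  (* The slack [2 ^ 4] makes scarce mean below 1/16. Lower values at density 1/8 in [C - 1] thus
     outnumber the higher ones in [C], so the capped side is that of [tj]. *)
  have [B8|B8] := leqP (2 ^ z) (8 * cB z C.-1 i); [left|right].
    have AB : cA z C i < cB z C.-1 i by exact: lt_of_16_8 (mul_pow16 A0) B8.
    have [||||||j [jz bj pd]] := @pair_bucket z (b + 4) i (fun i => ti i %/ 2 ^ z - true); rewrite -/C ?subn1 -?Cp //.
    - by rewrite leq_min cA0 // (leq_trans _ AB).
    - by rewrite (minn_idPl (ltnW AB)).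
    - by move=> BA; move: AB; rewrite ltnNge BA.
    by exists j; split=> //; exact: leq_trans zl.
  split; last first.
    by rewrite /capped jC (leq_trans (ltnW A0)) // leq_pmull.
  split; rewrite /= -/C ?subn1 -?Cp //.
  by apply: mostly_equal B8 (mul_pow16 A1) (value_count _ _ _).
have C0 : C.+1 != zW.+1 * 2 ^ (lam - z) by move: H; rewrite /balBb negb_or => /andP[].
have D0 : 0 < 2 ^ (lam - z) by rewrite expn_gt0.
have Cge : C.+1 < zW.+1 * 2 ^ (lam - z) by rewrite ltn_neqAle C0 /= -ltn_divLR // CW leqnn.
have C1W : C.+1 %/ 2 ^ (lam - z) = zW.
  apply/eqP; rewrite eqn_leq -{2}CW leq_div2r // andbT.
  by rewrite -ltnS ltn_divLR.
have nC1 : near C.+1 C by rewrite /near leqnn /= leqW.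
have B1 := balBbN H nC1 C1W; have B0 := balBbN H nC CW; rewrite -/z in B1 B0.
exists false; split=> //.
have [A8|A8] := leqP (2 ^ z) (8 * cA z C.+1 i); [left|right].
  have AB : cB z C i < cA z C.+1 i by exact: lt_of_16_8 (mul_pow16 B0) A8.
  have [||||||j [jz bj pd]] := @pair_bucket z (b + 4) i (fun i => ti i %/ 2 ^ z - false); rewrite -/C ?subn0 //.
  - by rewrite leq_min cB0 // (leq_trans _ AB).
  - by rewrite (minn_idPr (ltnW AB)).
  - by move=> BA; move: AB; rewrite ltnNge BA.
  by exists j; split=> //; exact: leq_trans zl.
split; last first.
  by rewrite /capped (leq_trans (ltnW B0)) // leq_pmull.
split; rewrite /= -/C ?subn0 //.
by apply: mostly_equal A8 (mul_pow16 B1) _; rewrite addnC [cA _ _ _ + _]addnC addnA value_count.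
Qed.

Hypothesis lamK : lam + 4 < K.

(** The code [c] stands for [Inv], [Ext], [Pair], [Tie] in this order. All data are numbers below
    [K], so that many copies share one label. *)
Definition labelled (c : nat) (up sd : bool) (t b z m h : nat) i : Prop :=
  if c is 0 then
    [/\ z <= lam, tj i %/ 2 ^ lam = zW.+1 & tk i %/ 2 ^ z = (tj i %/ 2 ^ z).+1]
  else [/\ t <= r, rdense b i, tight up t b i &
    match c with
    | 1 => [/\ z < lam, z <= h <= lam, z < ex lam gam r -> h <= ex lam gam r &
            [/\ m <= b + 4, left_data z m i & capped sd m h i]]
    | 2 => [/\ z <= lam, b + 4 <= m & pair_data z m (fun i => ti i %/ 2 ^ z - sd) i]
    | _ => [/\ z <= lam, tie_data z sd (fun i => ti i %/ 2 ^ z - sd) i & capped sd (b + 4) z i]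
    end].

Lemma label_exists i : inW i -> exists (c : nat) (up sd : bool) (t b z m h : nat),
  [/\ labelled c up sd t b z m h i, c < 4, t < K & [/\ b < K, z < K, m < K & h < K]].
Proof.
move=> iW; have [/andP[ij jk] _ iz kz _] := iW.
have lK : lam < K := leq_ltn_trans (leq_addr 4 lam) lamK.
have K0 : 0 < K := leq_ltn_trans (leq0n _) lK.
have [jr|jr] := eqVneq (tj i %/ 2 ^ lam) zW.+1.
  have [w [wl sp _]] := dyadic_split jk (etrans jr (esym kz)).
  exists 0, true, true, 0, 0, w, 0, 0; split=> //.
    by split=> //; exact: ltnW.
  by split=> //; exact: ltn_trans wl lK.
have jz : ti i %/ 2 ^ lam = tj i %/ 2 ^ lam.
  have H1 : zW <= tj i %/ 2 ^ lam by rewrite -iz leq_div2r // ltnW.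
  have H2 : tj i %/ 2 ^ lam <= zW.+1 by rewrite -kz leq_div2r // ltnW.
  by rewrite iz; apply/eqP; rewrite eqn_leq H1 -ltnS ltn_neqAle jr H2.
have [w [wl sp ev]] := dyadic_split ij jz.
have siw : sided w i by rewrite /sided ev sp eqxx.
have [b [up [t [bl tr rd tg]]]] := rank_data iW.
have tK := leq_ltn_trans tr rK; have bK := leq_ltn_trans bl lK.
have [ok|nok] := boolP (left_ok w (b + 4) i).
  have [m [h [sd [mb ld /andP[wh hl] hr cp]]]] := left_min iW siw (ltnW wl) ok.
  exists 1, up, sd, t, b, w, m, h; split=> //.
    by split=> //; split=> //; rewrite wh.
  split=> //; [exact: ltn_trans wl lK| |exact: leq_ltn_trans hl lK].
  by apply: leq_ltn_trans mb (leq_ltn_trans _ lamK); rewrite leq_add2r.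
have [z [sd [zl [[j [jl bj pd]]|[td cp]]]]] := left_or_value iW siw wl nok.
  exists 2, up, sd, t, b, z, j, 0; split=> //.
  by split=> //; exact: leq_ltn_trans lK.
exists 3, up, sd, t, b, z, 0, 0; split=> //.
by split=> //; exact: leq_ltn_trans lK.
Qed.

Lemma pigeon_label (L : finType) (T : {set I}) (D : L -> I -> Prop) :
  T != set0 -> (forall i, i \in T -> exists l, D l i) ->
  exists l (T' : {set I}), [/\ T' \subset T, #|T| <= #|L| * #|T'| & forall i, i \in T' -> D l i].
Proof.
move=> T0 HP; have [i0 i0T] := set0Pn _ T0; have [l0 _] := HP _ i0T.
have [|f Hf] := @fin_all_exists I (fun=> L) (fun i l => i \in T -> D l i) _.
  by move=> i; have [/HP[l Dl]|nT] := boolP (i \in T); [exists l|exists l0].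
have T1 : 0 < #|T| by rewrite card_gt0.
have [|l Tl] := @pigeonhole I L T (fun l i => f i == l) T1.
  by move=> i _; exists (f i).
exists l, [set i in T | f i == l]; split=> //.
  by apply/subsetP => i; rewrite inE => /andP[].
by move=> i; rewrite inE => /andP[iT /eqP <-]; exact: Hf.
Qed.

Lemma fiber_capped (T : {set I}) m h sd w D : w <= h ->
  (forall i, i \in T -> [/\ inW i, sided w i & capped sd m h i]) ->
  #|[set i in T | ti i %/ 2 ^ h == D]| * 2 ^ m <= 2 * 2 ^ h.
Proof.
move=> wh HT; case: sd HT => HT.
  apply: (@count_A _ h (if w == h then D.+1 else D) m) => i; rewrite inE => /andP[/HT[iW sp cp] /eqP iD].
  have E : tj i %/ 2 ^ h = if w == h then D.+1 else D.
    case: eqP => [wE|/eqP ne]; last by rewrite (above_split sp) ?iD // ltn_neqAle ne.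
    by move: iD; rewrite -wE => <-; apply/eqP; case/andP: sp.
  by split=> //; rewrite -E.
apply: (@count_B _ h D m) => i; rewrite inE => /andP[/HT[iW sp cp] /eqP iD].
by split=> //; rewrite -iD.
Qed.

(** There are [16 * K ^ 5] labels, and equalising the fibers for [Inv] and [Tie] loses at most one
    more factor [K]. *)
Lemma classify (T : {set I}) : 16 * K ^ 6 <= Q -> T != set0 ->
  (forall i, i \in T -> inW i) -> 2 ^ lam <= #|T| * 2 ^ u1 ->
  exists k z m j, [/\ z <= lam, m < K, j < K & concl (mkth k z m j) m j].
Proof.
move=> KQ T0 HT bigT.
have lK : lam < K := leq_ltn_trans (leq_addr 4 lam) lamK.
pose L : finType := ('I_4 * bool * bool * ('I_K * 'I_K * 'I_K * 'I_K * 'I_K))%type.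
pose D (l : L) i := let: (c, up, sd, (t, b, z, m, h)) := l in labelled c up sd t b z m h i.
have [i iT|l [T1 [T1T cT1 DT1]]] := @pigeon_label L T D T0.
  have [c [up [sd [t [b [z [m [h [lb c4 tK [bK zK mK hK]]]]]]]]]] := label_exists (HT i iT).
  by exists (Ordinal c4, up, sd, (Ordinal tK, Ordinal bK, Ordinal zK, Ordinal mK, Ordinal hK)).
have T10 : T1 != set0.
  by apply: contraNneq T0 => E; rewrite E cards0 muln0 leqn0 cards_eq0 in cT1.
have {}HT i : i \in T1 -> inW i by move=> iT; apply: HT; exact: (subsetP T1T).
have cL : #|L| * K <= Q.
  rewrite !card_prod !card_ord !card_bool; apply: leq_trans KQ.
  by rewrite (_ : _ * K = 16 * K ^ 6) //; move: (K) => c; ring.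
have big1 : 2 ^ lam <= #|T1| * Qu.
  apply: leq_trans bigT _; apply: leq_trans (leq_mul cT1 (leqnn _)) _.
  rewrite mulnAC mulnC leq_mul2l leq_mul2r; apply/orP; right; apply/orP; right.
  by apply: leq_trans cL; rewrite leq_pmulr // (leq_ltn_trans _ lK).
have big2 (T' : {set I}) : #|T1| <= lam.+1 * #|T'| -> 2 ^ lam <= #|T'| * Qu.
  move=> cT'; apply: leq_trans bigT _; apply: leq_trans (leq_mul cT1 (leqnn _)) _.
  rewrite /Qu mulnA leq_mul2r; apply/orP; right.
  apply: leq_trans (leq_mul (leqnn #|L|) cT') _.
  rewrite mulnA mulnC leq_mul2l; apply/orP; right; apply: leq_trans cL.
  by rewrite leq_mul2l lK orbT.
have nz (T' : {set I}) : 2 ^ lam <= #|T'| * Qu -> T' != set0.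
  by apply: contraTneq => ->; rewrite cards0 mul0n -ltnNge expn_gt0.
case: l {cT1 cL} DT1 => [[[c up] sd] [[[[t b] z] m] h]] /= DT1.
case: c DT1 => -[|[|[|c]]] /= _ DT1.
- have [|j [T2 [jl T2T cT2 fib]]] := @pigeon_fiber I T1 (fun i => tj i %/ 2 ^ z) z T10.
    move=> c; apply: leq_trans (cnt_le z c predT); apply: (card_le_cnt tj_inj) => i.
    by rewrite inE => /andP[_ /eqP].
  have [i0 i0T] := set0Pn _ T10; have [zl _ _] := DT1 _ i0T.
  have b2 := big2 _ (leq_trans cT2 (leq_mul (zl : z.+1 <= lam.+1) (leqnn _))).
  exists Inv, z, 0, j; split=> //; [exact: leq_ltn_trans lK|exact: leq_ltn_trans (leq_trans jl zl) lK|].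
  apply: (inv_win (Zp := fun i => tj i %/ 2 ^ z) zl _ fib (nz _ b2) b2) => i iT.
  have iT1 := subsetP T2T _ iT; have [_ jr sp] := DT1 i iT1.
  by split=> //; [exact: HT|rewrite divn_exp2 ?zl].
- have [i0 i0T] := set0Pn _ T10; have [tr _ _ [zl /andP[zh hl] hr [mb _ _]]] := DT1 _ i0T.
  exists (Ext up), (ex lam gam t), m, b; split=> //; first exact: ex_le.
  have mb4 : m <= b + 4 := mb.
  apply: (left_win (T := T1) (w := z) (h0 := h) (up := up) tr zl hl hr) => // [E|i iT].
    apply: (@fiber_capped _ m h sd z _ zh) => i iT.
    have [_ _ _ [_ _ _ [_ [ev sp _ _ _] cp]]] := DT1 i iT.
    by split=> //; [exact: HT|rewrite /sided ev sp eqxx].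
  have [_ _ tg [_ _ _ [_ ld _]]] := DT1 i iT.
  by split=> //; exact: HT.
- have [i0 i0T] := set0Pn _ T10; have [tr _ _ [zl bm _]] := DT1 _ i0T.
  exists Pair, z, b, m; split=> //.
  apply: (pair_win (T := T1) (up := up) (Zp := fun i => ti i %/ 2 ^ z - sd) zl tr) => //.
    move=> i iT; have [_ rd tg [_ _ pd]] := DT1 i iT.
    by split; [exact: HT| | |exact: pd].
  exact: leq_trans (leq_addr 4 b) (leq_trans bm (leq_addr 4 m)).
have [i0 i0T] := set0Pn _ T10; have [tr _ _ [zl _ _]] := DT1 _ i0T.
pose Zp i := ti i %/ 2 ^ z - sd.
have fibE i k : i \in T1 -> k \in T1 -> Zp k = Zp i ->
    ti k %/ 2 ^ z = ti i %/ 2 ^ z /\ tj k %/ 2 ^ z = ti i %/ 2 ^ z.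
  have CE k' : k' \in T1 -> ti k' %/ 2 ^ z = Zp k' + sd /\ tj k' %/ 2 ^ z = Zp k' + sd.
    move=> k'T; have [_ _ _ [_ [_ _ _ E1 E2] _]] := DT1 k' k'T.
    have {}E1 : ti k' %/ 2 ^ z = if sd then (Zp k').+1 else Zp k' := E1.
    have {}E2 : tj k' %/ 2 ^ z = if sd then (Zp k').+1 else Zp k' := E2.
    by rewrite E1 E2; case: (sd); rewrite ?addn1 ?addn0.
  by move=> iT kT E; have [-> _] := CE i iT; have [-> ->] := CE k kT; rewrite E.
have fibcap i : i \in T1 -> #|[set k in T1 | Zp k == Zp i]| * 2 ^ (b + 4) <= 2 * 2 ^ z.
  move=> iT; case: (sd) DT1 => DT1.
    apply: (@count_A _ z (ti i %/ 2 ^ z) (b + 4)) => k; rewrite inE => /andP[kT /eqP kZ].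
    have [_ E] := fibE i k iT kT kZ; have [_ _ _ [_ _ cp]] := DT1 k kT.
    by split=> //; [exact: HT|rewrite -E].
  apply: (@count_B _ z (ti i %/ 2 ^ z) (b + 4)) => k; rewrite inE => /andP[kT /eqP kZ].
  have [E _] := fibE i k iT kT kZ; have [_ _ _ [_ _ cp]] := DT1 k kT.
  by split=> //; [exact: HT|rewrite -E].
have [|j [T2 [jl T2T cT2 fib]]] := @pigeon_fiber I T1 Zp z T10.
  move=> D'; have [->|/set0Pn[i]] := eqVneq [set i in T1 | Zp i == D'] set0; first by rewrite cards0.
  rewrite inE => /andP[iT /eqP <-]; apply: leq_trans (cnt_le z (ti i %/ 2 ^ z) predT).
  apply: (card_le_cnt ti_inj) => k; rewrite inE => /andP[kT /eqP kZ].
  by have [] := fibE i k iT kT kZ.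
have b2 := big2 _ (leq_trans cT2 (leq_mul (zl : z.+1 <= lam.+1) (leqnn _))).
exists (Tie sd), z, b, j; split=> //; first exact: leq_ltn_trans (leq_trans jl zl) lK.
apply: (tie_win (T := T2) (up := up) (Zp := Zp) zl tr _ fib (nz _ b2) b2) => [i iT|].
  have iT1 := subsetP T2T _ iT; have [_ rd tg [_ td _]] := DT1 i iT1.
  by split=> //; exact: HT.
have [i iT] := set0Pn _ (nz _ b2).
have /andP[f1 _] := fib i iT; have f2 := fibcap i (subsetP T2T _ iT).
set n1 := #|[set k in T2 | _]| in f1; set n2 := #|_| in f2.
have cc : n1 <= n2 by apply: subset_leq_card; apply/subsetP => k; rewrite !inE => /andP[/(subsetP T2T) -> ->].
have c0 : 0 < n1 by rewrite lt0n; apply: contraTneq f1 => ->; rewrite mul0n -ltnNge expn_gt0.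
(* A fiber of [T2] lies in a capped fiber of [T1] but has size at least [2 ^ (z - j)]; comparing
   gives [b + 4 <= j + 1]. *)
have : 2 ^ (b + 4) <= 2 ^ j.+1.
  rewrite -(leq_pmul2l c0); apply: leq_trans (leq_mul cc (leqnn _)) _; apply: leq_trans f2 _.
  by rewrite expnS mulnCA leq_mul2l f1.
rewrite leq_exp2l // => bj; apply: leq_trans (leq_trans (leq_addr 4 b) bj) _.
by rewrite -addn1 leq_add2l.
Qed.

End Instances.

(** * One dyadic split *)

Section Budget.
Variables (lam gam r K Q : nat).
Hypotheses (Q0 : 0 < Q) (top : lam <= gam * r.+1).

(** In units of [2 ^ u1 * 2 ^ gam]: the samples for targets, then the samples in searched cells. *)
Definition budget : nat :=
  2 ^ 15 * Q ^ 2 + 100 * K * (2 * Q + (1 + 128 * r) * (512 * Q ^ 2)).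

Lemma rate_cost_m u y m c : m <= y -> 2 ^ m <= c * 2 ^ u -> 0 < c ->
  2 ^ (u - y) * 2 ^ m <= c * 2 ^ u.
Proof.
move=> my mc c0; have [uy|yu] := leqP u y.
  by rewrite (eqP (_ : u - y == 0)) ?mul1n // subn_eq0.
apply: leq_trans (leq_pmull _ c0); rewrite -expnD leq_exp2l //.
by rewrite -[leqRHS](subnK (ltnW yu)) leq_add2l.
Qed.

Lemma gap_le : lam - ex lam gam r <= gam.
Proof. by rewrite /ex; move: top; rewrite mulnS; lia. Qed.

(** Up to constants and powers of [Q], trials times batch size times samples per target have
    exponent [(u1 - y) + (g + m - j) + j <= u1 + g], because [m <= y]. When the batch exponent is
    truncated to 0, the bound [j - g <= y] takes over. *)
Lemma mkth_cost k z m j u1 : m <= j + 4 ->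
  2 ^ j <= 8 * (Q * 2 ^ u1) -> 2 ^ m <= 2 * (Q * 2 ^ u1) ->
  body_cost gam r (mkth lam gam r K Q u1 k z m j) <= budget * (2 ^ u1 * 2 ^ gam).
Proof.
move=> mj jb mb; rewrite /body_cost /mkth /=.
set g := lam - ex lam gam r; set y := maxn m (j - g).
have gE : g <= gam := gap_le.
have G : 2 ^ g <= 2 ^ gam by rewrite leq_exp2l.
have ntE : (if k is Ext _ then 2 ^ (j - 2) else 8 * 2 ^ j) <= 8 * 2 ^ j.
  have H : 2 ^ (j - 2) <= 8 * 2 ^ j.
    by apply: leq_trans (leq_pmull _ _); rewrite // leq_exp2l // leq_subr.
  by case: (k).
move: (if k is Ext _ then _ else _) ntE => t tE.
have Hm : 2 ^ (u1 - y) * 2 ^ m <= 2 * Q * 2 ^ u1.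
  by apply: rate_cost_m; rewrite ?leq_maxl ?muln_gt0 // -mulnA.
have Hj : 2 ^ (u1 - y) * 2 ^ (g + m - j) * 2 ^ j <= 8 * Q * (2 ^ u1 * 2 ^ gam).
  have [jg|gj] := leqP j (g + m).
    rewrite -mulnA -expnD subnK // addnC expnD mulnA.
    apply: leq_trans (leq_mul Hm G) _.
    by rewrite -[leqLHS]mulnA leq_mul // leq_mul.
  rewrite (eqP (_ : g + m - j == 0)) ?subn_eq0 ?(ltnW gj) // muln1.
  have : 2 ^ (u1 - y) * 2 ^ (j - g) <= 8 * Q * 2 ^ u1.
    apply: rate_cost_m; rewrite ?leq_maxr ?muln_gt0 // -mulnA.
    by apply: leq_trans jb; rewrite leq_exp2l // leq_subr.
  have jE : j = (j - g) + g by rewrite subnK // (leq_trans (leq_addr m g)) // ltnW.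
  by move=> H; rewrite [in X in _ * 2 ^ X <= _]jE expnD !mulnA; exact: leq_mul H G.
move: (2 ^ (u1 - y)) (2 ^ (g + m - j)) (2 ^ m) (2 ^ j) (2 ^ u1) (2 ^ gam) Hm Hj mb tE => a b c f h i Hm Hj mb tE.
rewrite /budget [leqRHS]mulnDl; apply: leq_add.
  apply: (@leq_trans (256 * Q * a * b * (2 * (8 * f)))); first by rewrite leq_mul2l leq_mul2l tE !orbT.
  apply: (@leq_trans (4096 * Q * (a * b * f))); first by lia.
  apply: (@leq_trans (4096 * Q * (8 * Q * (h * i)))); first by rewrite leq_mul2l Hj orbT.
  by lia.
apply: (@leq_trans (100 * K * i * (c + (1 + 128 * r) * (256 * Q * (a * c))))); first by lia.
apply: (@leq_trans (100 * K * i * (2 * (Q * h) + (1 + 128 * r) * (256 * Q * (2 * Q * h))))); last by lia.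
by rewrite leq_mul2l leq_add ?orbT // leq_mul2l leq_mul2l Hm !orbT.
Qed.

End Budget.

Definition kind_of (a : nat) : kind :=
  match a with 0 => Inv | 1 => Ext true | 2 => Ext false | 3 => Pair | 4 => Tie true | _ => Tie false end.

Lemma kind_ofP k : exists a : 'I_6, kind_of a = k.
Proof.
case: k => [|[]||[]];
  by [exists (inord 0); rewrite inordK|exists (inord 1); rewrite inordK|exists (inord 2); rewrite inordK
     |exists (inord 3); rewrite inordK|exists (inord 4); rewrite inordK|exists (inord 5); rewrite inordK].
Qed.

Lemma prod_gt0 (A B : finType) : 0 < #|{: A}| -> 0 < #|{: B}| -> 0 < #|{: A * B}|.
Proof. by move=> A0 B0; rewrite card_prod muln_gt0 A0. Qed.

Lemma ffun_gt0 (A B : finType) : 0 < #|{: B}| -> 0 < #|{: {ffun A -> B}}|.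
Proof. by move=> B0; rewrite card_ffun expn_gt0 B0. Qed.

Lemma even_cell_lt e h p : h < e -> p < 2 ^ e -> (2 * (p %/ 2 ^ h.+1)).+1 < 2 ^ (e - h).
Proof.
move=> he pe; rewrite -(prednK (_ : 0 < e - h)) ?subn_gt0 // [2 ^ _.-1.+1]expnS -subnS.
have : p %/ 2 ^ h.+1 < 2 ^ (e - h.+1) by rewrite ltn_divLR ?expn_gt0 // -expnD subnK.
by move: (p %/ _) (2 ^ (e - _)) => u v; lia.
Qed.

(** * All kinds and scales tried in parallel on a random window *)

Section Split.
Context {d : Order.disp_t} {V : orderType d}.
Variables (R : realFieldType) (e gam r K Q : nat).
Variable F : nat -> V.
Hypotheses (r0 : 0 < r) (rK : r < K) (eK : e + 4 < K) (top : e <= (gam * r.+1).+1) (KQ : 16 * K ^ 6 <= Q).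

Local Notation strategy := (@strat d V).

Definition guess : finType := ('I_6 * 'I_K * 'I_K * 'I_K)%type.

Definition guess_params lam u (l : guess) : params :=
  let: (a, z, m, j) := l in mkth lam gam r K Q u.+1 (kind_of a) z m j.

(** Filtering by cost makes the total cost bound independent of the input; the right guess survives
    by [mkth_cost]. *)
Definition guesses lam u : seq guess :=
  [seq l <- enum {: guess} |
    body_cost gam r (guess_params lam u l) <= budget r K Q * (2 ^ u.+1 * 2 ^ gam)].

Definition guess_body lam u (l : guess) : strategy (shareT e (2 ^ u.+1)) :=
  body e lam gam r (2 ^ u.+1) (guess_params lam u l).

Definition bodies lam u : strategy (shareT e (2 ^ u.+1)) :=
  par [seq guess_body lam u l | l <- guesses lam u].

Definition split_trial lam u : strategy unit := share (@P0 e lam (2 ^ u.+1)) (bodies lam u).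

Definition split_cost := 1 + 6 * K ^ 3 * budget r K Q.

Lemma split_trial_adaptive lam u : adaptive (fun=> [::]) (split_trial lam u).
Proof. by apply: share_adaptive; apply: par_adaptive => l; exact: body_adaptive. Qed.

Lemma split_trial_cost lam u :
  cost_le (split_trial lam u) r (split_cost * (2 ^ u.+1 * 2 ^ gam)).
Proof.
have H : cost_le (bodies lam u) r (6 * K ^ 3 * budget r K Q * (2 ^ u.+1 * 2 ^ gam)).
  move=> x w F'; apply: leq_trans (par_cost (c := fun l => body_cost gam r (guess_params lam u l)) _ x w F') _.
    by move=> l _; exact: body_cost_le.
  apply: leq_trans (sumn_map_le (c := budget r K Q * (2 ^ u.+1 * 2 ^ gam)) _) _.
    by move=> l; rewrite mem_filter => /andP[].
  rewrite -mulnA leq_mul2r; apply/orP; right.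
  apply: (@leq_trans #|{: guess}|); first by rewrite cardE size_filter count_size.
  by rewrite !card_prod !card_ord !expnS expn0 muln1 !mulnA.
move=> x w F'; apply: leq_trans (share_cost (c' := 2 ^ u.+1) _ H x w F') _.
  by move=> y; rewrite size_map size_enum_ord.
by rewrite /split_cost mulnDl mul1n leq_add2r leq_pmulr // expn_gt0.
Qed.

Lemma pos_nonempty s : 0 < #|{: shareT e s}|.
Proof. by rewrite card_prod muln_gt0 pos_gt0 card_ffun expn_gt0 pos_gt0. Qed.

Lemma body_coined lam s0 th : coined (body e lam gam r s0 th : strategy (shareT e s0)).
Proof.
have tg : 0 < #|{: targetT e th}| 
  by exact: prod_gt0 (pos_gt0 e) (prod_gt0 (ffun_gt0 _ (pos_gt0 e)) (ffun_gt0 _ (pos_gt0 e))).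
exact: prod_gt0 (ffun_gt0 _ (pos_gt0 e)) (ffun_gt0 _ (prod_gt0 (pos_gt0 e) (ffun_gt0 _ tg))).
Qed.

Lemma split_trial_coined lam u : coined (split_trial lam u).
Proof.
rewrite /coined /= card_prod muln_gt0 pos_nonempty /=.
by apply: (@par_coined _ _ _ _ (guesses lam u) (guess_body lam u)) => l; exact: body_coined.
Qed.

Variables (I : finType) (ti tj tk : I -> nat).
Hypotheses (ti_inj : injective ti) (tj_inj : injective tj) (tk_inj : injective tk).
Hypothesis copy : forall i, ti i < tj i < tk i /\ (F (ti i) < F (tk i) < F (tj i))%O.

Lemma bodies_win lam u (T : {set I}) (x : shareT e (2 ^ u.+1)) : lam < e ->
  (forall i, i \in T -> ti i %/ 2 ^ lam = zw lam x /\ tk i %/ 2 ^ lam = (zw lam x).+1) ->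
  2 ^ lam <= #|T| * 2 ^ u ->
  #|T| <= 2 * #|[set i in T | above (map F (P0 lam x)) (F (tk i))]| ->
  (2^-1 <= winpr R r (bodies lam u) x F (P0 lam x))%R.
Proof.
move=> le HT bigT half; set T1 := [set i in T | _] in half.
have big1 : 2 ^ lam <= #|T1| * 2 ^ u.+1.
  apply: leq_trans bigT _.
  by rewrite expnS mulnA leq_mul2r [_ * 2]mulnC half orbT.
have T10 : T1 != set0.
  by apply: contraTneq big1 => ->; rewrite cards0 mul0n -ltnNge expn_gt0.
have topl : lam <= gam * r.+1 by rewrite -ltnS (leq_trans le).
have lamK : lam + 4 < K by apply: leq_ltn_trans eK; rewrite leq_add2r ltnW.
have zWe : (zw lam x).+1 < 2 ^ (e - lam).
  have x1 : x.1 < 2 ^ e by rewrite -[X in _ < X]prednK ?expn_gt0.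
  exact: even_cell_lt le x1.
have [|k [z [m [j [zl mK jK [W jb mb mj]]]]]] := @classify _ _ R e lam gam r (2 ^ u.+1) K Q u.+1 F x r0 rK (ltnW le) topl zWe I ti tj tk
  ti_inj tj_inj tk_inj lamK T1 KQ T10 _ big1.
  move=> i; rewrite inE => /andP[/HT[H1 H2] ab]; have [H3 H4] := copy i; by split.
have [a ak] := kind_ofP k.
have zK : z < K by apply: leq_ltn_trans zl (leq_ltn_trans (leq_addr 4 lam) lamK).
pose l : guess := (a, Ordinal zK, Ordinal mK, Ordinal jK).
have lE : guess_params lam u l = mkth lam gam r K Q u.+1 k z m j by rewrite /l /= ak.
apply: le_trans W _; rewrite -lE.
apply: (@par_win _ _ R r _ _ (guesses lam u) (guess_body lam u) l).
  by move=> l'; exact: body_coined.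
rewrite mem_filter mem_enum andbT lE; apply: mkth_cost => //.
apply: leq_trans KQ; rewrite muln_gt0 expn_gt0; apply/orP; left.
by apply: leq_ltn_trans rK.
Qed.

(** Split at the median of f(i). A sample of value at most the median is expected at least once, and
    it is below f(l) for all copies whose f(i) is at least the median. *)
Lemma median_above lam s (T : {set I}) W (c := #|T|) : lam <= e -> T != set0 ->
  (forall i, i \in T -> ti i %/ 2 ^ lam = W) -> 2 * 2 ^ lam <= s * c ->
  (2^-1 <= pr R (fun g : {ffun 'I_s -> pos e} => 
     #|T| <= 2 * #|[set i in T | above (map F [seq smp lam W (g a) | a <- enum 'I_s]) (F (tk i))]|)%N)%R.
Proof.
move=> le T0 HT sc; have [m0 [M1 M2]] := median (fun i => F (ti i)) T0.
have c1 : #|[set i in T | (F (ti i) <= m0)%O]| <= cnt lam W (fun p => (F p <= m0)%O).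
  by apply: (card_le_cnt ti_inj) => i; rewrite inE => /andP[/HT].
have N1 : 1 * 2 ^ lam <= s * #|[set i in T | (F (ti i) <= m0)%O]|.
  rewrite mul1n -(leq_pmul2l (isT : 0 < 2)) (leq_trans sc) // mulnCA leq_mul2l; apply/orP; right.
  exact: M1.
have H := hit_ge R le c1 N1.
have E2 : (1 + 1%:R = 2 :> R)%R by [].
rewrite E2 in H; apply: le_trans (le_trans _ H) _; first by lra.
apply: pr_mono => g /existsP[a am]; apply: (leq_trans M2).
rewrite leq_mul2l /=; apply: subset_leq_card; apply/subsetP => i.
rewrite !inE => /andP[-> im] /=; apply/hasP; exists (F (smp lam W (g a))).
  by apply: map_f; apply/mapP; exists a; rewrite ?mem_enum.
by have [_ /andP[+ _]] := copy i; apply: le_lt_trans; exact: le_trans im.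
Qed.

(** A window has [2 ^ (lam + 1)] positions and at most [2 * 2 ^ (lam - u)] copies, so a random
    position falls into an occupied one with probability at least [#|T| * 2 ^ u / 2 ^ e]. The factor
    1/4 is 1/2 for the samples of the left half and 1/2 for the body. *)
Lemma split_trial_win lam u (T : {set I}) : lam < e ->
  (forall i, i \in T -> [/\ ti i < 2 ^ e, ~~ odd (ti i %/ 2 ^ lam) & tk i %/ 2 ^ lam = (ti i %/ 2 ^ lam).+1]) ->
  (forall i, i \in T -> 2 ^ lam <= #|[set k in T | ti k %/ 2 ^ lam == ti i %/ 2 ^ lam]| * 2 ^ u <= 2 * 2 ^ lam) ->
  ((#|T| * 2 ^ u)%:R / (4 * (2 ^ e)%:R) <= winpr R r (split_trial lam u) tt F [::])%R.
Proof.
move=> le HT fib.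
pose TW (x : shareT e (2 ^ u.+1)) := [set k in T | ti k %/ 2 ^ lam == zw lam x].
pose hit (y : pos e) := [exists i in T, ti i %/ 2 ^ lam.+1 == y %/ 2 ^ lam.+1].
pose A (x : shareT e (2 ^ u.+1)) := hit x.1 &&
  (#|TW x| <= 2 * #|[set i in TW x | above (map F (P0 lam x)) (F (tk i))]|).
have even i : i \in T -> ti i %/ 2 ^ lam = 2 * (ti i %/ 2 ^ lam.+1).
  move=> /HT[_ ev _]; rewrite expnSr divnMA divn2 mul2n -[LHS](odd_double_half) (negPf ev) //.
have hitz (x : shareT e (2 ^ u.+1)) i : i \in T -> ti i %/ 2 ^ lam.+1 = x.1 %/ 2 ^ lam.+1 -> ti i %/ 2 ^ lam = zw lam x.
  by move=> iT E; rewrite even // E.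
have TWfib x : hit x.1 -> 2 ^ lam <= #|TW x| * 2 ^ u.
  move=> /exists_inP[i iT /eqP ix]; have /andP[f1 _] := fib i iT.
  by rewrite /TW -(hitz x i iT ix).
have Awin x : A x -> (2^-1 <= winpr R r (bodies lam u) x F (P0 lam x))%R.
  move=> /andP[hx half]; apply: bodies_win le _ (TWfib x hx) half => i.
  by rewrite inE => /andP[/HT[_ _ ->] /eqP ->].
have SW := @share_win _ _ R r _ _ _ F A _ r0 Awin.
apply: le_trans SW.
have hitP : ((#|T| * 2 ^ u)%:R / (2 ^ e)%:R <= pr R hit)%R.
  pose near_T p := [exists i in T, ti i %/ 2 ^ lam.+1 == p %/ 2 ^ lam.+1].
  have -> : pr R hit = pr R (fun y : pos e => near_T (smp e 0 y)).
    apply: eq_pr => y; rewrite /hit /near_T /smp mul0n add0n modn_small //.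
    by rewrite -[X in _ < X]prednK ?expn_gt0.
  rewrite (pr_smp R 0 near_T (leqnn e)) ler_pM2r ?invr_gt0 ?ltr0n ?expn_gt0 // ler_nat.
  rewrite -[cnt _ _ _]mul1n; apply: (fiber_cover le) => [i iT|c].
    by have [ie _ _] := HT i iT; rewrite divn_exp2 // divn_small.
  have [->|/set0Pn[i]] := eqVneq [set i in T | ti i %/ 2 ^ lam.+1 == c] set0; first by rewrite cards0.
  rewrite inE mul1n => /andP[iT /eqP <-]; have /andP[_ f2] := fib i iT.
  rewrite [leqRHS]expnS; apply: leq_trans f2; rewrite leq_mul2r; apply/orP; right.
  apply: subset_leq_card; apply/subsetP => k; rewrite !inE => /andP[kT /eqP kE].
  by rewrite kT !even // kE /=.
have HP := @pr_pair_ge R _ _ (fun (y : pos e) (g : {ffun 'I_(2 ^ u.+1) -> pos e}) => A (y, g)) hit 2^-1.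
rewrite (_ : _ / _ = (#|T| * 2 ^ u)%:R / (2 ^ e)%:R * 2^-1 * 2^-1)%R; last first.
  by field; rewrite pnatr_eq0 -lt0n expn_gt0.
rewrite ler_pM2r ?invr_gt0 //; apply: (le_trans (le_trans _ (HP _))).
- by rewrite ler_pM2r ?invr_gt0.
- move=> y hy; have := TWfib (y, [ffun=> ord0]) hy.
  set W := 2 * (y %/ 2 ^ lam.+1).
  have TWE g : TW (y, g) = [set k in T | ti k %/ 2 ^ lam == W] by [].
  rewrite TWE => bigW; set T0 := [set k in T | _] in bigW.
  have T00 : T0 != set0.
    by apply: contraTneq bigW => ->; rewrite cards0 mul0n -ltnNge expn_gt0.
  apply: le_trans (@median_above lam (2 ^ u.+1) T0 W (ltnW le) T00 _ _) _.
  + by move=> i; rewrite inE => /andP[_ /eqP].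
  + by rewrite expnS -mulnA leq_mul2l mulnC bigW.
  by apply: pr_mono => g /=; rewrite /A /= hy.
by apply: pr_mono => -[].
Qed.

End Split.

(** * Repetition over all separation scales and densities *)

Section Finder.
Context {d : Order.disp_t} {V : orderType d}.
Variables (e gam r K Q M : nat).

(** Both the cost of a trial and its success probability grow like [2 ^ u], so [M / 2 ^ u]
    repetitions balance all densities. *)
Definition reps u : nat := if 2 ^ u <= M then (M %/ 2 ^ u).+1 else 0.

Definition rep_trial (l : 'I_e * 'I_e) : @strat d V unit :=
  rep (reps l.2) (split_trial e gam r K Q l.1 l.2).

Definition finder : @strat d V unit := par [seq rep_trial l | l <- enum {: 'I_e * 'I_e}].

Lemma finder_adaptive : adaptive (fun=> [::]) finder.
Proof.
apply: par_adaptive => l; apply: rep_adaptive; exact: split_trial_adaptive.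
Qed.

Lemma finder_coined : coined finder.
Proof. by apply: par_coined => l; apply: rep_coined; exact: split_trial_coined. Qed.

Lemma finder_cost : cost_le finder r (4 * e ^ 2 * split_cost r K Q * M * 2 ^ gam).
Proof.
pose c := 4 * M * split_cost r K Q * 2 ^ gam.
move=> x w F; apply: leq_trans (par_cost (c := fun=> c) _ x w F) _.
  move=> l _ x' w' F'; apply: leq_trans (rep_cost (@split_trial_cost _ V _ _ _ _ _ _ _) _ _ _) _.
  rewrite /reps; case: ifP => [uM|_]; last by rewrite mul0n.
  have H : (M %/ 2 ^ l.2).+1 * 2 ^ l.2 <= 2 * M by rewrite mulSn mul2n -addnn leq_add // leq_trunc_div.
  rewrite /c expnS; move: (M %/ 2 ^ l.2).+1 H => a; move: (2 ^ l.2) (2 ^ gam) (split_cost r K Q) => b g s H.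
  apply: (@leq_trans (a * b * (2 * s * g))); first by lia.
  by apply: leq_trans (leq_mul H (leqnn _)) _; lia.
apply: leq_trans (sumn_map_le (c := c) _) _; first by [].
rewrite -cardE card_prod !card_ord /c.
by move: (2 ^ gam) (split_cost _ _ _) => g s; rewrite -mulnn; lia.
Qed.

(** [e ^ 2] pays for choosing the scale [lam] and then the density [u]. With [8 / 4 = 2] expected
    successes, all repetitions fail with probability at most [(1 + 2)^-1]. *)
Lemma finder_win (R : realFieldType) (F : nat -> V) (I : finType) (ti tj tk : I -> nat) :
  0 < r -> r < K -> e + 4 < K -> e <= (gam * r.+1).+1 -> 16 * K ^ 6 <= Q ->
  injective ti -> injective tj -> injective tk ->
  (forall i, ti i < tj i < tk i /\ (F (ti i) < F (tk i) < F (tj i))%O) ->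
  (forall i, tk i < 2 ^ e) -> 8 * e ^ 2 * 2 ^ e <= #|I| * M ->  0 < #|I| ->
  (2 / 3 <= winpr R r finder tt F [::])%R.
Proof.
move=> r0 rK eK top KQ ti_inj tj_inj tk_inj copy tke bigI I0.
have tie i : ti i < 2 ^ e by have [/andP[ij jk] _] := copy i; rewrite (ltn_trans (ltn_trans ij jk)).
have [||lam] := @pigeonhole I 'I_e [set: I] (fun lam i => ~~ odd (ti i %/ 2 ^ lam) && (tk i %/ 2 ^ lam == (ti i %/ 2 ^ lam).+1)).
- by rewrite cardsT.
- move=> i _; have [/andP[ij jk] _] := copy i.
  have [|w [we sp ev]] := @dyadic_split e (ti i) (tk i) (ltn_trans ij jk).
    by rewrite !divn_small.
  by exists (Ordinal we); rewrite /= ev sp eqxx.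
rewrite cardsT card_ord; set T := [set i in _ | _] => cT.
have T0 : T != set0 by apply: contraTneq cT => ->; rewrite cards0 muln0 -ltnNge.
have [|u [T1 [ul T1T cT1 fib]]] := @pigeon_fiber I T (fun i => ti i %/ 2 ^ lam) lam T0.
  move=> c; apply: leq_trans (cnt_le lam c predT); apply: (card_le_cnt ti_inj) => i.
  by rewrite inE => /andP[_ /eqP].
have T1P i : i \in T1 -> [/\ ti i < 2 ^ e, ~~ odd (ti i %/ 2 ^ lam) & tk i %/ 2 ^ lam = (ti i %/ 2 ^ lam).+1].
  by move=> /(subsetP T1T); rewrite !inE /= => /andP[ev /eqP ->].
have e0 : 0 < e := leq_ltn_trans (leq0n lam) (ltn_ord lam).
have big1 : 8 * 2 ^ e <= #|T1| * M.
  rewrite -(leq_pmul2l (_ : 0 < e ^ 2)) ?expn_gt0 ?e0 //.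
  have H : #|I| <= e ^ 2 * #|T1|.
    apply: leq_trans cT _; rewrite -mulnn -mulnA leq_mul2l; apply/orP; right.
    by apply: leq_trans cT1 _; rewrite leq_mul2r ltn_ord orbT.
  by rewrite mulnCA mulnA (leq_trans bigI) // mulnA leq_mul2r H orbT.
have W := @split_trial_win _ _ R e gam r K Q F r0 rK eK top KQ I ti tj tk ti_inj tj_inj tk_inj copy lam u T1 (ltn_ord lam) T1P fib.
set p := (_ / _)%R in W.
have p0 : (0 <= p)%R by rewrite divr_ge0 ?mulr_ge0 ?ler0n.
have E0 : (0 < (2 ^ e)%:R :> R)%R by rewrite ltr0n expn_gt0.
have uM : 2 ^ u <= M.
  have : (p <= 1)%R := le_trans W (pr_le1 _ _).
  rewrite ler_pdivrMr ?mulr_gt0 // mul1r -natrM ler_nat => H.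
  have T10 : 0 < #|T1| by rewrite lt0n; apply: contraTneq big1 => ->; rewrite mul0n -ltnNge muln_gt0 expn_gt0.
  rewrite -(leq_pmul2l T10); apply: leq_trans H (leq_trans _ big1).
  by rewrite leq_mul2r orbT.
have ue : u < e := leq_ltn_trans ul (ltn_ord lam).
have := @par_win _ V R r _ _ (enum {: 'I_e * 'I_e}) rep_trial (lam, Ordinal ue) tt F [::].
rewrite mem_enum => PW; apply: le_trans (PW _ isT); last first.
  by move=> l; apply: rep_coined; exact: split_trial_coined.
apply: le_trans (rep_win _ (split_trial_coined _ _ _ _ _ _ _) p0 W).
rewrite /= /reps uM.
have : (2 <= (M %/ 2 ^ u).+1%:R * p)%R.
  rewrite /p mulrA ler_pdivlMr ?mulr_gt0 // -!natrM ler_nat.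
  have := ltn_ceil M (_ : 0 < 2 ^ u); rewrite expn_gt0 => /(_ isT)/ltnW H.
  rewrite mulnA (leq_trans big1) // mulnCA leq_mul2l H orbT //.
move: (_ * p)%R => y y2.
have y1 : (0 < 1 + y)%R by lra.
rewrite lerBrDr -lerBrDl.
have -> : (1 - 2 / 3 = 3^-1 :> R)%R by field.
by rewrite lef_pV2 ?posrE //; lra.
Qed.

End Finder.

(** * Disjoint copies in a far sequence *)

Section Copies.
Variables (R : realType) (n : nat) (f : 'I_n -> R).

Definition is_copy (t : 'I_n * 'I_n * 'I_n) : bool :=
  let: (i, j, l) := t in [&& i < j, j < l, (f i < f l)%R & (f l < f j)%R].

Definition pts (t : 'I_n * 'I_n * 'I_n) : seq 'I_n := [:: t.1.1; t.1.2; t.2].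

Definition packing (S : {set 'I_n * 'I_n * 'I_n}) : bool :=
  [forall t in S, is_copy t] &&
  [forall t in S, [forall t' in S, has (mem (pts t)) (pts t') ==> (t == t')]].

Lemma packing_inj S (g : 'I_n * 'I_n * 'I_n -> 'I_n) : packing S ->
  (forall t, g t \in pts t) -> {in S &, injective g}.
Proof.
move=> /andP[_ /forall_inP dS] gP t t' tS t'S E; apply/eqP.
have /forall_inP/(_ t' t'S)/implyP := dS t tS; apply; apply/hasP.
by exists (g t); [rewrite E|]; exact: gP.
Qed.

Lemma retraction (D : {set 'I_n}) : D != set0 -> exists h : 'I_n -> 'I_n,
  [/\ forall i, h i \in D, forall i, i \in D -> h i = i & {homo h : i j / (i <= j)%N}].
Proof.
case/set0Pn => d dD.
case: (@arg_minnP _ d (mem D) (@nat_of_ord n) dD) => k0 k0D k0min.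
(* The least element [k0] of [D] takes care of the indices with no element of [D] at or below
   them. *)
pose P (i k : 'I_n) := (k \in D) && (k <= maxn i k0).
have P0 (i : 'I_n) : P i k0 by rewrite /P leq_maxr andbT.
pose h (i : 'I_n) := [arg max_(k > k0 | P i k) (nat_of_ord k)].
have hP i : P i (h i) /\ forall k, P i k -> k <= h i.
  by rewrite /h; case: (@arg_maxnP _ k0 (P i) (@nat_of_ord n) (P0 i)).
exists h; split=> [i|i iD|i j ij].
- by have [/andP[]] := hP i.
- have [/andP[hD hi] hmax] := hP i; apply: val_inj; apply/eqP.
  have k0i : k0 <= i := k0min i iD.
  rewrite eqn_leq; apply/andP; split; last by apply: hmax; rewrite /P iD leq_maxl.
  by move: hi; rewrite (maxn_idPl k0i).
have [_ hmax] := hP j; have [/andP[hD hi] _] := hP i; apply: hmax.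
by rewrite /P hD (leq_trans hi) // geq_max leq_maxr leq_max ij.
Qed.

(** Take a maximal packing and compose [f] with a monotone retraction onto the uncovered indices. A
    copy in the result would give a copy of [f] disjoint from the packing, so three changes per
    packed copy repair the sequence. *)
Lemma far_packing (eps : R) : far132 eps f ->
  exists S, packing S /\ (eps * n%:R < (3 * #|S|)%:R)%R.
Proof.
move=> far.
have p0 : packing set0.
  by apply/andP; split; apply/forall_inP => t; rewrite inE.
case: (@arg_maxnP _ (set0 : {set 'I_n * 'I_n * 'I_n}) packing (fun S => #|S|) p0) => S pS Smax.
exists S; split=> //.
pose U := [set i | [exists t in S, i \in pts t]].
have cU : #|U| <= 3 * #|S|.
  pose im (g : 'I_n * 'I_n * 'I_n -> 'I_n) := [set g t | t in S].
  have : U \subset im (fun t => t.1.1) :|: im (fun t => t.1.2) :|: im (fun t => t.2).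
    apply/subsetP => i; rewrite inE => /exists_inP[t tS]; rewrite !inE => /or3P[] /eqP ->.
    - by apply/orP; left; apply/orP; left; exact: (imset_f (fun t => t.1.1)).
    - by apply/orP; left; apply/orP; right; exact: (imset_f (fun t => t.1.2)).
    by apply/orP; right; exact: (imset_f (fun t => t.2)).
  move=> /subset_leq_card /leq_trans; apply.
  apply: leq_trans (leq_card_setU _ _) _; rewrite mulSn addnC leq_add ?leq_imset_card //.
  apply: leq_trans (leq_card_setU _ _) _; rewrite mul2n -addnn leq_add ?leq_imset_card //.
suff [g fg gU] : exists2 g, free132 g & forall i, i \notin U -> f i = g i.
  apply: lt_le_trans (far g fg) _; rewrite ler_nat; apply: leq_trans cU.
  apply: subset_leq_card; apply/subsetP => i; rewrite inE.
  by apply: contraR => /gU ->.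
have [U0|/retraction[h [hD hid hmono]]] := eqVneq (~: U) set0.
  exists (fun=> 0%R) => [[i [j [l [_ _]]]]|i iU]; first by rewrite ltxx.
  by have := in_set0 i; rewrite -U0 inE iU.
exists (f \o h) => [[i [j [l [ij jl]]]] /= fil flj|i iU]; last by rewrite /= hid // inE.
have hlt (a b : 'I_n) : (a < b)%N -> f (h a) != f (h b) -> (h a < h b)%N.
  move=> ab ne; rewrite ltn_neqAle hmono ?(ltnW ab) // andbT.
  by apply: contra ne => /eqP/val_inj ->.
have cp : is_copy (h i, h j, h l).
  rewrite /is_copy fil flj !andbT hlt ?hlt //; first by rewrite gt_eqF.
  by rewrite lt_eqF // (lt_trans fil).
have tU t : has (mem (pts (h i, h j, h l))) (pts t) -> t \notin S.
  move=> /hasP[p pt pq]; apply/negP => tS.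
  have : p \in U by rewrite inE; apply/exists_inP; exists t.
  apply/negP; move: pq; rewrite /= !inE => /or3P[]/eqP ->;
    [have := hD i|have := hD j|have := hD l]; by rewrite !inE.
have nS : (h i, h j, h l) \notin S by apply: tU; rewrite /= !inE eqxx.
have := Smax ((h i, h j, h l) |: S); rewrite /= cardsU1 nS add1n /= ltnn => H.
suff : false by []; apply: H; apply/andP; split.
  apply/forall_inP => t; rewrite !inE => /orP[/eqP -> //|tS].
  by have /andP[/forall_inP/(_ t tS)] := pS.
apply/forall_inP => t /setU1P tS; apply/forall_inP => t' /setU1P t'S; apply/implyP.
case: tS t'S => [->|tS] [->|t'S] // hp; first by have := tU _ hp; rewrite t'S.
  have := tU t; rewrite tS => /(_ _)/negP; case=> //; move: hp => /hasP[p p1 p2].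
  by apply/hasP; exists p.
have /andP[_ /forall_inP/(_ t tS)/forall_inP/(_ t' t'S)/implyP] := pS; exact.
Qed.

End Copies.

(** * Testers from strategies *)

Section Tester.
Variables (R : realType) (n' r : nat) (S : @strat _ R unit).
Hypotheses (S_adaptive : adaptive (fun=> [::]) S) (S_coined : coined S).
Let n := n'.+1.

(** Strategies work on [2 ^ e] positions, so the sequence is continued by its last value. A copy
    needs strictly different values, hence its positions stay distinct and ordered after
    clamping. *)
Definition clamp (p : nat) : 'I_n := inord (minn p n').

Lemma clamp_mono p q : p <= q -> clamp p <= clamp q.
Proof. by move=> pq; rewrite !inordK ?ltnS ?geq_minr // leq_min geq_minr geq_min pq. Qed.

(** The input as reconstructed from the answers so far; by adaptivity it yields the same next batch
    as the input itself. *)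
Definition lookup (h : history R n) (p : nat) : R :=
  head 0%R [seq q.2 | q <- flatten h & q.1 == clamp p].

Definition tester_batch (w : coinT S) (h : history R n) : seq 'I_n :=
  if size h < r then map clamp (qry S tt w (lookup h) (size h)) else [::].

Definition tester_verdict (w : coinT S) (h : history R n) : bool :=
  ~~ has (fun a : 'I_n * R => has (fun b : 'I_n * R => has (fun c : 'I_n * R =>
    [&& a.1 < b.1, b.1 < c.1, (a.2 < c.2)%R & (c.2 < b.2)%R])
    (flatten h)) (flatten h)) (flatten h).

Definition tester_pr (w : coinT S) : R := (#|{: coinT S}|%:R^-1)%R.

Lemma tester_pr_ge0 w : (0 <= tester_pr w)%R.
Proof. by rewrite invr_ge0 ler0n. Qed.

Lemma tester_pr_sum1 : (\sum_(w : coinT S) tester_pr w = 1)%R.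
Proof.
by rewrite /tester_pr sumr_const -[LHS]mulr_natl divff // pnatr_eq0 -lt0n.
Qed.

Definition tester : round_tester R n :=
  RoundTester tester_pr_ge0 tester_pr_sum1 tester_batch tester_verdict.

Section Run.
Variables (f : 'I_n -> R) (w : coinT S).
Let F p := f (clamp p).

Lemma size_run k : size (run (T := tester) w f k) = k.
Proof. by elim: k => //= k IH; rewrite size_rcons IH. Qed.

Lemma lookup_map (L : seq nat) (h : history R n) :
  flatten h = [seq (clamp p, F p) | p <- L] -> {in L, F =1 lookup h}.
Proof.
move=> hE p pL; rewrite /lookup hE filter_map -map_comp /=.
have : p \in [seq q <- L | clamp q == clamp p] by rewrite mem_filter eqxx.
case E: [seq q <- L | _] => [//|q s] _ /=.
have : q \in [seq q <- L | clamp q == clamp p] by rewrite E mem_head.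
by rewrite mem_filter /F => /andP[/eqP ->].
Qed.

Lemma run_asked k : flatten (run (T := tester) w f k) =
  [seq (clamp p, F p) | p <- asked S tt w F (minn k r)].
Proof.
elim: k => [|k IH]; first by rewrite min0n.
rewrite /= -cats1 flatten_cat IH /= cats0 /tester_batch size_run.
case: ltnP => [kr|rk]; last first.
  by rewrite (minn_idPr (leqW rk)) cats0.
rewrite (minn_idPl kr) /asked -addn1 iotaD map_cat flatten_cat map_cat.
congr (_ ++ _); rewrite /= cats0 -map_comp add0n; rewrite (minn_idPl (ltnW kr)) in IH.
rewrite (@S_adaptive tt w F (lookup (run (T := tester) w f k)) k) //.
exact: lookup_map.
Qed.

Lemma tester_queries k : num_queries (T := tester) k w f = size (asked S tt w F (minn k r)).
Proof.
rewrite /num_queries -/(shape _) -size_flatten.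
by have := congr1 size (run_asked k); rewrite size_map.
Qed.

Lemma tester_verdictE k : accepts (T := tester) k w f = ~~ has132 F (asked S tt w F (minn k r)).
Proof.
rewrite /accepts /= /tester_verdict run_asked; congr (~~ _).
set L := asked _ _ _ _ _.
apply/hasP/has132P => [[_ /mapP[a aL ->] /hasP[_ /mapP[b bL ->] /hasP[_ /mapP[c cL ->] /= /and4P[ab bc ac cb]]]]|].
  exists a, b, c; split=> //; apply/and4P; split=> //.
    by rewrite ltnNge; apply: contraL ab => /clamp_mono; rewrite -leqNgt.
  by rewrite ltnNge; apply: contraL bc => /clamp_mono; rewrite -leqNgt.
move=> [a [b [c [aL bL cL /and4P[ab bc ac cb]]]]].
have lt p q : p < q -> F p != F q -> clamp p < clamp q.
  move=> pq ne; rewrite ltn_neqAle (clamp_mono (ltnW pq)) andbT.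
  by apply: contra ne => /eqP/val_inj E; rewrite /F E.
exists (clamp a, F a); first exact: (map_f (fun p => (clamp p, F p))).
apply/hasP; exists (clamp b, F b); first exact: (map_f (fun p => (clamp p, F p))).
apply/hasP; exists (clamp c, F c); first exact: (map_f (fun p => (clamp p, F p))).
apply/and4P; split=> //; apply: lt => //; first by rewrite lt_eqF // (lt_trans ac).
by rewrite gt_eqF.
Qed.

End Run.

Lemma tester_free f k w : free132 f -> accepts (T := tester) k w f.
Proof.
move=> fr; rewrite tester_verdictE; apply/negP => /has132P[a [b [c [_ _ _ /and4P[ab bc ac cb]]]]].
have lt p q : p < q -> f (clamp p) != f (clamp q) -> clamp p < clamp q.
  move=> pq ne; rewrite ltn_neqAle (clamp_mono (ltnW pq)) andbT.
  by apply: contra ne => /eqP/val_inj E; rewrite E.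
apply: fr; exists (clamp a), (clamp b), (clamp c); split=> //; apply: lt => //.
  by rewrite lt_eqF // (lt_trans ac).
by rewrite gt_eqF.
Qed.

Lemma tester_reject f k : r <= k ->
  reject_pr tester k f = winpr R r S tt (fun p => f (clamp p)) [::].
Proof.
move=> rk; rewrite /reject_pr /winpr /pr /= sumr_const -[LHS]mulr_natl; congr (_%:R * _)%R.
apply: eq_card => w.
have E : ~~ accepts (T := tester) k w f = has132 (fun p => f (clamp p)) (asked S tt w (fun p => f (clamp p)) r).
  by rewrite tester_verdictE negbK (minn_idPr rk).
exact: E.
Qed.

End Tester.

(** * Query complexity *)

(** With [Q = q * K ^ 6] the dominant term is of order [K * r * Q ^ 2], hence [K ^ 14]. *)
Lemma budget_le r K q : 0 < K -> r <= K -> budget r K (q * K ^ 6) <= budget 1 1 q * K ^ 14.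
Proof.
move=> K0 rK; have KX a b : a <= b -> K ^ a <= K ^ b by move=> ab; rewrite leq_pexp2l.
have K12 := KX 12 14 isT; have K13 := KX 7 13 isT.
have E2 : (q * K ^ 6) ^ 2 = q ^ 2 * K ^ 12 by rewrite expnMn -expnM.
have E7 : K * K ^ 6 = K ^ 7 by rewrite -expnS.
have E14 : K ^ 14 = K * K ^ 13 by rewrite -expnS.
have E13 : K ^ 13 = K * K ^ 12 by rewrite -expnS.
have K6 := KX 6 13 isT.
have D1 : 1 + 128 * r <= (1 + 128) * K by rewrite mulnDl mul1n leq_add // leq_mul2l rK.
rewrite /budget E2 !muln1; move: (2 ^ 15) 100 512 (1 + 128) (1 + 128 * r) D1 E14 E13 K12 K6 => A B C D D' D1 E14 E13 K12 K6.
rewrite [leqRHS]mulnDl; apply: leq_add.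
  by rewrite mulnA leq_mul2l K12 orbT.
rewrite E14; move: (K ^ 6) (K ^ 12) (K ^ 13) K6 E13 (q ^ 2) => k6 k12 k13 K6 E13 q2.
have H : 2 * (q * k6) + D' * (C * (q2 * k12)) <= (2 * q + D * (C * q2)) * k13.
  rewrite [leqRHS]mulnDl; apply: leq_add; first by rewrite mulnA leq_mul2l K6 orbT.
  apply: leq_trans (leq_mul D1 (leqnn _)) _; rewrite E13; apply: eq_leq; ring.
apply: leq_trans (leq_mul (leqnn (B * K)) H) _; apply: eq_leq; ring.
Qed.

Lemma split_cost_gt0 r K Q : 0 < split_cost r K Q.
Proof. by rewrite /split_cost add1n. Qed.

Lemma split_cost_le r K : 0 < K -> r <= K ->
  split_cost r K (16 * K ^ 6) <= split_cost 1 1 16 * K ^ 17.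
Proof.
move=> K0 rK; have := budget_le 16 K0 rK; rewrite /split_cost.
have K17 : K ^ 17 = K ^ 3 * K ^ 14 by rewrite -expnD.
have : 0 < K ^ 17 by rewrite expn_gt0 K0.
move: (budget r K _) (budget 1 1 16) => b b1 k17 bb.
rewrite exp1n muln1 [leqRHS]mulnDl mul1n leq_add // K17.
apply: leq_trans (leq_mul (leqnn _) bb) _; apply: eq_leq.
by move: (K ^ 3) (K ^ 14) => k3 k14; ring.
Qed.

Section Asymptotics.
Variable R : realType.
Local Open Scope ring_scope.

Lemma ln2_gt0 : 0 < ln 2 :> R.
Proof. by rewrite ln_gt0 // ltr1n. Qed.

Lemma up_log2_le n : (1 < n)%N -> (up_log 2 n)%:R <= 2 * log2 n%:R :> R.
Proof.
move=> n1; have l2 := ln2_gt0.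
have lg k : (2 ^ k < n)%N || (2 ^ k <= n)%N -> k%:R <= log2 n%:R :> R.
  move=> kn; have {}kn : (2 ^ k <= n)%N by case/orP: kn => // /ltnW.
  rewrite /log2 ler_pdivlMr // mulr_natl -lnXn ?ltr0n // ler_ln ?posrE ?exprn_gt0 ?ltr0n ?(ltnW n1) //.
  by rewrite -natrX ler_nat.
have e0 : (0 < up_log 2 n)%N by rewrite up_log_gt0 n1.
have := lg _ (introT orP (or_introl (up_log_gtn (isT : (1 < 2)%N) n1))).
have := lg 1%N; rewrite expn1 n1 orbT => /(_ isT).
rewrite -[in X in _ -> _ -> X](prednK e0) -natr1; lra.
Qed.

(** For [r <= e], [g] exceeds [(e - 1) / (r + 1)] by less than 1, and [2 ^ (e - 1) < n]. For [r > e]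
    the hypothesis leaves [g <= 1], which the factor 2 covers. *)
Lemma exp_gap_le n r g : (1 < n)%N -> let e := up_log 2 n in
  (g * (minn r e).+1 <= e.-1 + minn r e)%N ->
  (2 ^ g)%:R <= 2 * n%:R `^ (r.+1%:R)^-1 :> R.
Proof.
move=> n1 e; set y := _ `^ _ => gle.
have n0 : (0 : R) < n%:R by rewrite ltr0n ltnW.
have y0 : 0 <= y by rewrite powR_ge0.
have yX : y ^+ r.+1 = n%:R.
  by rewrite -powR_mulrn // -powRrM mulVf ?powRr1 ?ltW // pnatr_eq0.
have H : (2 ^ (g * r.+1) <= 2 ^ r.+1 * n)%N.
  have en : (2 ^ e.-1 < n)%N by apply: up_log_gtn.
  have e0 : (0 < e)%N by rewrite up_log_gt0 n1.
  have [re|er] := leqP r e.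
    rewrite (minn_idPl re) in gle.
    apply: (@leq_trans (2 ^ (e.-1 + r))); first by rewrite leq_exp2l.
    by rewrite expnD mulnC leq_mul ?leq_exp2l // ltnW.
  rewrite (minn_idPr (ltnW er)) in gle.
  have g1 : (g <= 1)%N.
    rewrite leqNgt; apply/negP => g2.
    have := leq_trans (leq_mul g2 (leqnn e.+1)) gle; lia.
  apply: (@leq_trans (2 ^ r.+1)); last by rewrite leq_pmulr // ltnW.
  by rewrite leq_exp2l // -[leqRHS]mul1n leq_mul2r g1 orbT.
rewrite -(@ler_pXn2r _ r.+1) ?nnegrE ?ler0n ?mulr_ge0 //.
by rewrite exprMn yX -!natrX -natrM ler_nat -expnM.
Qed.

End Asymptotics.

Lemma clampE n' (i : 'I_n'.+1) : clamp n' i = i.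
Proof.
have i_le : i <= n' by rewrite -ltnS.
by apply: val_inj; rewrite /= inordK (minn_idPl i_le).
Qed.

Lemma gap_ge e r : e <= (e + r) %/ r.+1 * r.+1.
Proof.
have := divn_eq (e + r) r.+1; have := ltn_pmod (e + r) (isT : 0 < r.+1).
by move: (_ %% _) (_ %/ _ * _) => u v; lia.
Qed.

(** The level width is [(e - 1) / (r1 + 1)] rounded up, as a searched half has exponent at most
    [e - 1]. The rounds are cut at [e], where the width is already at most 1. *)
Definition finder_for {R : realType} n r M : @strat _ R unit :=
  let e := up_log 2 n in let r1 := minn r e in
  finder e ((e.-1 + r1) %/ r1.+1) r1 (e + 6) (16 * (e + 6) ^ 6) M.

Section Main.
Variable R : realType.
Local Open Scope ring_scope.

Lemma far_lt1 n (f : 'I_n.+1 -> R) eps : far132 eps f -> eps < 1.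
Proof.
move=> far.
have fr : free132 (fun=> 0 : R) by move=> ? [i [j [l [_ _]]]]; rewrite ltxx.
have H : eps * n.+1%:R < n.+1%:R.
  apply: lt_le_trans (far _ (fr n.+1)) _.
  by rewrite ler_nat -[leqRHS]card_ord max_card.
by rewrite -(ltr_pM2r (_ : 0 < n.+1%:R :> R)) ?mul1r ?ltr0n.
Qed.

Lemma far_gt1 n (f : 'I_n.+1 -> R) eps : 0 < eps -> far132 eps f -> (0 < n)%N.
Proof.
move=> eps0 far; rewrite lt0n; apply/eqP => n0; subst n.
have fr : free132 f by move=> [i [j [l []]]]; rewrite !ord1.
have := far f fr; rewrite (_ : [set i | _] = set0) ?cards0; last first.
  by apply/setP => i; rewrite !inE eqxx.
by rewrite mulr1 ltNge ltW.
Qed.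

Lemma finder_detects n (f : 'I_n.+1 -> R) eps r M : (0 < r)%N -> 0 < eps -> far132 eps f ->
  (48 * up_log 2 n.+1 ^ 2)%:R <= M%:R * eps ->
  2 / 3 <= winpr R (minn r (up_log 2 n.+1)) (finder_for n.+1 r M) tt (fun p => f (clamp n p)) [::].
Proof.
move=> r0 eps0 far ME; have n0 := far_gt1 eps0 far.
rewrite /finder_for /=; set e := up_log 2 n.+1 in ME *; set r1 := minn r e.
have e0 : (0 < e)%N by rewrite up_log_gt0.
have r10 : (0 < r1)%N by rewrite leq_min r0.
have r1e : (r1 <= e)%N by rewrite geq_minr.
have [S [pS epsS]] := far_packing far.
have ne : (n.+1 <= 2 ^ e)%N by apply: up_logP.
have en : (2 ^ e <= 2 * n.+1)%N.
  by rewrite -(prednK e0) expnS leq_mul2l /= ltnW // up_log_gtn // ltnS.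
have S0 : (0 < #|S|)%N.
  rewrite lt0n; apply/eqP => E; move: epsS; rewrite E muln0 ltNge mulr_ge0 ?ler0n // ltW //.
pose I : finType := {t | t \in S}.
have cI : #|{: I}| = #|S| by rewrite card_sig.
have vS (u : I) : val u \in S := valP u.
have inj (g : 'I_n.+1 * 'I_n.+1 * 'I_n.+1 -> 'I_n.+1) : (forall t, g t \in pts t) ->
    injective (fun u : I => nat_of_ord (g (val u))).
  move=> gP u v /val_inj E; apply: val_inj; exact: (packing_inj pS gP) (vS u) (vS v) E.
have cp (u : I) : is_copy f (val u).
  by have /andP[/forall_inP/(_ _ (vS u))] := pS.
apply: (@finder_win _ R e ((e.-1 + r1) %/ r1.+1) r1 (e + 6) (16 * (e + 6) ^ 6) M R (fun p => f (clamp n p)) I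
  (fun u : I => (val u).1.1) (fun u : I => (val u).1.2) (fun u : I => (val u).2)) => //.
- by rewrite (leq_ltn_trans r1e) // -addn1 leq_add2l.
- by rewrite ltn_add2l.
- by rewrite -(prednK e0) /= ltnS; exact: gap_ge.
- by apply: (inj (fun t => t.1.1)) => t; rewrite mem_head.
- by apply: (inj (fun t => t.1.2)) => t; rewrite !inE eqxx orbT.
- by apply: (inj (fun t => t.2)) => t; rewrite !inE eqxx !orbT.
- move=> u; rewrite !clampE; have := cp u; case: (val u) => [[i j] l] /=.
  by move=> /and4P[-> -> -> ->].
- by move=> u; apply: leq_trans (ltn_ord _) ne.
(* [48 = 8 * 2 * 3]: the 8 of [finder_win], [2 ^ e <= 2 * n.+1], and three points per copy. *)
- rewrite cI; move: (e ^ 2)%N (2 ^ e)%N ME epsS en => E2 E; rewrite -!(ler_nat R) -(ler_pM2r eps0) !natrM.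
  move: E%:R E2%:R n.+1%:R M%:R #|S|%:R (ler0n R E2) (ler0n R #|S|) => {}E {}E2 N m s E20 s0 ME epsS en.
  have H1 : 48 * E2 * s <= m * eps * s by rewrite ler_wpM2r.
  have H2 : eps * E <= 6 * s by nra.
  have H3 : E2 * (eps * E) <= E2 * (6 * s) by rewrite ler_wpM2l.
  nra.
by rewrite cI.
Qed.

Lemma poly_cost (s c e k g M p : nat) (y L : R) :
  (0 < p)%N -> (s <= c * k ^ p)%N -> (k <= 7 * e)%N -> (2 ^ g)%:R <= 2 * y -> e%:R <= 2 * L ->
  (4 * e ^ 2 * s * M * 2 ^ g)%:R <=
  8 * (c * 7 ^ p)%:R * 2 ^+ (p + 2) * L ^+ (p + 2) * M%:R * y.
Proof.
move=> p0 sk ke gy eL.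
have se : (4 * e ^ 2 * s <= 4 * (c * 7 ^ p) * e ^ (p + 2))%N.
  have -> : (4 * (c * 7 ^ p) * e ^ (p + 2) = 4 * e ^ 2 * (c * (7 ^ p * e ^ p)))%N.
    by rewrite expnD; ring.
  rewrite leq_mul2l; apply/orP; right; apply: leq_trans sk _.
  by rewrite leq_mul2l -expnMn leq_exp2r // ke orbT.
have eX : (e ^ (p + 2))%:R <= 2 ^+ (p + 2) * L ^+ (p + 2).
  by rewrite natrX -exprMn lerXn2r // nnegrE // (le_trans _ eL).
move: (4 * e ^ 2 * s)%N (c * 7 ^ p)%N (e ^ (p + 2))%N (2 ^ g)%N se eX gy => a cc ee gg se eX gy.
rewrite -[_ * 2 ^+ _ * _]mulrA; move: (2 ^+ (p + 2) * L ^+ (p + 2)) eX => t eX.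
have {}se : a%:R <= 4 * cc%:R * t.
  apply: le_trans (_ : (4 * cc * ee)%:R <= _); first by rewrite ler_nat.
  by rewrite !natrM ler_wpM2l // mulr_ge0.
have := ler_pM (ler0n R (a * M)) (ler0n R gg) _ gy; rewrite !natrM => H.
apply: le_trans (H (4 * cc%:R * t * M%:R) _) _; first by rewrite ler_wpM2r.
by rewrite le_eqVlt; apply/orP; left; apply/eqP; ring.
Qed.

Lemma finder_for_cost : exists N : nat, (0 < N)%N /\
  forall n r M w (F : nat -> R), (1 < n)%N ->
  (size (asked (finder_for n r M) tt w F (minn r (up_log 2 n))))%:R <=
  8 * N%:R * 2 ^+ (17 + 2) * log2 n%:R ^+ (17 + 2) * M%:R * n%:R `^ (r.+1%:R)^-1 :> R.
Proof.
exists (split_cost 1 1 16 * 7 ^ 17)%N; split=> [|n r M w F n1].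
  have H u v p : (0 < u -> 0 < v -> 0 < u * v ^ p)%N by rewrite muln_gt0 expn_gt0 => -> ->.
  exact (H _ 7%N 17%N (split_cost_gt0 1 1 16) isT).
have e0 : (0 < up_log 2 n)%N by rewrite up_log_gt0 n1.
have K7 : (up_log 2 n + 6 <= 7 * up_log 2 n)%N by rewrite mulSn leq_add2l leq_pmulr.
apply: le_trans (poly_cost M (isT : (0 < 17)%N) (split_cost_le _ _) K7 (exp_gap_le R (r := r) n1 _) (up_log2_le R n1)).
- by rewrite ler_nat; exact: finder_cost.
- by rewrite addn_gt0 e0.
- by apply: leq_trans (geq_minr _ _) (leq_addr _ _).
exact: leq_trunc_div.
Qed.

End Main.
Local Open Scope ring_scope.

Theorem theorem3p13 (R : realType) (a : nat) :
  exists (C : R) (b : nat), 0 < C /\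
    forall (n r : nat) (eps : R),
      (0 < n)%N -> (1 <= r)%N -> r%:R <= log2 (n%:R : R) ^+ a -> 0 < eps ->
      exists T : round_tester R n,
        one_sided_test132 T r eps /\
        forall (f : 'I_n -> R) (w : coins T),
          (num_queries r w f)%:R <=
            C * log2 (n%:R : R) ^+ b * (eps^-1 * n%:R `^ (r.+1%:R)^-1).
Proof.
have [N [N0 cost]] := finder_for_cost R.
pose c := 8 * N%:R * 2 ^+ (17 + 2) : R.
have c0 : 0 < c by rewrite !mulr_gt0 ?exprn_gt0 // ltr0n.
(* The exponent 17 is [K ^ 3] guesses times a budget of order [K ^ 14]; one 2 comes from the pairs
   of scale and density, the other from [e ^ 2] in [M]. [49 = 48 + 1] absorbs the rounding of [M],
   and 4 is from [e <= 2 * L] squared. *)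
exists (c * 49 * 4), (17 + 2 + 2)%N; split; first by rewrite (mulr_gt0 (mulr_gt0 c0 _)) ?ltr0n.
case=> // n r eps _ r1 _ eps0.
set L := log2 _; set y := _ `^ _; set e := up_log 2 n.+1.
(* For [eps >= 1] no sequence is far, and nothing is queried. *)
pose M := if eps < 1 then (Num.truncn (48 * e%:R ^+ 2 / eps)).+1 else 0%N.
have ad : adaptive (fun=> [::]) (finder_for n.+1 r M : strat unit) := @finder_adaptive _ R _ _ _ _ _ _.
have co : coined (finder_for n.+1 r M : @strat _ R unit) := @finder_coined _ R _ _ _ _ _ _.
exists (tester n (minn r e) co); split; first split.
- by move=> f fr w; exact: tester_free.
- move=> f far; rewrite (tester_reject ad co) ?geq_minl //; apply: (finder_detects r1 eps0 far).
  rewrite /M (far_lt1 far) -ler_pdivrMr // natrM natrX; apply: ltW; exact: truncnS_gt.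
move=> f w; rewrite (@tester_queries R n (minn r e) _ ad co) (minn_idPr (geq_minl _ _)).
have y0 : 0 <= y := powR_ge0 _ _.
(* At length 1 the bound is 0 because [log2 1 = 0]; there [e = 0] and no query is made. *)
case: (ltnP 1 n.+1) => n1; last first.
  have n0 : n = 0%N by case: (n) n1.
  have -> : (size (asked (finder_for n.+1 r M) tt w (fun p => f (clamp n p)) (minn r e)) = 0)%N.
    apply/eqP; rewrite -leqn0; apply: leq_trans (@finder_cost _ R _ _ _ _ _ _ _ _ _) _.
    by rewrite n0 /= exp0n // muln0 !mul0n.
  have L0 : L = 0 by rewrite /L n0 /log2 ln1 mul0r.
  by rewrite L0 expr0n mulr0 mul0r.
apply: le_trans (cost _ r M w _ n1) _; rewrite -/c -/L -/y.
have eL : e%:R <= 2 * L :> R := up_log2_le R n1.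
have e0 : (1 : R) <= e%:R by rewrite ler1n up_log_gt0 n1.
have L0 : 0 <= L by lra.
have Mle : M%:R <= 49 * 4 * L ^+ 2 / eps.
  have e2 : e%:R ^+ 2 <= 4 * L ^+ 2 :> R by rewrite !expr2; nra.
  have e21 : (1 : R) <= e%:R ^+ 2 by rewrite expr2; nra.
  rewrite /M; case: ifP => [eps1|_]; last first.
    by apply: divr_ge0; [apply: mulr_ge0; rewrite ?exprn_ge0|exact: ltW].
  rewrite -natr1; apply: le_trans (_ : 49 * e%:R ^+ 2 / eps <= _); last first.
    by rewrite ler_pM2r ?invr_gt0 // -mulrA ler_pM2l.
  have x0 : 0 <= 48 * e%:R ^+ 2 / eps.
    by apply: divr_ge0; [apply: mulr_ge0; rewrite ?exprn_ge0|exact: ltW].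
  have /andP[Hf _] := truncn_itv x0.
  have : 1 <= e%:R ^+ 2 / eps by rewrite ler_pdivlMr // mul1r (le_trans (ltW eps1)).
  rewrite -!mulrA in Hf *; lra.
have -> : c * 49 * 4 * L ^+ (17 + 2 + 2) * (eps^-1 * y) = c * L ^+ (17 + 2) * (49 * 4 * L ^+ 2 / eps) * y.
  by rewrite (exprD L (17 + 2)); ring.
by rewrite ler_wpM2r // ler_wpM2l // mulr_ge0 ?exprn_ge0 // ltW.
Qed.
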